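(* Let $(M,\eta,g_M)$ be a contact metric manifold and let $\mu$ be a compatible connection. Then the symplectic form $\omega$ and the Riemannian metric $g$ defined on the trivial $\mathbb{R}_+$-bundle $P=M\times\mathbb{R}_+$ by $$\omega(x,s)=\mathrm{d}s\wedge\eta(x)+s\cdot\mathrm{d}\eta(x),\qquad g(x,s)=s\Big(\big(\tfrac{\mathrm{d}s}{s}+\mu(x)\big)^2+g_M(x)\Big)$$ constitute a homogeneous almost-K\''ahler structure. Moreover, any homogeneous almost-K\''ahler structure on a principal $\mathbb{R}_+$-bundle is of this form in a certain trivialization.
   Context: $\mathbb{R}_+$ is the multiplicative group of positive reals; forms on $M$ are identified with their pullbacks to $P$. Conventions: $\mathrm{d}\eta(X,Y)=X\eta(Y)-Y\eta(X)-\eta([X,Y])$, $(\alpha\wedge\beta)(X,Y)=\alpha(X)\beta(Y)-\alpha(Y)\beta(X)$, $\alpha^2=\alpha\otimes\alpha$. A homogeneous almost-K\''ahler structure on a principal $\mathbb{R}_+$-bundle $P\to M$ with action $t\mapsto h_t$ is a pair $(\omega,g)$ of a symplectic form and a Riemannian metric on $P$ with $h_t^*\omega=t\omega$, $h_t^*g=tg$ for all $t>0$, such that the $(1,1)$-tensor $J$ defined by $g(X,Y)=\omega(X,J(Y))$ satisfies $J^2=-\mathrm{id}$. Let $(M,\eta)$ be a manifold of dimension $2n+1$ with a contact form $\eta$ (i.e. $\eta\wedge(\mathrm{d}\eta)^n\neq0$), and $C=\ker\eta$. A Riemannian metric $g_M$ on $M$ is a Levi metric if $g_M(Z,Z)=|\eta(Z)|^2$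 for every vector field $Z$ with values in the line bundle $L=C^\perp$ ($g_M$-orthogonal complement of $C$), and the map $\phi_C:C\to C$ defined by $g_M(X,Y)=\mathrm{d}\eta(X,\phi_C(Y))$, $X,Y\in C$, satisfies $\phi_C^2=-\mathrm{id}_C$. Then $(M,\eta,g_M)$ is called a contact metric manifold. The split vector field $A$ is the unique section of $C^\perp$ with $\eta(A)=1$, and the associated 1-form is $\nu=i_A\mathrm{d}\eta$. A compatible connection is any 1-form $\mu$ on $M$ extending $\nu|_C$, i.e. such that $\mu(X)=\mathrm{d}\eta(A,X)$ for all $X\in C$.
   Formalization: A compatible connection is taken with μ(X)=dη(X,A) for X∈C instead of μ(X)=dη(A,X); with the stated conventions the original sign makes J²=−id fail unless i_A dη vanishes on C, where both signs agree. *)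

(* Defs.v *)
From HB Require Import structures.
From mathcomp Require Import all_boot all_order all_algebra all_fingroup.
From mathcomp Require Import all_classical all_reals all_analysis.

Set Implicit Arguments.
Unset Strict Implicit.
Unset Printing Implicit Defensive.
Import Order.TTheory GRing.Theory Num.Theory.
Import numFieldNormedType.Exports.
Local Open Scope classical_set_scope.
Local Open Scope ring_scope.

(* For finite-dimensional V and open U, [Ck k.+1] together with [Ck 0] is the
   usual class C^(k+1): directional derivatives exist on U in every direction
   and are C^k there. *)
Fixpoint Ck (R : realType) (V W : normedModType R) (k : nat) (U : set V)
    (f : V -> W) : Prop :=
  if k is k'.+1 then
    (forall x v, U x -> derivable f x v) /\
    (forall v, Ck k' U (fun x => 'D_v f x : W))
  else forall x, U x -> {for x, continuous f}.

Definition Csmooth (R : realType) (V W : normedModType R) (U : set V)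
    (f : V -> W) : Prop := forall k, Ck k U f.

Record chart (R : realType) (m : nat) (T : topologicalType) := Chart {
  cdom : set T;
  cimg : set 'rV[R]_m;
  cmap : T -> 'rV[R]_m;
  cinv : 'rV[R]_m -> T;
  cdom_open : open cdom;
  cimg_open : open cimg;
  cmap_img : forall p, cdom p -> cimg (cmap p);
  cinv_dom : forall y, cimg y -> cdom (cinv y);
  cmapK : forall p, cdom p -> cinv (cmap p) = p;
  cinvK : forall y, cimg y -> cmap (cinv y) = y;
  cmap_cont : forall p, cdom p -> {for p, continuous cmap};
  cinv_cont : forall y, cimg y -> {for y, continuous cinv} }.

(* [chart_at p] is a chosen chart of the atlas around p; the tangent space at p
   is represented by 'rV[R]_m, a row vector being the coordinates of a tangent
   vector in [chart_at p]. *)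
Record manifold (R : realType) (m : nat) := Manifold {
  mcarrier :> topologicalType;
  atlas : set (chart R m mcarrier);
  chart_at : mcarrier -> chart R m mcarrier;
  atlas_chart_at : forall p, atlas (chart_at p);
  mem_chart_at : forall p, cdom (chart_at p) p;
  atlas_smooth : forall c c', atlas c -> atlas c' ->
    Csmooth (cmap c @` (cdom c `&` cdom c')) (cmap c' \o cinv c);
  manifold_hausdorff : hausdorff_space mcarrier;
  manifold_second_countable : @second_countable mcarrier;
  manifold_nonempty : inhabited mcarrier }.

Section Maps.
Variables (R : realType) (m k : nat) (M : manifold R m) (N : manifold R k).

Definition smooth_on (A : set M) (F : M -> N) : Prop :=
  [/\ open A, (forall p, A p -> {for p, continuous F}) &
      forall (c : chart R m M) (c' : chart R k N), atlas c -> atlas c' ->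
        Csmooth (cmap c @` (A `&` cdom c `&` F @^-1` cdom c'))
                (cmap c' \o F \o cinv c)].

(* tangent map T_p M -> T_(F p) N *)
Definition tmap (F : M -> N) (p : M) (u : 'rV[R]_m) : 'rV[R]_k :=
  'D_u (cmap (chart_at (F p)) \o F \o cinv (chart_at p)) (cmap (chart_at p) p).

End Maps.

Section Forms.
Variables (R : realType) (m : nat) (M : manifold R m).

Definition form1 := M -> 'rV[R]_m -> R.
Definition form2 := M -> 'rV[R]_m -> 'rV[R]_m -> R.

(* the tangent vector at q whose coordinates in the chart c are u, i.e. the
   value at q of the coordinate vector field \sum_i u_i d/dx^i of c *)
Definition coord_vec (c : chart R m M) (u : 'rV[R]_m) (q : M) : 'rV[R]_m :=
  'D_u (cmap (chart_at q) \o cinv c) (cmap c q).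

(* components in the chart c, as functions on the image of c *)
Definition comp1 (eta : form1) (c : chart R m M) (u : 'rV[R]_m)
    (y : 'rV[R]_m) : R :=
  eta (cinv c y) (coord_vec c u (cinv c y)).

Definition comp2 (B : form2) (c : chart R m M) (u v : 'rV[R]_m)
    (y : 'rV[R]_m) : R :=
  B (cinv c y) (coord_vec c u (cinv c y)) (coord_vec c v (cinv c y)).

Definition smooth_form1 (eta : form1) : Prop :=
  (forall p, scalar (eta p)) /\
  (forall c, atlas c -> forall u, Csmooth (cimg c) (comp1 eta c u)).

Definition smooth_bilin (B : form2) : Prop :=
  [/\ forall p u, scalar (B p u), forall p v, scalar (B p ^~ v) &
      forall c, atlas c -> forall u v, Csmooth (cimg c) (comp2 B c u v)].

Definition smooth_form2 (om : form2) : Prop :=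
  smooth_bilin om /\ forall p u, om p u u = 0.

(* differential of a function *)
Definition dfun (f : M -> R) : form1 := fun p u =>
  'D_u (f \o cinv (chart_at p)) (cmap (chart_at p) p).

(* d eta (X, Y) = X (eta Y) - Y (eta X) - eta [X, Y], evaluated at p on the
   coordinate fields X, Y of [chart_at p] extending u and v; these commute. *)
Definition extd1 (eta : form1) : form2 := fun p u v =>
  let c := chart_at p in
  'D_u (comp1 eta c v) (cmap c p) - 'D_v (comp1 eta c u) (cmap c p).

(* same for 2-forms *)
Definition extd2 (om : form2) (p : M) (u v w : 'rV[R]_m) : R :=
  let c := chart_at p in
  'D_u (comp2 om c v w) (cmap c p) + 'D_v (comp2 om c w u) (cmap c p)
  + 'D_w (comp2 om c u v) (cmap c p).

Definition closed_form2 (om : form2) : Prop :=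
  forall p u v w, extd2 om p u v w = 0.

Definition symplectic (om : form2) : Prop :=
  [/\ smooth_form2 om, closed_form2 om &
      forall p u, u != 0 -> exists v, om p u v != 0].

Definition riemannian (g : form2) : Prop :=
  [/\ smooth_bilin g, forall p u v, g p u v = g p v u &
      forall p u, u != 0 -> 0 < g p u u].

Definition wedge1 (al be : form1) : form2 := fun p u v =>
  al p u * be p v - al p v * be p u.

Definition sq1 (al : form1) : form2 := fun p u v => al p u * al p v.

End Forms.

Section Pullback.
Variables (R : realType) (m k : nat) (M : manifold R m) (N : manifold R k).

Definition pull1 (F : M -> N) (eta : form1 N) : form1 M := fun p u =>
  eta (F p) (tmap F p u).

Definition pull2 (F : M -> N) (B : form2 N) : form2 M := fun p u v =>
  B (F p) (tmap F p u) (tmap F p v).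

End Pullback.

Section Wedge.
Variables (R : realType) (V : Type).

(* Normalized so that (al /\ be)(X, Y) = al X * be Y - al Y * be X
   for p = q = 1. *)
Definition wedge (p q : nat) (al : ('I_p -> V) -> R) (be : ('I_q -> V) -> R)
    (v : 'I_(p + q) -> V) : R :=
  (p`! * q`!)%:R^-1 *
  \sum_(s : 'S_(p + q)) (-1) ^+ s *
    (al (fun i => v (s (lshift q i))) * be (fun j => v (s (rshift p j)))).

Fixpoint wedge_exp (Om : V -> V -> R) (n : nat) {struct n} :
    ('I_n.*2 -> V) -> R :=
  if n is n'.+1 then
    wedge (p := 2) (q := n'.*2) (fun v => Om (v ord0) (v ord_max))
          (@wedge_exp Om n')
  else fun=> 1.

End Wedge.

Section Contact.
Variables (R : realType) (m : nat) (M : manifold R m).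

Definition contact_form (eta : form1 M) : Prop :=
  smooth_form1 eta /\
  exists2 n, m = n.*2.+1 &
    forall p, exists v : 'I_(1 + n.*2) -> 'rV[R]_m,
      wedge (p := 1) (fun w => eta p (w ord0)) (@wedge_exp R _ (extd1 eta p) n) v
      != 0.

(* the g-orthogonal complement of C = ker eta *)
Definition ker_perp (eta : form1 M) (g : form2 M) (p : M) (z : 'rV[R]_m) :=
  forall u, eta p u = 0 -> g p z u = 0.

Definition levi_metric (eta : form1 M) (g : form2 M) : Prop :=
  [/\ riemannian g,
      forall p z, ker_perp eta g p z -> g p z z = `|eta p z| ^+ 2 &
      exists phi : M -> 'rV[R]_m -> 'rV[R]_m,
        forall p v, eta p v = 0 ->
        [/\ eta p (phi p v) = 0,
            forall u, eta p u = 0 -> g p u v = extd1 eta p u (phi p v) &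
            phi p (phi p v) = - v]].

Definition contact_metric (eta : form1 M) (g : form2 M) : Prop :=
  contact_form eta /\ levi_metric eta g.

Definition split_field (eta : form1 M) (g : form2 M)
    (A : M -> 'rV[R]_m) : Prop :=
  forall p, ker_perp eta g p (A p) /\ eta p (A p) = 1.

(* Pitfall: with the sign conventions of [extd1] and [wedge1], the forms
   [omega_of] and [g_of] below require mu X = d eta (X, A) on C, i.e. i_A
   contracts the last slot.  With the opposite sign, mu X = d eta (A, X), the
   tensor J squares to -1 only if d eta (A, X) = 0 for all X in C. *)
Definition compatible (eta : form1 M) (g : form2 M) (mu : form1 M) : Prop :=
  smooth_form1 mu /\
  exists2 A, split_field eta g A &
    forall p u, eta p u = 0 -> mu p u = extd1 eta p u (A p).

End Contact.

Definition Rplus (R : realType) : Type :=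
  initial_topology (fun t : {posnum R} => t%:num).

Definition to_Rplus (R : realType) (x : R) : Rplus R :=
  if pselect (0 < x) is left h then PosNum h else 1%:pos.

Lemma Rplus_num_cont (R : realType) :
  continuous ((fun t => t%:num) : Rplus R -> R).
Proof. exact: initial_continuous. Qed.

Lemma Rplus_inj (R : realType) (s t : Rplus R) :
  (s : {posnum R})%:num = (t : {posnum R})%:num -> s = t.
Proof. by move=> h; apply: val_inj. Qed.

Lemma to_RplusK (R : realType) (t : Rplus R) : to_Rplus (t : {posnum R})%:num = t.
Proof.
rewrite /to_Rplus; case: pselect => [h|]; first exact: val_inj.
by case.
Qed.

Lemma to_Rplus_num (R : realType) (x : R) : 0 < x ->
  (to_Rplus x : {posnum R})%:num = x.
Proof. by rewrite /to_Rplus; case: pselect. Qed.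

Lemma to_Rplus_cont (R : realType) (x : R) : 0 < x ->
  {for x, continuous (@to_Rplus R)}.
Proof.
move=> x0 A; rewrite {1}nbhsE /= => -[U [[B oB <-] Bx] UA].
change (\forall y \near x, A (to_Rplus y)).
near=> y; apply: UA => /=; rewrite to_Rplus_num.
  near: y; apply: open_nbhs_nbhs; split => //.
  by move: Bx; rewrite /= to_Rplus_num.
by near: y; exact: lt_nbhsr.
Unshelve. all: by end_near. Qed.

Lemma row_mx_cont (R : realType) (T : topologicalType) (a b : nat)
  (f : T -> 'rV[R]_a) (g : T -> 'rV[R]_b) x :
  {for x, continuous f} -> {for x, continuous g} ->
  {for x, continuous (fun y => row_mx (f y) (g y))}.
Proof.
move=> cf cg A [P hP sPA].
have hf : \forall y \near x, forall i j, P i (lshift b j) (f y i j).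
  apply: (cf [set N : 'rV[R]_a | forall i j, P i (lshift b j) (N i j)]); exists (fun i j => P i (lshift b j)) => [i j|]; last first.
    by move=> N hN i j; apply: hN.
  by have := hP i (lshift b j); rewrite row_mxEl.
have hg : \forall y \near x, forall i j, P i (rshift a j) (g y i j).
  apply: (cg [set N : 'rV[R]_b | forall i j, P i (rshift a j) (N i j)]); exists (fun i j => P i (rshift a j)) => [i j|]; last first.
    by move=> N hN i j; apply: hN.
  by have := hP i (rshift a j); rewrite row_mxEr.
change (\forall y \near x, A (row_mx (f y) (g y))).
apply: filterS2 hf hg => y hf hg; apply: sPA => /= i j.
by case: (split_ordP j) => l -> /=; rewrite (row_mxEl, row_mxEr).
Qed.

Section CkTheory.
Variables (R : realType).
Implicit Types V W Z : normedModType R.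

Lemma Ck_sub V W k (U U' : set V) (f : V -> W) : U' `<=` U -> Ck k U f -> Ck k U' f.
Proof.
move=> s; elim: k f => [|k IH] f /=; first by move=> h x /s /h.
by move=> [h1 h2]; split => [x v /s|v]; [exact: h1|apply: IH].
Qed.

Lemma Ck_ext V W k (U : set V) (f g : V -> W) : open U ->
  (forall x, U x -> f x = g x) -> Ck k U f -> Ck k U g.
Proof.
move=> oU; elim: k f g => [|k IH] f g fg /=.
  move=> h x Ux; change (g @ x --> g x); rewrite -(fg x Ux).
  apply: cvg_trans (h x Ux); apply: near_eq_cvg.
  by near=> y; rewrite fg//; near: y; apply: open_nbhs_nbhs.
have nfg x : U x -> \forall y \near x, f y = g y.
  by move=> Ux; near=> y; rewrite fg//; near: y; apply: open_nbhs_nbhs.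
move=> [h1 h2]; split => [x v Ux|v].
  by apply: near_eq_derivable (h1 x v Ux); apply: nfg.
by apply: IH (h2 v) => x Ux; apply/near_eq_derive/nfg.
Unshelve. all: by end_near. Qed.

Lemma Ck_cst V W k (U : set V) (a : W) : Ck k U (fun=> a).
Proof.
elim: k a => [|k IH] a /=; first by move=> x _; exact: cst_continuous.
split => [x v _|v]; first exact: derivable_cst.
rewrite (_ : (fun x : V => 'D_v (fun=> a) x : W) = fun=> 0)//.
by apply/funext => x; rewrite derive_cst.
Qed.

Lemma Ck_lin_post V W Z k (U : set V) (f : V -> W) (L : {linear W -> Z}) :
  continuous L -> open U -> Ck k U f -> Ck k U (L \o f).
Proof.
move=> cL oU; elim: k f => [|k IH] f /=.
  by move=> h x Ux; apply: continuous_comp; [exact: h|exact: cL].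
have key x v : derivable f x v ->
    (fun h => h^-1 *: (((L \o f) \o shift x) (h *: v) - (L \o f) x)) @ 0^' -->
    L ('D_v f x).
  move=> /= df; rewrite (_ : (fun _ => _) =
    L \o (fun h => h^-1 *: ((f \o shift x) (h *: v) - f x))); last first.
    by apply/funext => h /=; rewrite (linearZ_LR L) (raddfB L).
  exact: (cvg_comp _ _ df (cL _)).
move=> [h1 h2]; split => [x v Ux|v].
  by apply/cvg_ex; exists (L ('D_v f x)); apply: key; exact: h1.
apply: (@Ck_ext _ _ _ _ (L \o (fun x => 'D_v f x : W))) => //; last exact: IH.
by move=> x Ux /=; apply/esym/cvg_lim => //; apply: key; exact: h1.
Qed.

Lemma Ck_add V W k (U : set V) (f g : V -> W) : open U ->
  Ck k U f -> Ck k U g -> Ck k U (f \+ g).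
Proof.
move=> oU; elim: k f g => [|k IH] f g /=.
  by move=> hf hg x Ux; apply: continuousD; [exact: hf|exact: hg].
move=> [f1 f2] [g1 g2]; split => [x v Ux|v].
  by apply: derivableD; [exact: f1|exact: g1].
apply: (@Ck_ext _ _ _ _ ((fun x => 'D_v f x : W) \+ (fun x => 'D_v g x : W))) => //.
  by move=> x Ux /=; rewrite -deriveD//; [exact: f1|exact: g1].
exact: IH.
Qed.

Lemma Ck_lin_pre V W Z k (U : set W) (f : W -> Z) (L : {linear V -> W}) :
  continuous L -> Ck k U f -> Ck k (L @^-1` U) (f \o L).
Proof.
move=> cL; elim: k f => [|k IH] f /=.
  by move=> h x Ux; apply: continuous_comp; [exact: cL|exact: h].
have key x v : (fun h => h^-1 *: (((f \o L) \o shift x) (h *: v) - (f \o L) x)) =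
     (fun h => h^-1 *: ((f \o shift (L x)) (h *: L v) - f (L x))).
  apply/funext => h /=; rewrite (raddfD L).
  congr (_ *: (f (_ + _) - _)); exact: linearZ_LR.
move=> [h1 h2]; split => [x v Ux|v].
  by rewrite /derivable key; exact: h1.
rewrite (_ : (fun x => 'D_v (f \o L) x : Z) = (fun x => 'D_(L v) f x : Z) \o L); first exact: IH.
by apply/funext => x /=; rewrite /derive key.
Qed.

Lemma Ck_id V k (U : set V) : Ck k U (id : V -> V).
Proof.
case: k => [|k] /=; first by move=> x _; exact: cvg_id.
split => [x v _|v]; first exact: derivable_id.
rewrite (_ : (fun x : V => 'D_v id x : V) = fun=> v); first exact: Ck_cst.
by apply/funext => x; rewrite derive_id.
Qed.

Lemma Ck_row_mx V k (U : set V) a b (f : V -> 'rV[R]_a) (g : V -> 'rV[R]_b) :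
  open U -> Ck k U f -> Ck k U g -> Ck k U (fun y => row_mx (f y) (g y)).
Proof.
move=> oU hf hg.
pose L1 : 'rV[R]_a -> 'rV[R]_(a + b) := row_mx^~ 0.
pose L2 : 'rV[R]_b -> 'rV[R]_(a + b) := row_mx 0.
have l1 : linear L1 by move=> c u v; rewrite /L1 scale_row_mx add_row_mx scaler0 addr0.
have l2 : linear L2 by move=> c u v; rewrite /L2 scale_row_mx add_row_mx scaler0 addr0.
pose M1 := GRing.isLinear.Build _ _ _ _ L1 l1.
pose M2 := GRing.isLinear.Build _ _ _ _ L2 l2.
pose LL1 : {linear _ -> _} := HB.pack L1 M1.
pose LL2 : {linear _ -> _} := HB.pack L2 M2.
rewrite (_ : (fun y => _) = (LL1 \o f) \+ (LL2 \o g)); last first.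
  by apply/funext => y /=; rewrite /L1 /L2 add_row_mx addr0 add0r.
apply: Ck_add => //; apply: Ck_lin_post => // x.
  apply: (@row_mx_cont R _ a b id (fun=> 0)); first exact: cvg_id.
  exact: cst_continuous.
apply: (@row_mx_cont R _ a b (fun=> 0) id); last exact: cvg_id.
exact: cst_continuous.
Qed.

End CkTheory.

Lemma openX (T U : topologicalType) (A : set T) (B : set U) :
  open A -> open B -> open (A `*` B).
Proof.
move=> oA oB; rewrite openE => -[x y] [/= Ax By].
by exists (A, B) => //=; split; exact: open_nbhs_nbhs.
Qed.

Lemma second_countable_prod (T U : topologicalType) :
  @second_countable T -> @second_countable U -> @second_countable (T * U)%type.
Proof.
move=> [B cB [oB bB]] [C cC [oC bC]].
exists ((fun AB => AB.1 `*` AB.2) @` (B `*` C)).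
  by apply/(sub_countable (card_image_le _ _))/countableX.
split=> [_ [[A D] [/= /oB oA /oC oD] <-]|[x y] N [[N1 N2] /= [n1 n2] sN]].
  exact: openX.
have [A [BA Ax] sA] := bB x _ n1; have [D [CD Dy] sD] := bC y _ n2.
exists (A `*` D); first by split => //; exists (A, D).
by move=> [a d] [/sA a1 /sD d1]; exact: sN.
Qed.

Lemma second_countable_Rplus (R : realType) : @second_countable (Rplus R).
Proof.
pose I (pq : rat * rat) : set (Rplus R) :=
  (fun t : {posnum R} => t%:num) @^-1` `]ratr pq.1, ratr pq.2[%classic.
exists (range I).
  exact: (sub_countable (card_image_le _ _)).
split=> [_ [pq _ <-]|t N].
  by exists (`]ratr pq.1, ratr pq.2[%classic) => //; exact: interval_open.
rewrite {1}nbhsE /= => -[U [[B oB <-] Bt] UN].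
have /nbhs_ballP[e /= e0 eB] : nbhs ((t : {posnum R})%:num : R) B by exact: open_nbhs_nbhs.
have [p] := @rat_in_itvoo R ((t : {posnum R})%:num - e) (t : {posnum R})%:num ltac:(by rewrite ltrBlDr ltrDl).
have [q] := @rat_in_itvoo R (t : {posnum R})%:num ((t : {posnum R})%:num + e) ltac:(by rewrite ltrDl).
rewrite !in_itv /= => /andP[q1 q2] /andP[p1 p2].
exists (I (p, q)).
  by split; [exists (p, q)|rewrite /I /= in_itv /= p2 q1].
move=> s; rewrite /I /= in_itv /= => /andP[s1 s2]; apply: UN; apply: eB => /=.
rewrite /ball /= ltr_norml; apply/andP; split.
  by rewrite ltrBrDl -ltrBrDr opprK (lt_trans s2)// addrC.
by rewrite ltrBlDr -ltrBlDl (lt_trans p1).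
Qed.

Lemma hausdorff_Rplus (R : realType) : hausdorff_space (Rplus R).
Proof.
move=> s t cl; apply: Rplus_inj; apply: (@Rhausdorff R) => A B nA nB.
have [u [uA uB]] := cl _ _ (Rplus_num_cont nA) (Rplus_num_cont nB).
by exists (u : {posnum R})%:num.
Qed.

Lemma hausdorff_prod (T U : topologicalType) :
  hausdorff_space T -> hausdorff_space U -> hausdorff_space (T * U)%type.
Proof.
move=> hT hU [x y] [x' y'] cl; congr (_, _).
  apply: hT => A B nA nB.
  have [[a b] [/= ? ?]] := cl (A `*` setT) (B `*` setT)
    ltac:(by exists (A, setT) => //=; split => //; exact: filterT)
    ltac:(by exists (B, setT) => //=; split => //; exact: filterT).
  by exists a; split; firstorder.
apply: hU => A B nA nB.
have [[a b] [/= ? ?]] := cl (setT `*` A) (setT `*` B)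
    ltac:(by exists (setT, A) => //=; split => //; exact: filterT)
    ltac:(by exists (setT, B) => //=; split => //; exact: filterT).
by exists b; split; firstorder.
Qed.

Section ProdChart.
Variables (R : realType) (m : nat).

Section One.
Variables (T : topologicalType) (c : chart R m T).

Definition prod_cdom : set (T * Rplus R) := cdom c `*` setT.
Definition prod_cimg : set 'rV[R]_(m + 1) :=
  [set y | cimg c (lsubmx y) /\ 0 < rsubmx y 0 0].
Definition prod_cmap (q : T * Rplus R) : 'rV[R]_(m + 1) :=
  row_mx (cmap c q.1) (const_mx (q.2 : {posnum R})%:num).
Definition prod_cinv (y : 'rV[R]_(m + 1)) : T * Rplus R :=
  (cinv c (lsubmx y), to_Rplus (rsubmx y 0 0)).

Lemma last_coord_cont :
  continuous (fun y : 'rV[R]_(m + 1) => (rsubmx y : 'rV[R]_1) 0 0).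
Proof.
move=> y; apply: (@continuous_comp _ _ _ (rsubmx : 'rV[R]_(m + 1) -> 'rV[R]_1)
  (fun z : 'rV[R]_1 => z 0 0)); first exact: continuous_rsubmx.
exact: coord_continuous.
Qed.

Lemma prod_cdom_open : open prod_cdom.
Proof. by apply: openX; [exact: cdom_open|exact: openT]. Qed.

Lemma open_half (A : set 'rV[R]_m) : open A ->
  open [set y : 'rV[R]_(m + 1) | A (lsubmx y) /\ 0 < rsubmx y 0 0].
Proof.
move=> oA.
apply: (@openI _ (lsubmx @^-1` A)
  ((fun y : 'rV[R]_(m + 1) => rsubmx y 0 0) @^-1` [set x | x > 0])).
  by apply: open_comp => // y _; exact: continuous_lsubmx.
by apply: open_comp => [y _|]; [exact: last_coord_cont|exact: open_gt].
Qed.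

Lemma prod_cmap_img q : prod_cdom q -> prod_cimg (prod_cmap q).
Proof.
move=> [dq _]; split; rewrite /prod_cmap (row_mxKl, row_mxKr).
  exact: cmap_img.
by rewrite mxE.
Qed.

Lemma prod_cinv_dom y : prod_cimg y -> prod_cdom (prod_cinv y).
Proof. by move=> [iy _]; split => //=; exact: cinv_dom. Qed.

Lemma prod_cmapK q : prod_cdom q -> prod_cinv (prod_cmap q) = q.
Proof.
move: q => [x t] [/= dq _]; rewrite /prod_cinv /prod_cmap row_mxKl row_mxKr mxE.
by rewrite cmapK// to_RplusK.
Qed.

Lemma prod_cinvK y : prod_cimg y -> prod_cmap (prod_cinv y) = y.
Proof.
move=> [iy y0]; rewrite /prod_cmap /prod_cinv /= cinvK// to_Rplus_num//.
rewrite -[RHS]hsubmxK; congr row_mx; apply/rowP => i.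
by rewrite mxE (ord1 i).
Qed.

Lemma prod_cmap_cont q : prod_cdom q -> {for q, continuous prod_cmap}.
Proof.
move=> [dq _]; apply: (@row_mx_cont R _ m 1 (fun q : T * Rplus R => cmap c q.1)
  (fun q : T * Rplus R => const_mx (q.2 : {posnum R})%:num)).
  by apply: continuous_comp; [exact: cvg_fst|exact: cmap_cont].
apply: (@continuous_comp _ _ _ snd
  (fun t : Rplus R => const_mx (t : {posnum R})%:num)); first exact: cvg_snd.
move=> A [P hP sPA].
have h0 : nbhs ((q.2 : {posnum R})%:num : R) (P ord0 ord0).
  by have := hP ord0 ord0; rewrite mxE.
have := Rplus_num_cont h0.
change (nbhs q.2 ((fun t : Rplus R => (t : {posnum R})%:num) @^-1` P ord0 ord0) ->
  nbhs q.2 ((fun t : Rplus R => const_mx (t : {posnum R})%:num) @^-1` A)).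
apply: filterS => t Pt; apply: sPA => i j.
by rewrite (ord1 i) (ord1 j) mxE.
Qed.

Lemma prod_cinv_cont y : prod_cimg y -> {for y, continuous prod_cinv}.
Proof.
move=> [iy y0].
have h1 : {for y, continuous (fun y => cinv c (lsubmx y : 'rV[R]_m))}.
  by apply: continuous_comp; [exact: continuous_lsubmx|exact: cinv_cont].
have h2 : {for y, continuous (fun y => to_Rplus ((rsubmx y : 'rV[R]_1) 0 0))}.
  apply: (@continuous_comp _ _ _ (fun y : 'rV[R]_(m + 1) => rsubmx y 0 0)
    (@to_Rplus R)); first exact: last_coord_cont.
  exact: to_Rplus_cont.
exact: (cvg_pair h1 h2).
Qed.

Definition prod_chart : chart R (m + 1) (T * Rplus R)%type :=
  Chart prod_cdom_open (open_half (@cimg_open _ _ _ c)) prod_cmap_img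
    prod_cinv_dom prod_cmapK prod_cinvK prod_cmap_cont prod_cinv_cont.

End One.

Section Two.
Variable M : manifold R m.

Lemma chart_img_open (c : chart R m M) (A : set M) : open A ->
  open (cmap c @` (cdom c `&` A)).
Proof.
move=> oA; rewrite (_ : _ @` _ = cimg c `&` cinv c @^-1` A); last first.
  rewrite eqEsubset; split => [_ [p [dp Ap] <-]|y [iy Ay]].
    by split; [exact: cmap_img|rewrite /= cmapK].
  by exists (cinv c y); [split=> //; exact: cinv_dom|exact: cinvK].
rewrite openE => y [iy Ay]; rewrite /interior; apply: filterI.
  by apply: open_nbhs_nbhs; split => //; exact: cimg_open.
by apply: cinv_cont => //; exact: open_nbhs_nbhs.
Qed.

Lemma prod_atlas_smooth (d d' : chart R (m + 1) (M * Rplus R)%type) :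
  (@prod_chart M @` @atlas _ _ M) d -> (@prod_chart M @` @atlas _ _ M) d' ->
  Csmooth (cmap d @` (cdom d `&` cdom d')) (cmap d' \o cinv d).
Proof.
move=> [c ac <-] [c' ac' <-] k /=.
pose U := cmap c @` (cdom c `&` cdom c').
have oU : open U by apply: chart_img_open; exact: cdom_open.
pose HU := [set y : 'rV[R]_(m + 1) | U (lsubmx y) /\ 0 < rsubmx y 0 0].
have oHU : open HU by exact: open_half.
apply: (@Ck_sub _ _ _ _ HU) => [_ [[x t] [[/= dx _] [/= dx' _]] <-]|].
  split; rewrite /prod_cmap (row_mxKl, row_mxKr); first by exists x.
  by rewrite mxE.
apply: (@Ck_ext _ _ _ _ _
  (fun y => row_mx ((cmap c' \o cinv c) (lsubmx y)) (rsubmx y))) => //.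
  move=> y [_ y0]; rewrite /prod_cmap /prod_cinv /= to_Rplus_num//; congr row_mx.
  by apply/rowP => i; rewrite [in RHS]mxE (ord1 i).
apply: Ck_row_mx => //.
  apply: (@Ck_sub _ _ _ _ (lsubmx @^-1` U)) => [y []//|].
  apply: (@Ck_lin_pre _ _ _ _ _ _ _ lsubmx); first exact: continuous_lsubmx.
  exact: atlas_smooth.
apply: (@Ck_lin_post _ _ _ _ k HU id rsubmx) => //; first exact: continuous_rsubmx.
exact: Ck_id.
Qed.

Definition prod_Rplus : manifold R (m + 1) :=
  @Manifold R (m + 1) (M * Rplus R)%type (@prod_chart M @` @atlas _ _ M)
    (fun q => prod_chart (chart_at q.1))
    (fun q => imageP (@prod_chart M) (atlas_chart_at q.1))
    (fun q => conj (mem_chart_at q.1) I)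
    prod_atlas_smooth
    (hausdorff_prod (@manifold_hausdorff _ _ M) (@hausdorff_Rplus R))
    (second_countable_prod (@manifold_second_countable _ _ M)
                           (@second_countable_Rplus R))
    (let: inhabits p := manifold_nonempty M in inhabits (p, 1%:pos : Rplus R)).

End Two.
End ProdChart.

Definition Rplus_mul (R : realType) (s t : Rplus R) : Rplus R :=
  ((s : {posnum R})%:num * (t : {posnum R})%:num)%:pos.

Section PrincipalBundle.
Variables (R : realType) (m : nat) (M : manifold R m) (P : manifold R (m + 1)).
Variables (pi : P -> M) (h : Rplus R -> P -> P).

(* Phi is an R_+-equivariant diffeomorphism of pi^-1(U) onto U x R_+ over U,
   with inverse Psi. *)
Definition trivialization (U : set M) (Phi : P -> prod_Rplus M) : Prop :=
  open U /\
  exists Psi : prod_Rplus M -> P,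
  [/\ smooth_on (pi @^-1` U) Phi,
      smooth_on ([set q : M * Rplus R | U q.1] : set (prod_Rplus M)) Psi,
      forall y, U (pi y) -> Psi (Phi y) = y,
      forall q : prod_Rplus M, U q.1 -> U (pi (Psi q)) /\ Phi (Psi q) = q &
      forall y, U (pi y) ->
        (Phi y).1 = pi y /\
        forall t, Phi (h t y) = ((Phi y).1, Rplus_mul t (Phi y).2)].

Definition principal_bundle : Prop :=
  [/\ (forall y, h (1%:pos : {posnum R}) y = y),
      (forall s t y, h (Rplus_mul s t) y = h s (h t y)),
      smooth_on setT
        ((fun q : P * Rplus R => h q.2 q.1) : prod_Rplus P -> P),
      smooth_on setT pi /\ (forall t y, pi (h t y) = pi y) &
      forall x : M, exists U Phi, U x /\ trivialization U Phi].

(* omega is nondegenerate, so J is unique. *)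
Definition hom_almost_kahler (om g : form2 P) : Prop :=
  [/\ principal_bundle,
      symplectic om /\ riemannian g,
      (forall t y u v,
         pull2 (h t) om y u v = (t : {posnum R})%:num * om y u v),
      (forall t y u v,
         pull2 (h t) g y u v = (t : {posnum R})%:num * g y u v) &
      exists J : P -> 'rV[R]_(m + 1) -> 'rV[R]_(m + 1),
        (forall y u v, g y u v = om y u (J y v)) /\
        (forall y v, J y (J y v) = - v)].

End PrincipalBundle.

Section Model.
Variables (R : realType) (m : nat) (M : manifold R m).

Definition prod_pi : prod_Rplus M -> M := fun q => q.1.

Definition prod_s : prod_Rplus M -> R := fun q => (q.2 : {posnum R})%:num.

Definition prod_act (t : Rplus R) : prod_Rplus M -> prod_Rplus M :=
  fun q => (q.1, Rplus_mul t q.2).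

Definition omega_of (eta : form1 M) : form2 (prod_Rplus M) := fun q u v =>
  wedge1 (dfun prod_s) (pull1 prod_pi eta) q u v
  + prod_s q * pull2 prod_pi (extd1 eta) q u v.

Definition g_of (gM : form2 M) (mu : form1 M) : form2 (prod_Rplus M) :=
  fun q u v =>
  prod_s q *
    (sq1 (fun q u => dfun prod_s q u / prod_s q + pull1 prod_pi mu q u) q u v
     + pull2 prod_pi gM q u v).

End Model.

(* Main.v *)
Require Import Defs.
From HB Require Import structures.
From mathcomp Require Import all_boot all_order all_algebra all_fingroup.
From mathcomp Require Import all_classical all_reals all_analysis.
From mathcomp Require Import ring lra zify.

Set Implicit Arguments.
Unset Strict Implicit.
Unset Printing Implicit Defensive.
Import Order.TTheory GRing.Theory Num.Theory.
Import numFieldNormedType.Exports.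
Local Open Scope classical_set_scope.
Local Open Scope ring_scope.

(** Forward direction: [omega = d(s eta)] is closed.  Put
    [theta = ds/s + mu] and let [C = ker eta].  Compatibility of [mu] gives
    [d eta = d eta|_C + mu /\ eta], so
    [omega = s (theta /\ eta + d eta|_C)] and
    [g = s (theta^2 + eta^2 + g_M|_C)]; hence [J] is the rotation of the
    [(theta, eta)]-plane plus [phi] on [C], and nondegeneracy of [omega]
    follows from [omega (X, J X) = g (X, X)].

    Converse: let [Delta] be the generator of the action.  The function
    [s = g (Delta, Delta)] is positive, smooth and homogeneous of degree one,
    so [(pi, s)] is a global trivialization and no partition of unity is
    needed.  In it everything is determined on the slice [s = 1], where one
    reads off [eta = i_Delta omega], [mu = i_Delta g] and
    [g_M = g - mu^2]; homogeneity and [d omega = 0] force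
    [omega = d(s eta)].  The split field is the projection of [J Delta], and
    [phi] is the projection of [J] applied to the lift of [C] orthogonal to
    [Delta].

    The chain rule and the symmetry of second derivatives are needed for maps
    whose smoothness is expressed by iterated directional derivatives; both
    are derived from the mean value theorem on segments. *)

(** * Calculus with iterated directional derivatives *)

(** The coordinate s is forced: Delta is s d/ds, on which ds/s is 1 while mu and g_M vanish, so the
    formula for g gives g (Delta, Delta) = s.

    A tangent vector at p is a row vector read in the chart chosen at p, and that chart may jump as
    p moves. A form can therefore be differentiated only through its components in a fixed chart;
    hence [coord_vec], the naturality of d under smooth maps and the independence of [extd1] from
    the chart.

    The contact condition is the nonvanishing of a top-degree wedge, whereas J only yields
    nondegeneracy of d eta on C. A symplectic basis of C bridges this gap: on it the sum over
    permutations defining the wedge power can be shown positive. The exponent n has to serve all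
    points of M at once, which follows from m = 2n + 1. *)

Lemma near_continuous (T U : topologicalType) (f : T -> U) x (P : set U) :
  {for x, continuous f} -> nbhs (f x) P -> \forall y \near x, P (f y).
Proof. by move=> cf nP; apply: cf. Qed.

Lemma near_open_nbhs (T : topologicalType) x (P : set T) :
  (\forall y \near x, P y) -> exists2 N, open_nbhs x N & N `<=` P.
Proof. by move=> h; have : nbhs x P by []; rewrite nbhsE. Qed.

Lemma open_near (T : topologicalType) x (P : set T) :
  open P -> P x -> \forall y \near x, P y.
Proof. by move=> oP Px; apply: open_nbhs_nbhs. Qed.

Section LineMVT.
Variables (R : realType) (V : normedModType R).

Lemma line_is_derive (f : V -> R) (x v : V) (s : R) :
  derivable f (x + s *: v) v ->
  is_derive s 1 (fun t : R => f (x + t *: v)) ('D_v f (x + s *: v)).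
Proof.
have key : (fun h : R => h^-1 *:
    (((fun t : R => f (x + t *: v)) \o shift s) (h *: (1 : R)) - f (x + s *: v)))
  = (fun h : R => h^-1 *: ((f \o shift (x + s *: v)) (h *: v) - f (x + s *: v))).
  apply/funext => h /=; congr (_ *: (f _ - _)).
  by rewrite [h%:A]mulr1 scalerDl addrCA addrA.
by move=> df; apply: DeriveDef; rewrite /derivable /derive key.
Qed.

Lemma line_MVT (f : V -> R) (x v : V) (t : R) : 0 <= t ->
  (forall s, 0 <= s <= t -> derivable f (x + s *: v) v) ->
  exists2 c, 0 <= c <= t & f (x + t *: v) - f x = t * 'D_v f (x + c *: v).
Proof.
move=> t0 df.
have id s : 0 <= s <= t ->
    is_derive s 1 (fun t : R => f (x + t *: v)) ('D_v f (x + s *: v)).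
  by move=> /df; exact: line_is_derive.
have [|||c] := @MVT_segment R (fun t => f (x + t *: v))
    (fun s => 'D_v f (x + s *: v)) 0 t => //.
- by move=> s; rewrite in_itv /= => /andP[s0 st]; apply: id; rewrite !ltW.
- apply: derivable_within_continuous => s; rewrite in_itv /= => /id h.
  exact: ex_derive.
rewrite in_itv /= => c0t; rewrite scale0r addr0 subr0 => e.
by exists c => //; rewrite e mulrC.
Qed.

End LineMVT.

(** * Symmetry of mixed second derivatives *)

Section Clairaut.
Variables (R : realType) (V : normedModType R).

Lemma near_segment2 (P : set V) (x u v : V) : nbhs x P ->
  exists2 t : R, 0 < t &
    forall a b, 0 <= a <= t -> 0 <= b <= t -> P (x + a *: u + b *: v).
Proof.
move=> /nbhs_ballP[e /= e0 eP].
(* The summand 1 keeps [K] positive when u = v = 0, and the factor 2 below gives the strict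
   inequality required by an open ball. *)
pose K := `|u| + `|v| + 1.
have K0 : 0 < K by rewrite ltr_wpDl// addr_ge0.
have t0 : 0 < e / (K * 2) by rewrite divr_gt0// mulr_gt0.
have tK : e / (K * 2) * K < e.
  have -> : e / (K * 2) * K = e / 2 by field; rewrite gt_eqF.
  by rewrite ltr_pdivrMr// mulr_natr mulr2n ltrDl.
move: (e / (K * 2)) t0 tK => t t0 tK; exists t => // a b /andP[a0 at_] /andP[b0 bt].
apply: eP; rewrite -ball_normE /ball_ /= -!addrA opprD addNKr normrN.
apply: le_lt_trans (ler_normD _ _) _; apply: le_lt_trans tK.
rewrite !normrZ (ger0_norm a0) (ger0_norm b0).
have := ler_wpM2r (normr_ge0 u) at_; have := ler_wpM2r (normr_ge0 v) bt.
by rewrite /K !mulrDr mulr1; lra.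
Qed.

(** The mean value theorem is used twice: in direction u for the function y |-> f (y + t v) - f y,
    then in direction v for ['D_u f]. *)
Lemma second_difference (f : V -> R) (x u v : V) (t : R) : 0 < t ->
  (forall a b, 0 <= a <= t -> 0 <= b <= t ->
    [/\ derivable f (x + a *: u + b *: v) u &
        derivable (fun y => 'D_u f y) (x + a *: u + b *: v) v]) ->
  exists a b, [/\ 0 <= a <= t, 0 <= b <= t &
    f (x + t *: u + t *: v) - f (x + t *: u) - (f (x + t *: v) - f x) =
    t * (t * 'D_v (fun y => 'D_u f y) (x + a *: u + b *: v))].
Proof.
move=> t0 h; have tt : 0 <= t <= t by rewrite lexx ltW.
have zt : 0 <= (0 : R) <= t by rewrite lexx ltW.
have d1 a : 0 <= a <= t -> derivable (f \o shift (t *: v)) (x + a *: u) u.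
  move=> at_; have [df _] := h a t at_ tt.
  by move: df; rewrite /derivable /=; under eq_fun do rewrite addrA.
have d1E a : 'D_u (f \o shift (t *: v)) (x + a *: u) = 'D_u f (x + a *: u + t *: v).
  by rewrite /derive /=; under eq_fun do rewrite -addrA.
have d2 a : 0 <= a <= t -> derivable f (x + a *: u) u.
  by move=> at_; have [] := h a 0 at_ zt; rewrite scale0r addr0.
have [||a at_] := @line_MVT R V (f \o shift (t *: v) - f) x u t; first exact: ltW.
  by move=> s st; apply: derivableB; [exact: d1|exact: d2].
have -> : (f \o shift (t *: v) - f) (x + t *: u) =
  f (x + t *: u + t *: v) - f (x + t *: u) by [].
have -> : (f \o shift (t *: v) - f) x = f (x + t *: v) - f x by [].
rewrite deriveB; [|exact: d1|exact: d2]; rewrite d1E => e1.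
have [||b bt e2] := @line_MVT R V (fun y => 'D_u f y) (x + a *: u) v t; first exact: ltW.
  by move=> s st; have [] := h a s at_ st.
by exists a, b; split => //; rewrite e1 e2.
Qed.

(** The second difference over a parallelogram is symmetric in u and v, so the two mixed derivatives
    take a common value, each at some point of the parallelogram. The points may differ, but both
    are close to x, and continuity concludes. *)
Lemma derive_comm (f : V -> R) (x u v : V) :
  (\forall y \near x, [/\ derivable f y u, derivable f y v,
     derivable (fun z => 'D_u f z) y v & derivable (fun z => 'D_v f z) y u]) ->
  {for x, continuous (fun y => 'D_v (fun z => 'D_u f z) y)} ->
  {for x, continuous (fun y => 'D_u (fun z => 'D_v f z) y)} ->
  'D_v (fun z => 'D_u f z) x = 'D_u (fun z => 'D_v f z) x.
Proof.
move=> nf cv cu; apply/eqP; rewrite -subr_eq0 -normr_le0; apply/ler_addgt0Pr => e e0.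
rewrite add0r.
have e2 : 0 < e / 2 by rewrite divr_gt0.
have n1 : \forall y \near x,
    `|'D_v (fun z => 'D_u f z) x - 'D_v (fun z => 'D_u f z) y| < e / 2.
  exact: (cvgr_dist_lt _ _ cv _ e2).
have n2 : \forall y \near x,
    `|'D_u (fun z => 'D_v f z) x - 'D_u (fun z => 'D_v f z) y| < e / 2.
  exact: (cvgr_dist_lt _ _ cu _ e2).
have [t t0 ht] := near_segment2 u v (filterI nf (filterI n1 n2)).
have [|a [b [at_ bt E1]]] := @second_difference f x u v t t0.
  by move=> a b at_ bt; have [[]] := ht a b at_ bt.
have [|b' [a' [bt' at' E2]]] := @second_difference f x v u t t0.
  move=> b' a' bt' at'; have [[h1 h2 h3 h4] _] := ht a' b' at' bt'.
  by rewrite (addrAC x); split; [exact: h2|exact: h4].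
have swap (p q r s A B : R) :
  p - q - (r - s) = A -> p - r - (q - s) = B -> A = B by move=> <- <-; ring.
rewrite (addrAC x (b' *: v)) (addrAC x (t *: v)) in E2.
have /(mulfI (lt0r_neq0 t0))/(mulfI (lt0r_neq0 t0)) E := swap _ _ _ _ _ _ E1 E2.
have [_ [h1 _]] := ht a b at_ bt; have [_ [_ h2]] := ht a' b' at' bt'.
have close (p q r s : R) : `|p - r| < e / 2 -> `|q - s| < e / 2 -> r = s ->
    `|p - q| <= e.
  move=> /ltW pr /ltW qs rs; rewrite (splitr e) -(subrKA r).
  by apply: le_trans (ler_normD _ _) (lerD pr _); rewrite rs distrC.
exact: close h1 h2 E.
Qed.

End Clairaut.

(** * Continuous partial derivatives imply differentiability *)

Section Differentiability.
Variable R : realType.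

(** On the line through x in direction v, f is a function of one variable, for which derivability is
    differentiability; rescaling v is then composition with a linear map. The case c = 0 is included
    because [differentiable_partial] meets increments with zero coordinates. *)
Lemma derive_dirZ (V W : normedModType R) (f : V -> W) (x v : V) (c : R) :
  derivable f x v -> derivable f x (c *: v) /\ 'D_(c *: v) f x = c *: 'D_v f x.
Proof.
move=> df; pose F := fun h : R => f (h *: v + x).
have lineE w : 'D_w f x = 'D_1 (fun h : R => f (h *: w + x)) 0.
  rewrite /derive; set g1 := fun h => h^-1 *: _; set g2 := fun h => h^-1 *: _.
  suff -> : g1 = g2 by []; apply/funext => h; rewrite /g1 /g2 /=.
  by rewrite addr0 scale0r add0r [h%:A]mulr1.
have dF : differentiable F (c *: (0 : R)).
  by rewrite scaler0; apply/derivable1_diffP; exact: (derivable1P f x v).1.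
have FcE : (fun h : R => f (h *: (c *: v) + x)) = F \o *:%R c.
  by apply/funext => h; rewrite /F /= !scalerA mulrC.
have dc : differentiable ( *:%R c : R -> R) 0.
  exact/linear_differentiable/scaler_continuous.
have dFc : differentiable (F \o *:%R c) (0 : R) by exact: differentiable_comp.
split.
  by apply/(derivable1P f x (c *: v)).2; rewrite FcE; exact/derivable1_diffP.
rewrite lineE FcE deriveE// diff_comp// /= diff_lin; last exact: scaler_continuous.
rewrite lineE -/F deriveE; last by rewrite -[X in differentiable _ X](scaler0 _ c).
by rewrite scaler0; exact: (GRing.linearZ_LR ('d F (0 : R)) c 1).
Qed.

Lemma differentiable_littleo (V W : normedModType R) (f : V -> W) (x : V)
    (df : {linear V -> W}) : continuous df ->
  (forall e, 0 < e ->
    \forall h \near 0, `|f (h + x) - f x - df h| <= e * `|h|) ->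
  differentiable f x.
Proof.
move=> cdf o.
have fE : f \o shift x = cst (f x) + df +o_ 0 id.
  apply/eqaddoP => e e0; near=> h; have /= := near (o e e0) h.
  by rewrite fctE /= opprD addrA; apply.
have dE : 'd f x = df :> (V -> W) by exact: diff_unique.
by apply/diff_locallyP; rewrite dE.
Unshelve. all: by end_near. Qed.

Lemma rV_normP m (h : 'rV[R]_m) (K : R) : 0 <= K ->
  (forall j, `|h 0 j| <= K) -> `|h| <= K.
Proof.
move=> K0 hK; rewrite /Num.Def.normr /= mx_normrE; apply: bigmax_le => //.
by move=> [i j] _; rewrite (ord1 i).
Qed.

Lemma rV_norm_coord m (h : 'rV[R]_m) j : `|h 0 j| <= `|h|.
Proof. by rewrite [leRHS]/Num.Def.normr/= mx_normrE; exact: (le_bigmax _ _ (0, j)). Qed.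

(* [f (x + h) - f x] is telescoped along the coordinate directions, and the mean
   value theorem is applied to each step. *)
Lemma differentiable_partial m (f : 'rV[R]_m -> R) (x : 'rV[R]_m) :
  (forall j, \forall y \near x, derivable f y (delta_mx 0 j)) ->
  (forall j, {for x, continuous (fun y => 'D_(delta_mx 0 j) f y)}) ->
  differentiable f x.
Proof.
move=> df' cf.
have df := filter_forall (nbhs_filter x) df'.
pose D j y := 'D_(delta_mx 0 j) f y.
pose L (h : 'rV[R]_m) := \sum_j h 0 j * D j x.
have lL : linear L.
  move=> a u v; rewrite /L scaler_sumr -big_split; apply: eq_bigr => j _ /=.
  by rewrite !mxE scalerAl mulrDl.
pose LL : {linear 'rV[R]_m -> R} := HB.pack L (GRing.isLinear.Build _ _ _ _ L lL).
apply: (@differentiable_littleo _ _ _ _ LL).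
  have -> : (LL : 'rV[R]_m -> R) = \sum_j (fun h : 'rV[R]_m => h 0 j * D j x).
    by apply/funext => h; rewrite fct_sumE.
  move=> h; apply: differentiable_continuous; apply: differentiable_sum => j.
  by apply: (@differentiableZl _ _ _ _ (D j x)); exact: differentiable_coord.
(* Each of the m steps contributes at most [e' * |h|]; dividing by m + 1 also covers m = 0. *)
move=> e e0; pose e' := e / m.+1%:R.
have e'0 : 0 < e' by rewrite divr_gt0.
have cD : \forall y \near x, forall j, `|D j x - D j y| < e'.
  apply: (@filter_forall _ _ (fun j y => `|D j x - D j y| < e') _ (nbhs_filter x)) => j.
  exact: (cvgr_dist_lt _ _ (cf j) _ e'0).
have [r /= r0 hr] : nbhs_ball x (fun y => (forall j, derivable f y (delta_mx 0 j))
    /\ forall j, `|D j x - D j y| < e').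
  by apply/nbhs_ballP; exact: filterI df cD.
have near0 : \forall h \near (0 : 'rV[R]_m), `|h| < r.
  by apply/nbhs_ballP; exists r => // h; rewrite -ball_normE /= sub0r normrN.
apply: filterS near0 => h hr_.
have good y : `|y| <= `|h| -> (forall j, derivable f (x + y) (delta_mx 0 j))
    /\ forall j, `|D j x - D j (x + y)| < e'.
  move=> yh; apply: hr; rewrite -ball_normE /= opprD addNKr normrN.
  exact: le_lt_trans hr_.
(* The points x + p k are the vertices of a path from x to x + h with edges parallel to the axes. In
   the sup norm the whole path stays within distance |h| of x ([bnd]). *)
pose p k := \sum_(i < m | (i < k)%N) h 0 i *: delta_mx 0 i : 'rV[R]_m.
have pE k j : p k 0 j = if (j < k)%N then h 0 j else 0.
  rewrite summxE; case: ifPn => jk.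
    rewrite (bigD1 j)//= !mxE !eqxx mulr1 big1 ?addr0// => i /andP[_ ij].
    by rewrite !mxE eqxx /= eq_sym (negPf ij) mulr0.
  rewrite big1// => i ik; rewrite !mxE eqxx /=.
  by case: (eqVneq j i) => [ji|]; rewrite ?mulr0//; rewrite ji ik in jk.
have pS (k : 'I_m) : p k.+1 = p k + h 0 k *: delta_mx 0 k.
  apply/rowP => j; rewrite !mxE !pE ltnS leq_eqVlt eqxx /=.
  case: (eqVneq j k) => [->|jk] /=; first by rewrite eqxx ltnn mulr1 add0r.
  by rewrite (_ : (j == k :> nat) = false) ?mulr0 ?addr0//; exact/negbTE.
have bnd (k : 'I_m) c : 0 <= c <= 1 -> `|p k + c *: (h 0 k *: delta_mx 0 k)| <= `|h|.
  move=> /andP[c0 c1]; apply: rV_normP => // j; rewrite !mxE pE.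
  case: (eqVneq j k) => [->|jk] /=.
    rewrite ltnn mulr1 add0r normrM ger0_norm//; apply: le_trans (rV_norm_coord h k).
    by rewrite ler_piMl.
  by rewrite !mulr0 addr0; case: ifP => _; rewrite ?normr0//; exact: rV_norm_coord.
have step (k : 'I_m) : `|f (x + p k.+1) - f (x + p k) - h 0 k * D k x| <= e' * `|h|.
  have [||c c01] := @line_MVT R _ f (x + p k) (h 0 k *: delta_mx 0 k) 1 => //.
    move=> s s01; have [/(_ k) dk _] := good _ (bnd k s s01).
    by rewrite addrA in dk; have [] := derive_dirZ (h 0 k) dk.
  have [/(_ k) dk /(_ k) Dk] := good _ (bnd k c c01); rewrite addrA in dk Dk.
  rewrite scale1r mul1r -addrA -pS (derive_dirZ (h 0 k) dk).2 => ->.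
  rewrite -/(D k _) [_ *: _]mulrC -(mulrC (D k x)) -mulrBl normrM.
  by apply: ler_pM => //; [rewrite distrC; exact: ltW|exact: rV_norm_coord].
have -> : f (h + x) - f x - LL h =
    \sum_(k < m) (f (x + p k.+1) - f (x + p k) - h 0 k * D k x).
  rewrite sumrB -(big_mkord xpredT (fun k => f (x + p k.+1) - f (x + p k))).
  rewrite telescope_sumr//; congr (f _ - f _ - _).
    by rewrite addrC; congr (_ + _); apply/rowP => j; rewrite pE ltn_ord.
  suff -> : p 0%N = 0 by rewrite addr0.
  by apply/rowP => j; rewrite pE mxE.
apply: le_trans (ler_norm_sum _ _ _) _.
apply: (@le_trans _ _ (\sum_(k < m) e' * `|h|)); first by apply: ler_sum => k _; exact: step.
rewrite sumr_const card_ord -mulr_natr mulrAC ler_wpM2r//.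
by rewrite /e' -mulrA ler_piMr ?(ltW e0)// ler_pdivrMl// mulr1 ler_nat.
Qed.

End Differentiability.

(** * Germs of smooth maps and their algebra *)

Section SmoothAt.
Variables (R : realType).
Implicit Types V W Z : normedModType R.

(** One neighbourhood serves all orders at once, so the property is open in x and depends only on
    the germ of f. *)
Definition smooth_at V W (f : V -> W) (x : V) : Prop :=
  exists2 U, open_nbhs x U & Csmooth U f.

Lemma Ck_local V W k (U : set V) (f : V -> W) :
  (forall x, U x -> exists2 N, open_nbhs x N & Ck k N f) -> Ck k U f.
Proof.
elim: k f => [|k IH] f /= h.
  by move=> x Ux; have [N [_ Ox] /(_ x Ox)] := h x Ux.
split=> [x v Ux|v]; first by have [N [_ Ox] [+ _]] := h x Ux; exact.
by apply: IH => x /h[N Ox [_ /(_ v)]]; exists N.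
Qed.

Lemma Csmooth_at V W (U : set V) (f : V -> W) x :
  open U -> U x -> Csmooth U f -> smooth_at f x.
Proof. by move=> oU Ux sf; exists U. Qed.

Lemma smooth_at_Csmooth V W (U : set V) (f : V -> W) :
  (forall x, U x -> smooth_at f x) -> Csmooth U f.
Proof. by move=> h k; apply: Ck_local => x /h[N ? ?]; exists N. Qed.

Lemma smooth_at_near V W (f : V -> W) x :
  smooth_at f x -> \forall y \near x, smooth_at f y.
Proof.
move=> [U [oU Ux] sf].
have nU : nbhs x U by exact: open_nbhs_nbhs.
by apply: filterS nU => y Uy; exists U.
Qed.

Lemma smooth_at_ext V W (f g : V -> W) x :
  (\forall y \near x, f y = g y) -> smooth_at f x -> smooth_at g x.
Proof.
move=> fg_; have : nbhs x [set y | f y = g y] by exact: fg_.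
rewrite nbhsE => -[N [oN Ox] fg] [U [oU Ux] sf].
exists (N `&` U); first by split; [exact: openI|split].
move=> k; apply: (@Ck_ext _ _ _ _ _ f); first exact: openI.
  by move=> y [/fg].
by apply: Ck_sub (sf k) => y [].
Qed.

Lemma smooth_at_derivable V W (f : V -> W) x v : smooth_at f x -> derivable f x v.
Proof. by move=> [U [_ Ux] /(_ 1%N) [+ _]]; exact. Qed.

Lemma smooth_at_cont V W (f : V -> W) x : smooth_at f x -> {for x, continuous f}.
Proof. by move=> [U [_ Ux] /(_ 0%N)]; exact. Qed.

Lemma smooth_at_derive V W (f : V -> W) x v :
  smooth_at f x -> smooth_at (fun y => 'D_v f y : W) x.
Proof. by move=> [U oU sf]; exists U => // k; have [_] := sf k.+1; exact. Qed.

Lemma smooth_at_cst V W (a : W) (x : V) : smooth_at (fun=> a) x.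
Proof.
by exists setT => [|k]; [split => //; exact: openT|exact: Ck_cst].
Qed.

Lemma smooth_at_id V (x : V) : smooth_at id x.
Proof.
by exists setT => [|k]; [split => //; exact: openT|exact: Ck_id].
Qed.

Lemma smooth_at_lin V W Z (L : {linear W -> Z}) (f : V -> W) x :
  continuous L -> smooth_at f x -> smooth_at (L \o f) x.
Proof.
move=> cL [U [oU Ux] sf]; exists U => // k.
exact: Ck_lin_post.
Qed.

Lemma smooth_at_linear V W (L : {linear V -> W}) x :
  continuous L -> smooth_at L x.
Proof. by move=> cL; exact: (smooth_at_lin cL (smooth_at_id x)). Qed.

Lemma smooth_at_add V W (f g : V -> W) x :
  smooth_at f x -> smooth_at g x -> smooth_at (fun y => f y + g y) x.
Proof.
move=> [U [oU Ux] sf] [N [oN Ox] sg]; exists (U `&` N).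
  by split; [exact: openI|split].
move=> k; apply: Ck_add; first exact: openI.
  by apply: Ck_sub (sf k) => y [].
by apply: Ck_sub (sg k) => y [].
Qed.

Lemma smooth_at_row_mx V a b (f : V -> 'rV[R]_a) (g : V -> 'rV[R]_b) x :
  smooth_at f x -> smooth_at g x -> smooth_at (fun y => row_mx (f y) (g y)) x.
Proof.
move=> [U [oU Ux] sf] [N [oN Ox] sg]; exists (U `&` N).
  by split; [exact: openI|split].
move=> k; apply: Ck_row_mx; first exact: openI.
  by apply: Ck_sub (sf k) => y [].
by apply: Ck_sub (sg k) => y [].
Qed.

Lemma smooth_at_scalel V W (f : V -> R) (w : W) x :
  smooth_at f x -> smooth_at (fun y => f y *: w) x.
Proof.
have l : linear (fun a : R => a *: w) by move=> a b c; rewrite scalerDl scalerA.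
pose L : {linear R -> W} := HB.pack (fun a : R => a *: w)
  (GRing.isLinear.Build _ _ _ _ (fun a : R => a *: w) l).
by apply: (@smooth_at_lin _ _ _ L); exact: scalel_continuous.
Qed.

Lemma smooth_at_sum V W (I : Type) (r : seq I) (P : pred I) (f : I -> V -> W) x :
  (forall i, P i -> smooth_at (f i) x) -> smooth_at (fun y => \sum_(i <- r | P i) f i y) x.
Proof.
move=> h; elim: r => [|i r IH].
  by under eq_fun do rewrite big_nil; exact: smooth_at_cst.
under eq_fun do rewrite big_cons.
by have := h i; case: (P i) => [/(_ isT) hi|_] //; exact: smooth_at_add.
Qed.

(* In general [Ck k.+1] does not imply [Ck k]: directional derivatives may exist
   at a point of discontinuity.  Hence the assumptions at all lower levels. *)
Lemma Ck_mul V k (U : set V) (f g : V -> R) : open U ->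
  (forall j, (j <= k)%N -> Ck j U f) -> (forall j, (j <= k)%N -> Ck j U g) ->
  Ck k U (fun x => f x * g x).
Proof.
move=> oU; elim: k f g => [|k IH] f g hf hg.
  have /= f0 := hf _ (leqnn 0); have /= g0 := hg _ (leqnn 0).
  by move=> x Ux; apply: continuousM; [exact: f0|exact: g0].
have [f1 f2] := hf _ (leqnn k.+1); have [g1 g2] := hg _ (leqnn k.+1).
split=> [x v Ux|v]; first by apply: derivableM; [exact: f1|exact: g1].
apply: (@Ck_ext _ _ _ _ _ ((fun x => f x * 'D_v g x) \+ (fun x => g x * 'D_v f x))) => //.
  by move=> x Ux /=; rewrite deriveM//; [exact: f1|exact: g1].
apply: Ck_add => //; apply: IH => j jk.
- by apply: hf; rewrite leqW.
- by have [_] := hg j.+1 jk; exact.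
- by apply: hg; rewrite leqW.
- by have [_] := hf j.+1 jk; exact.
Qed.

Lemma smooth_at_mul V (f g : V -> R) x :
  smooth_at f x -> smooth_at g x -> smooth_at (fun y => f y * g y) x.
Proof.
move=> [U [oU Ux] sf] [N [oN Ox] sg]; exists (U `&` N).
  by split; [exact: openI|split].
move=> k; apply: Ck_mul => [|j _|j _]; first exact: openI.
  by apply: Ck_sub (sf j) => y [].
by apply: Ck_sub (sg j) => y [].
Qed.

(** The derivative of 1/f is a product of two factors 1/f and one factor -D_v f, so order k + 1
    reduces to lower orders of 1/f. The induction is strong because [Ck_mul] asks for all of
    them. *)
Lemma Ck_inv V k (U : set V) (f : V -> R) : open U ->
  (forall x, U x -> f x != 0) -> Csmooth U f -> Ck k U (fun x => (f x)^-1).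
Proof.
move=> oU f0 sf; elim/ltn_ind: k => -[_ x Ux|k IH].
  by apply: continuousV; [exact: f0|exact: (sf 0%N)].
have [f1 _] := sf 1%N; split=> [x v Ux|v].
  by apply: derivableV; [exact: f0|exact: f1].
apply: (@Ck_ext _ _ _ _ _ (fun x => (f x)^-1 * ((f x)^-1 * ((-1) * 'D_v f x)))) => //.
  move=> x Ux /=; rewrite deriveV; [|exact: f0|exact: f1].
  by rewrite -exprVn expr2 mulN1r !mulrN scaleNr mulrA.
have sD j : Ck j U (fun x => 'D_v f x : R) by have [_] := sf j.+1; exact.
apply: Ck_mul => // j jk.
apply: Ck_mul => // i ij; first by apply: IH; rewrite ltnS (leq_trans ij).
by apply: Ck_mul => // l _; exact: Ck_cst.
Qed.

Lemma smooth_at_inv V (f : V -> R) x :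
  f x != 0 -> smooth_at f x -> smooth_at (fun y => (f y)^-1) x.
Proof.
move=> fx0 sfx; have [U [oU Ux] sf] := sfx.
have nf : nbhs (f x) [set y | y != 0].
  by apply: open_nbhs_nbhs; split => //; exact: open_neq.
have [N [oN Nx] Of] := near_open_nbhs (near_continuous (smooth_at_cont sfx) nf).
exists (U `&` N).
  by split; [exact: openI|split].
move=> k; apply: Ck_inv => [|y [_ /Of]//|j]; first exact: openI.
by apply: Ck_sub (sf j) => y [].
Qed.

End SmoothAt.

(** * Chain rule and composition of smooth maps *)

Section SmoothRow.
Variables (R : realType).

Lemma coord_is_linear m (i : 'I_m) : linear (fun u : 'rV[R]_m => u 0 i : R).
Proof. by move=> a u v; rewrite !mxE. Qed.

Definition coord_lin m (i : 'I_m) : {linear 'rV[R]_m -> R} :=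
  HB.pack (fun u : 'rV[R]_m => u 0 i : R)
    (GRing.isLinear.Build _ _ _ _ (fun u : 'rV[R]_m => u 0 i : R) (@coord_is_linear m i)).

Lemma rV_sum_delta m (u : 'rV[R]_m) : u = \sum_i u 0 i *: delta_mx 0 i.
Proof. exact: row_sum_delta. Qed.

Lemma smooth_at_coordP (V : normedModType R) m (f : V -> 'rV[R]_m) x :
  smooth_at f x <-> forall i, smooth_at (fun y => f y 0 i) x.
Proof.
split=> [sf i|sf].
  by apply: (@smooth_at_lin _ _ _ _ (coord_lin i)) => //; exact: coord_continuous.
rewrite (_ : f = fun y => \sum_i f y 0 i *: delta_mx 0 i); last first.
  by apply/funext => y; exact: rV_sum_delta.
by apply: smooth_at_sum => i _; exact: smooth_at_scalel.
Qed.

Lemma smooth_at_diffR m (f : 'rV[R]_m -> R) x : smooth_at f x -> differentiable f x.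
Proof.
move=> sf; apply: differentiable_partial => j.
  by apply: filterS (smooth_at_near sf) => y; exact: smooth_at_derivable.
exact: (smooth_at_cont (smooth_at_derive _ sf)).
Qed.

Lemma smooth_at_diff m n (f : 'rV[R]_m -> 'rV[R]_n) x :
  smooth_at f x -> differentiable f x.
Proof.
move=> /smooth_at_coordP sf.
rewrite (_ : f = \sum_i (fun y => f y 0 i *: delta_mx 0 i)); last first.
  by apply/funext => y; rewrite fct_sumE; exact: rV_sum_delta.
apply: differentiable_sum => i; apply: differentiableZl.
exact: smooth_at_diffR.
Qed.

Lemma derive_linear_dir (V W : normedModType R) (f : V -> W) x :
  differentiable f x -> linear (fun v => 'D_v f x).
Proof. by move=> df a u v; rewrite !deriveE// GRing.linearP. Qed.

Lemma derive_chain (V W Z : normedModType R) (f : V -> W) (g : W -> Z) x v :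
  differentiable f x -> differentiable g (f x) ->
  'D_v (g \o f) x = 'D_('D_v f x) g (f x).
Proof.
move=> df dg; rewrite !deriveE//; last exact: differentiable_comp.
by rewrite diff_comp.
Qed.

Lemma derive_lin_post (V W Z : normedModType R) (L : {linear W -> Z})
    (f : V -> W) x v : continuous L -> differentiable f x ->
  'D_v (L \o f) x = L ('D_v f x).
Proof.
move=> cL df; have dL y : differentiable L y by exact: linear_differentiable.
by rewrite derive_chain// (deriveE _ (dL _)) diff_lin.
Qed.

Lemma derive_lin_pre (V W Z : normedModType R) (L : {linear V -> W})
    (f : W -> Z) x v : 'D_v (f \o L) x = 'D_(L v) f (L x).
Proof.
rewrite /derive; set g1 := fun h => h^-1 *: _; set g2 := fun h => h^-1 *: _.
suff -> : g1 = g2 by []; apply/funext => h; rewrite /g1 /g2 /=.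
rewrite (GRing.raddfD L); congr (_ *: (f (_ + _) - _)); exact: GRing.linearZ_LR.
Qed.

Lemma derive_lin (V W : normedModType R) (L : {linear V -> W}) x v :
  continuous L -> 'D_v L x = L v.
Proof.
by move=> cL; rewrite deriveE ?diff_lin//; exact: linear_differentiable.
Qed.

Lemma derive_coord m n (f : 'rV[R]_m -> 'rV[R]_n) x v i :
  differentiable f x -> ('D_v f x) 0 i = 'D_v (fun y => f y 0 i) x.
Proof.
move=> df; have cL : continuous (coord_lin i) by exact: coord_continuous.
exact: (esym (derive_lin_post v cL df)).
Qed.

Lemma derive_dir_sum m (W : normedModType R) (f : 'rV[R]_m -> W) x v :
  differentiable f x -> 'D_v f x = \sum_i v 0 i *: 'D_(delta_mx 0 i) f x.
Proof.
move=> df; rewrite deriveE// {1}(rV_sum_delta v) GRing.raddf_sum; apply: eq_bigr => i _.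
by rewrite deriveE//; exact: GRing.linearZ_LR.
Qed.

(** By the chain rule D_v (g o f) is the sum over j of D_v f_j times (d_j g) o f. The second factor
    is again a composite with f, so the induction on k is strong and lets g vary. *)
Lemma Ck_comp m n k (U : set 'rV[R]_m) (N : set 'rV[R]_n)
    (f : 'rV[R]_m -> 'rV[R]_n) (g : 'rV[R]_n -> R) :
  open U -> open N -> (forall x, U x -> N (f x)) ->
  Csmooth U f -> Csmooth N g -> Ck k U (g \o f).
Proof.
move=> oU oN UO sf; elim/ltn_ind: k g => -[_ g sg x Ux|k IH g sg].
  by apply: continuous_comp; [exact: (sf 0%N)|exact: (sg 0%N _ (UO _ Ux))].
have df x : U x -> differentiable f x.
  by move=> Ux; apply: smooth_at_diff; exact: Csmooth_at sf.
have dg x : U x -> differentiable g (f x).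
  by move=> Ux; apply: smooth_at_diffR; apply: Csmooth_at sg => //; exact: UO.
split=> [x v Ux|v].
  by apply/diff_derivable/differentiable_comp; [exact: df|exact: dg].
apply: (@Ck_ext _ _ _ _ _
  (fun x => \sum_j 'D_v (fun y => f y 0 j) x *
    (fun y => 'D_(delta_mx 0 j) g y) (f x))) => //.
  move=> x Ux; rewrite derive_chain; [|exact: df|exact: dg].
  rewrite (derive_dir_sum _ (dg _ Ux)); apply: eq_bigr => j _.
  by rewrite derive_coord//; exact: df.
have s1 j i : Ck i U (fun x => 'D_v (fun y => f y 0 j) x : R).
  have [_] : Ck i.+1 U (fun y => f y 0 j).
    by apply: (@Ck_lin_post _ _ _ _ _ _ _ (coord_lin j)) => //; exact: coord_continuous.
  exact.
elim: (index_enum _) => [|j r IHr].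
  by apply: (@Ck_ext _ _ _ _ _ (fun=> 0)) => [//|x _|]; [rewrite big_nil|exact: Ck_cst].
apply: (@Ck_ext _ _ _ _ _ ((fun x => 'D_v (fun y => f y 0 j) x *
  ((fun y => 'D_(delta_mx 0 j) g y) \o f) x) \+
  (fun x => \sum_(i <- r) 'D_v (fun y => f y 0 i) x *
    (fun y => 'D_(delta_mx 0 i) g y) (f x)))) => //.
  by move=> x _; rewrite big_cons.
apply: Ck_add => //; apply: Ck_mul => // i ik; apply: IH => //.
by move=> l; have [_] := sg l.+1; exact.
Qed.

Lemma smooth_at_compR m n (f : 'rV[R]_m -> 'rV[R]_n) (g : 'rV[R]_n -> R) x :
  smooth_at f x -> smooth_at g (f x) -> smooth_at (g \o f) x.
Proof.
move=> sfx [N [oN Ofx] sg]; have [U [oU Ux] sf] := sfx.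
have [U' [oU' U'x] U'O] := near_open_nbhs (near_continuous (smooth_at_cont sfx)
  (open_nbhs_nbhs (conj oN Ofx))).
exists (U `&` U').
  by split; [exact: openI|split].
move=> k; apply: (@Ck_comp _ _ _ _ N) => //; first exact: openI.
  by move=> y [_ /U'O].
by move=> j; apply: Ck_sub (sf j) => y [].
Qed.

Lemma smooth_at_comp m n l (f : 'rV[R]_m -> 'rV[R]_n) (g : 'rV[R]_n -> 'rV[R]_l) x :
  smooth_at f x -> smooth_at g (f x) -> smooth_at (g \o f) x.
Proof.
move=> sf /smooth_at_coordP sg; apply/smooth_at_coordP => i.
exact: (smooth_at_compR sf (sg i)).
Qed.

Lemma derive_comp_rV m n l (f : 'rV[R]_m -> 'rV[R]_n) (g : 'rV[R]_n -> 'rV[R]_l) x v :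
  smooth_at f x -> smooth_at g (f x) ->
  'D_v (g \o f) x = 'D_('D_v f x) g (f x).
Proof. by move=> sf sg; apply: derive_chain; exact: smooth_at_diff. Qed.

Lemma smooth_derive_commR m (f : 'rV[R]_m -> R) x u v : smooth_at f x ->
  'D_v (fun z => 'D_u f z) x = 'D_u (fun z => 'D_v f z) x.
Proof.
move=> sf; apply: derive_comm.
- apply: filterS (smooth_at_near sf) => y sy.
  split; apply: smooth_at_derivable => //; exact: smooth_at_derive.
- exact/smooth_at_cont/smooth_at_derive/smooth_at_derive.
- exact/smooth_at_cont/smooth_at_derive/smooth_at_derive.
Qed.

Lemma smooth_derive_comm m n (f : 'rV[R]_m -> 'rV[R]_n) x u v : smooth_at f x ->
  'D_v (fun z => 'D_u f z) x = 'D_u (fun z => 'D_v f z) x.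
Proof.
move=> sf; apply/rowP => i; have /smooth_at_coordP /(_ i) sfi := sf.
have key a b : ('D_b (fun z => 'D_a f z) x) 0 i =
    'D_b (fun z => 'D_a (fun y => f y 0 i) z) x.
  rewrite derive_coord; last by apply: smooth_at_diff; exact: smooth_at_derive.
  apply: near_eq_derive; apply: filterS (smooth_at_near sf) => y sy.
  by rewrite derive_coord//; exact: smooth_at_diff.
exact: (etrans (key u v) (etrans (smooth_derive_commR u v sfi) (esym (key v u)))).
Qed.

End SmoothRow.

(** * Leibniz rules and naturality of d in coordinates *)

Section Leibniz.
Variable R : realType.

Lemma scalar_sum_delta n (l : 'rV[R]_n -> R) u : scalar l ->
  l u = \sum_j u 0 j * l (delta_mx 0 j).
Proof.
move=> hl; pose L : {linear 'rV[R]_n -> R | *%R} :=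
  HB.pack l (GRing.isLinear.Build _ _ _ _ l hl).
rewrite -[l]/(L : _ -> _) {1}(rV_sum_delta u) GRing.raddf_sum.
by apply: eq_bigr => j _; exact: GRing.linearZ_LR.
Qed.

Lemma derive_sumE (V : normedModType R) (I : finType) (f : I -> V -> R) x v :
  (forall i, derivable (f i) x v) ->
  'D_v (fun y => \sum_i f i y) x = \sum_i 'D_v (f i) x.
Proof.
move=> df; suff [] : derivable (fun y => \sum_i f i y) x v /\
  'D_v (fun y => \sum_i f i y) x = \sum_i 'D_v (f i) x by [].
elim: (index_enum I) => [|i r [dr Er]].
  under eq_fun do rewrite big_nil.
  by rewrite big_nil derive_cst; split => //; exact: derivable_cst.
under eq_fun do rewrite big_cons; rewrite big_cons -Er.
by split; [exact: derivableD|rewrite -deriveD].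
Qed.

(** Here [al a z] is a 1-form at the point z applied to the vector a. Linearity is asked only near
    [phi x], since components of a form in a chart are controlled only on the image of the chart. *)
Lemma smooth_at_apply1 m n (phi X : 'rV[R]_m -> 'rV[R]_n)
    (al : 'rV[R]_n -> 'rV[R]_n -> R) x :
  (\forall z \near phi x, scalar (fun a => al a z)) ->
  (forall a, smooth_at (al a) (phi x)) ->
  smooth_at phi x -> smooth_at X x -> smooth_at (fun y => al (X y) (phi y)) x.
Proof.
move=> lal sal sphi /smooth_at_coordP sX.
apply: (@smooth_at_ext _ _ _ (fun y => \sum_j X y 0 j * al (delta_mx 0 j) (phi y))).
  apply: filterS (near_continuous (smooth_at_cont sphi) lal) => y ly.
  by rewrite -(scalar_sum_delta (X y) ly).
by apply: smooth_at_sum => j _; apply: smooth_at_mul => //; exact: smooth_at_compR.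
Qed.

(** Expanding [X] in the standard basis reduces this Leibniz rule to the product rule for real
    functions. *)
Lemma derive_apply1 m n (phi X : 'rV[R]_m -> 'rV[R]_n)
    (al : 'rV[R]_n -> 'rV[R]_n -> R) x u :
  (\forall z \near phi x, scalar (fun a => al a z)) ->
  (forall a, smooth_at (al a) (phi x)) ->
  smooth_at phi x -> smooth_at X x ->
  'D_u (fun y => al (X y) (phi y)) x =
  'D_('D_u phi x) (al (X x)) (phi x) + al ('D_u X x) (phi x).
Proof.
move=> lal sal sphi sX; have /smooth_at_coordP sXj := sX.
have sc j : smooth_at (fun y => al (delta_mx 0 j) (phi y)) x.
  exact: (smooth_at_compR sphi (sal _)).
have -> : 'D_u (fun y => al (X y) (phi y)) x =
    'D_u (fun y => \sum_j X y 0 j * al (delta_mx 0 j) (phi y)) x.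
  apply: near_eq_derive.
  apply: filterS (near_continuous (smooth_at_cont sphi) lal) => y ly.
  by rewrite -(scalar_sum_delta (X y) ly).
have -> : 'D_('D_u phi x) (al (X x)) (phi x) =
    'D_('D_u phi x) (fun z => \sum_j X x 0 j * al (delta_mx 0 j) z) (phi x).
  apply: near_eq_derive; apply: filterS lal => z lz.
  by rewrite -(scalar_sum_delta (X x) lz).
rewrite (scalar_sum_delta ('D_u X x) (nbhs_singleton lal)).
rewrite !derive_sumE => [|i|i].
- rewrite -big_split /=; apply: eq_bigr => j _.
  rewrite deriveM; [|exact: smooth_at_derivable|exact: smooth_at_derivable].
  rewrite deriveM; [|exact: derivable_cst|exact: smooth_at_derivable].
  rewrite derive_cst scaler0 addr0 derive_coord; last exact: smooth_at_diff.
  rewrite (_ : 'D_u (fun y => al (delta_mx 0 j) (phi y)) x =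
    'D_('D_u phi x) (al (delta_mx 0 j)) (phi x)).
    by congr (_ + _); exact: mulrC.
  by apply: derive_chain; [exact: smooth_at_diff|exact: smooth_at_diffR].
- by apply: derivableM; [exact: derivable_cst|exact: smooth_at_derivable].
- by apply: derivableM; exact: smooth_at_derivable.
Qed.

Lemma smooth_at_apply2 m n (phi X Y : 'rV[R]_m -> 'rV[R]_n)
    (B : 'rV[R]_n -> 'rV[R]_n -> 'rV[R]_n -> R) x :
  (\forall z \near phi x, forall b, scalar (fun a => B a b z)) ->
  (\forall z \near phi x, forall a, scalar (fun b => B a b z)) ->
  (forall a b, smooth_at (B a b) (phi x)) ->
  smooth_at phi x -> smooth_at X x -> smooth_at Y x ->
  smooth_at (fun y => B (X y) (Y y) (phi y)) x.
Proof.
move=> l1 l2 sB sphi /smooth_at_coordP sX sY.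
apply: (@smooth_at_ext _ _ _ (fun y => \sum_j X y 0 j * B (delta_mx 0 j) (Y y) (phi y))).
  apply: filterS (near_continuous (smooth_at_cont sphi) l1) => y ly.
  by rewrite -(scalar_sum_delta (X y) (ly (Y y))).
apply: smooth_at_sum => j _; apply: smooth_at_mul => //.
apply: smooth_at_apply1 => //.
by apply: filterS l2 => z; exact.
Qed.

Lemma derive_apply2 m n (phi X Y : 'rV[R]_m -> 'rV[R]_n)
    (B : 'rV[R]_n -> 'rV[R]_n -> 'rV[R]_n -> R) x u :
  (\forall z \near phi x, forall b, scalar (fun a => B a b z)) ->
  (\forall z \near phi x, forall a, scalar (fun b => B a b z)) ->
  (forall a b, smooth_at (B a b) (phi x)) ->
  smooth_at phi x -> smooth_at X x -> smooth_at Y x ->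
  'D_u (fun y => B (X y) (Y y) (phi y)) x =
  'D_('D_u phi x) (B (X x) (Y x)) (phi x) +
  B ('D_u X x) (Y x) (phi x) + B (X x) ('D_u Y x) (phi x).
Proof.
move=> l1 l2 sB sphi sX sY; have /smooth_at_coordP sXj := sX.
have l2' a : \forall z \near phi x, scalar (fun b => B a b z).
  by apply: filterS l2 => z; exact.
have sc j : smooth_at (fun y => B (delta_mx 0 j) (Y y) (phi y)) x.
  exact: smooth_at_apply1.
have -> : 'D_u (fun y => B (X y) (Y y) (phi y)) x =
    'D_u (fun y => \sum_j X y 0 j * B (delta_mx 0 j) (Y y) (phi y)) x.
  apply: near_eq_derive.
  apply: filterS (near_continuous (smooth_at_cont sphi) l1) => y ly.
  by rewrite -(scalar_sum_delta (X y) (ly (Y y))).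
have -> : 'D_('D_u phi x) (B (X x) (Y x)) (phi x) =
    'D_('D_u phi x) (fun z => \sum_j X x 0 j * B (delta_mx 0 j) (Y x) z) (phi x).
  apply: near_eq_derive; apply: filterS l1 => z lz.
  by rewrite -(scalar_sum_delta (X x) (lz (Y x))).
have := scalar_sum_delta ('D_u X x) (nbhs_singleton l1 (Y x)) => /= ->.
have := scalar_sum_delta (X x) (nbhs_singleton l1 ('D_u Y x)) => /= ->.
rewrite !derive_sumE => [|i|i].
- rewrite -!big_split /=; apply: eq_bigr => j _.
  rewrite deriveM; [|exact: smooth_at_derivable|exact: smooth_at_derivable].
  rewrite deriveM; [|exact: derivable_cst|exact: smooth_at_derivable].
  rewrite derive_cst scaler0 addr0 derive_coord; last exact: smooth_at_diff.
  have dE := derive_apply1 u (l2' (delta_mx 0 j)) (sB (delta_mx 0 j)) sphi sY.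
  rewrite dE {dE}.
  have alg (a p q b d : R) : a *: (p + q) + b *: d = a *: p + d * b + a * q.
    by rewrite /GRing.scale /=; ring.
  exact: alg.
- by apply: derivableM; [exact: derivable_cst|exact: smooth_at_derivable].
- by apply: derivableM; exact: smooth_at_derivable.
Qed.

(** The Leibniz rule leaves on each side a term [al] applied to a second derivative of [phi]; these
    cancel because mixed derivatives commute. *)
Lemma d_pull1 m n (phi : 'rV[R]_m -> 'rV[R]_n)
    (al : 'rV[R]_n -> 'rV[R]_n -> R) x u v :
  (\forall z \near phi x, scalar (fun a => al a z)) ->
  (forall a, smooth_at (al a) (phi x)) -> smooth_at phi x ->
  'D_u (fun y => al ('D_v phi y) (phi y)) x
  - 'D_v (fun y => al ('D_u phi y) (phi y)) x =
  'D_('D_u phi x) (al ('D_v phi x)) (phi x)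
  - 'D_('D_v phi x) (al ('D_u phi x)) (phi x).
Proof.
move=> lal sal sphi.
have alg (T1 T2 a1 a2 b1 b2 : R) : T1 = a1 + b1 -> T2 = a2 + b2 -> b1 = b2 ->
    T1 - T2 = a1 - a2 by move=> -> -> ->; ring.
exact: (alg _ _ _ _ _ _
  (derive_apply1 u lal sal sphi (smooth_at_derive v sphi))
  (derive_apply1 v lal sal sphi (smooth_at_derive u sphi))
  (congr1 (al^~ (phi x)) (smooth_derive_comm v u sphi))).
Qed.

(** The six terms with a second derivative of [phi] cancel in pairs, by symmetry of mixed
    derivatives and antisymmetry of [B]. *)
Lemma d_pull2 m n (phi : 'rV[R]_m -> 'rV[R]_n)
    (B : 'rV[R]_n -> 'rV[R]_n -> 'rV[R]_n -> R) x u v w :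
  (\forall z \near phi x, forall b, scalar (fun a => B a b z)) ->
  (\forall z \near phi x, forall a, scalar (fun b => B a b z)) ->
  (forall a b, B a b (phi x) = - B b a (phi x)) ->
  (forall a b, smooth_at (B a b) (phi x)) -> smooth_at phi x ->
  'D_u (fun y => B ('D_v phi y) ('D_w phi y) (phi y)) x
  + 'D_v (fun y => B ('D_w phi y) ('D_u phi y) (phi y)) x
  + 'D_w (fun y => B ('D_u phi y) ('D_v phi y) (phi y)) x =
  'D_('D_u phi x) (B ('D_v phi x) ('D_w phi x)) (phi x)
  + 'D_('D_v phi x) (B ('D_w phi x) ('D_u phi x)) (phi x)
  + 'D_('D_w phi x) (B ('D_u phi x) ('D_v phi x)) (phi x).
Proof.
move=> l1 l2 aB sB sphi; have sD a := smooth_at_derive a sphi.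
have c1 := etrans (aB ('D_w phi x) _) (congr1 (fun t => - B t ('D_w phi x) (phi x))
  (smooth_derive_comm u v sphi)).
have c2 := etrans (aB ('D_u phi x) _) (congr1 (fun t => - B t ('D_u phi x) (phi x))
  (smooth_derive_comm v w sphi)).
have c3 := etrans (aB ('D_v phi x) _) (congr1 (fun t => - B t ('D_v phi x) (phi x))
  (smooth_derive_comm w u sphi)).
have alg (T1 T2 T3 a1 a2 a3 b1 b2 b3 b1' b2' b3' : R) :
    T1 = a1 + b1 + b3' -> T2 = a2 + b2 + b1' -> T3 = a3 + b3 + b2' ->
    b1' = - b1 -> b2' = - b2 -> b3' = - b3 -> T1 + T2 + T3 = a1 + a2 + a3.
  by move=> -> -> -> -> -> ->; ring.
exact: (alg _ _ _ _ _ _ _ _ _ _ _ _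
  (derive_apply2 u l1 l2 sB sphi (sD v) (sD w))
  (derive_apply2 v l1 l2 sB sphi (sD w) (sD u))
  (derive_apply2 w l1 l2 sB sphi (sD u) (sD v)) c1 c2 c3).
Qed.

End Leibniz.

(** * Smooth maps and forms in charts *)

Section ManifoldCalculus.
Variable R : realType.

Lemma smooth_at_near_comp m n k (f : 'rV[R]_m -> 'rV[R]_n) (g : 'rV[R]_n -> 'rV[R]_k)
    (h : 'rV[R]_m -> 'rV[R]_k) x :
  smooth_at f x -> smooth_at g (f x) -> (\forall y \near x, h y = g (f y)) ->
  smooth_at h x.
Proof.
move=> sf sg hE; apply: smooth_at_ext (smooth_at_comp sf sg).
by apply: filterS hE => y ->.
Qed.

Lemma derive_near_comp m n k (f : 'rV[R]_m -> 'rV[R]_n) (g : 'rV[R]_n -> 'rV[R]_k)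
    (h : 'rV[R]_m -> 'rV[R]_k) x u :
  smooth_at f x -> smooth_at g (f x) -> (\forall y \near x, h y = g (f y)) ->
  'D_u h x = 'D_('D_u f x) g (f x).
Proof.
move=> sf sg hE; have -> : 'D_u h x = 'D_u (g \o f) x by exact: near_eq_derive.
exact: derive_comp_rV.
Qed.

Lemma derive_lincomb (V : normedModType R) (f g : V -> R) a x u :
  derivable f x u -> derivable g x u ->
  'D_u (fun y => a * f y + g y) x = a * 'D_u f x + 'D_u g x.
Proof.
move=> df dg; have daf : derivable (fun y => a * f y) x u.
  exact: (@derivableZ _ _ _ f a).
apply: etrans (deriveD daf dg) _; congr (_ + _).
exact: (@deriveZ _ _ _ f a).
Qed.

Lemma near_cmap m (T : topologicalType) (c : chart R m T) p (P : set T) :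
  cdom c p -> nbhs p P -> \forall y \near cmap c p, cimg c y /\ P (cinv c y).
Proof.
move=> dp nP; have h1 := open_near (@cimg_open _ _ _ c) (cmap_img dp).
have h2 : \forall y \near cmap c p, P (cinv c y).
  by apply: near_continuous (cinv_cont (cmap_img dp)) _; rewrite cmapK.
exact: filterI h1 h2.
Qed.

Lemma transition_smooth m (M : manifold R m) (c d : chart R m M) p :
  atlas c -> atlas d -> cdom c p -> cdom d p ->
  smooth_at (cmap d \o cinv c) (cmap c p).
Proof.
move=> ac ad cp dp; apply: Csmooth_at (atlas_smooth ac ad); last by exists p.
by apply: chart_img_open; exact: cdom_open.
Qed.

Section Maps.
Variables (m k : nat) (M : manifold R m) (N : manifold R k).
Implicit Types F : M -> N.

Definition loc F (c : chart R m M) (c' : chart R k N) := cmap c' \o F \o cinv c.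

(** Continuity is asked separately because [cmap] is arbitrary outside its domain: smoothness of
    [loc] alone does not keep F q in the chart at F p. Only the chosen charts are tested;
    [loc_change] passes to all others. *)
Definition msmooth F p := {for p, continuous F} /\
  smooth_at (loc F (chart_at p) (chart_at (F p))) (cmap (chart_at p) p).

Lemma loc_change F p c c' d d' : {for p, continuous F} ->
  atlas c -> atlas c' -> atlas d -> atlas d' ->
  cdom c p -> cdom c' (F p) -> cdom d p -> cdom d' (F p) ->
  smooth_at (loc F c c') (cmap c p) -> smooth_at (loc F d d') (cmap d p).
Proof.
move=> cF ac ac' ad ad' cp cp' dp dp' sF.
have s1 := transition_smooth ad ac dp cp.
have s2 := transition_smooth ac' ad' cp' dp'.
have e1 : (cmap c \o cinv d) (cmap d p) = cmap c p by rewrite /= cmapK.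
have e2 : loc F c c' (cmap c p) = cmap c' (F p) by rewrite /loc /= cmapK.
rewrite -e2 in s2; have s3 := smooth_at_comp sF s2; rewrite -e1 in s3.
apply: (smooth_at_near_comp s1 s3).
have nc : nbhs p [set q | cdom c q /\ cdom c' (F q)].
  apply: filterI; first exact: open_near (@cdom_open _ _ _ c) cp.
  exact: near_continuous cF (open_near (@cdom_open _ _ _ c') cp').
apply: filterS (near_cmap dp nc) => y [iy [cy cy']].
by rewrite /loc /= (cmapK cy) (cmapK cy').
Qed.

Lemma msmooth_loc F p c c' : msmooth F p -> atlas c -> atlas c' ->
  cdom c p -> cdom c' (F p) -> smooth_at (loc F c c') (cmap c p).
Proof.
move=> [cF sF] ac ac' cp cp'.
by apply: loc_change sF => //; [exact: atlas_chart_at|exact: atlas_chart_at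
  |exact: mem_chart_at|exact: mem_chart_at].
Qed.

Lemma smooth_on_msmooth (A : set M) F p : smooth_on A F -> A p -> msmooth F p.
Proof.
move=> [oA cF sF] Ap; set c := chart_at p; set c' := chart_at (F p).
have ac : atlas c by exact: atlas_chart_at.
have ac' : atlas c' by exact: atlas_chart_at.
have cp : cdom c p by exact: mem_chart_at.
have cp' : cdom c' (F p) by exact: mem_chart_at.
split; first exact: cF.
have nc : nbhs p [set q | A q /\ cdom c q /\ cdom c' (F q)].
  apply: filterI; first exact: open_near oA Ap.
  apply: filterI; first exact: open_near (@cdom_open _ _ _ c) cp.
  exact: near_continuous (cF p Ap) (open_near (@cdom_open _ _ _ c') cp').
have [U [oU Up] UP] := near_open_nbhs (near_cmap cp nc).
exists U => // j; apply: Ck_sub (sF c c' ac ac' j) => y /UP[iy [Ay [cy cy']]].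
by exists (cinv c y); [split|exact: cinvK].
Qed.

Lemma msmooth_smooth_on (A : set M) F :
  open A -> (forall p, A p -> msmooth F p) -> smooth_on A F.
Proof.
move=> oA sF; split => //; first by move=> p /sF[].
move=> c c' ac ac'; apply: smooth_at_Csmooth => _ [p [[Ap cp] cp'] <-].
exact: (msmooth_loc (sF _ Ap)).
Qed.

Lemma tmapE F p u :
  tmap F p u = 'D_u (loc F (chart_at p) (chart_at (F p))) (cmap (chart_at p) p).
Proof. by []. Qed.

Lemma tmap_linear F p : msmooth F p -> linear (tmap F p).
Proof. by move=> [_ sF]; exact: derive_linear_dir (smooth_at_diff sF). Qed.

Lemma msmooth_ext F G p : (\forall q \near p, F q = G q) -> msmooth F p -> msmooth G p.
Proof.
move=> FG [cF sF]; have FGp : F p = G p by exact: nbhs_singleton FG.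
split; last first.
  rewrite -FGp; apply: smooth_at_ext sF.
  apply: filterS (near_cmap (mem_chart_at p) FG) => y [_].
  by rewrite /loc /= => ->.
rewrite /prop_for /continuous_at -FGp; apply: cvg_trans cF.
exact: near_eq_cvg.
Qed.

End Maps.

Section Composition.
Variables (m k l : nat) (M : manifold R m) (N : manifold R k) (Q : manifold R l).

Lemma loc_comp (F : M -> N) (G : N -> Q) p c c' c'' : {for p, continuous F} ->
  cdom c p -> cdom c' (F p) ->
  \forall y \near cmap c p, loc (G \o F) c c'' y = loc G c' c'' (loc F c c' y).
Proof.
move=> cF cp cp'.
have nc : nbhs p [set q | cdom c' (F q)].
  exact: near_continuous cF (open_near (@cdom_open _ _ _ c') cp').
by apply: filterS (near_cmap cp nc) => y [iy cy']; rewrite /loc /= (cmapK cy').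
Qed.

Lemma msmooth_comp (F : M -> N) (G : N -> Q) p :
  msmooth F p -> msmooth G (F p) -> msmooth (G \o F) p.
Proof.
move=> [cF sF] [cG sG]; split; first exact: continuous_comp.
apply: (smooth_at_near_comp sF (g := loc G (chart_at (F p)) (chart_at (G (F p))))).
  by rewrite {2}/loc /= cmapK //; exact: mem_chart_at.
by apply: loc_comp => //; exact: mem_chart_at.
Qed.

Lemma tmap_comp (F : M -> N) (G : N -> Q) p u :
  msmooth F p -> msmooth G (F p) -> tmap (G \o F) p u = tmap G (F p) (tmap F p u).
Proof.
move=> [cF sF] [cG sG]; rewrite !tmapE.
have e : loc F (chart_at p) (chart_at (F p)) (cmap (chart_at p) p) =
    cmap (chart_at (F p)) (F p).
  by rewrite /loc /= cmapK //; exact: mem_chart_at.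
rewrite -e in sG *; apply: (derive_near_comp _ sF sG).
by apply: loc_comp => //; exact: mem_chart_at.
Qed.

End Composition.

Section CoordVec.
Variables (m k : nat) (M : manifold R m) (N : manifold R k).

Lemma near_cinvK (c : chart R m M) p : cdom c p ->
  \forall y \near cmap c p, cmap c (cinv c y) = y.
Proof.
by move=> cp; apply: filterS (open_near (@cimg_open _ _ _ c) (cmap_img cp)) => y /cinvK.
Qed.

Lemma tmap_id p u : tmap (id : M -> M) p u = u.
Proof.
rewrite -[RHS](derive_id (cmap (chart_at p) p) u).
exact: near_eq_derive (near_cinvK (mem_chart_at p)).
Qed.

Lemma msmooth_id p : msmooth (id : M -> M) p.
Proof.
split; first exact: cvg_id.
apply: transition_smooth; by [exact: atlas_chart_at|exact: mem_chart_at].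
Qed.

Lemma coord_vec_at (p : M) u : coord_vec (chart_at p) u p = u.
Proof. exact: tmap_id. Qed.

Lemma coord_vec_linear (c : chart R m M) (p : M) :
  atlas c -> cdom c p -> linear (fun u => coord_vec c u p).
Proof.
move=> ac cp; apply/derive_linear_dir/smooth_at_diff/transition_smooth => //;
  by [exact: atlas_chart_at|exact: mem_chart_at].
Qed.

(** Both sides are the derivative of F read in c and in the chosen chart at F p, factored once
    through the chosen chart at p and once through c'. *)
Lemma tmap_coord_vec (F : M -> N) p c c' u : msmooth F p -> atlas c -> atlas c' ->
  cdom c p -> cdom c' (F p) ->
  tmap F p (coord_vec c u p) = coord_vec c' ('D_u (loc F c c') (cmap c p)) (F p).
Proof.
move=> sF ac ac' cp cp'; have [cF sFp] := sF.
set d := chart_at p; set d' := chart_at (F p).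
have ad : atlas d by exact: atlas_chart_at.
have ad' : atlas d' by exact: atlas_chart_at.
have dp : cdom d p by exact: mem_chart_at.
have dp' : cdom d' (F p) by exact: mem_chart_at.
have s1 := transition_smooth ac ad cp dp.
have s2 := transition_smooth ac' ad' cp' dp'.
have s3 := msmooth_loc sF ac ac' cp cp'.
have e1 : (cmap d \o cinv c) (cmap c p) = cmap d p by rewrite /= cmapK.
have e2 : loc F c c' (cmap c p) = cmap c' (F p) by rewrite /loc /= cmapK.
rewrite tmapE /coord_vec -/d -/d' -e1 -e2.
have sFp' : smooth_at (loc F d d') ((cmap d \o cinv c) (cmap c p)) by rewrite e1.
have s2' : smooth_at (cmap d' \o cinv c') (loc F c c' (cmap c p)) by rewrite e2.
apply: etrans (esym (derive_near_comp u s1 sFp' (h := loc F c d') _)) _.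
  have nd : nbhs p [set q | cdom d q] by exact: open_near (@cdom_open _ _ _ d) dp.
  by apply: filterS (near_cmap cp nd) => y [_ dy]; rewrite /loc /= (cmapK dy).
apply: derive_near_comp => //.
have nc : nbhs p [set q | cdom c' (F q)].
  exact: near_continuous cF (open_near (@cdom_open _ _ _ c') cp').
by apply: filterS (near_cmap cp nc) => y [_ cy]; rewrite /loc /= (cmapK cy).
Qed.

Lemma comp1_linear (al : form1 M) (c : chart R m M) y : (forall p, scalar (al p)) ->
  atlas c -> cimg c y -> scalar (fun a => comp1 al c a y).
Proof.
move=> lal ac iy a u v; rewrite /comp1.
by rewrite (coord_vec_linear ac (cinv_dom iy)) lal.
Qed.

Lemma comp2_linearl (B : form2 M) (c : chart R m M) y b :
  (forall p v, scalar (B p ^~ v)) ->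
  atlas c -> cimg c y -> scalar (fun a => comp2 B c a b y).
Proof.
move=> lal ac iy a u v; rewrite /comp2.
by rewrite (coord_vec_linear ac (cinv_dom iy)) lal.
Qed.

Lemma comp2_linearr (B : form2 M) (c : chart R m M) y b :
  (forall p v, scalar (B p v)) ->
  atlas c -> cimg c y -> scalar (fun a => comp2 B c b a y).
Proof.
move=> lal ac iy a u v; rewrite /comp2.
by rewrite (coord_vec_linear ac (cinv_dom iy)) lal.
Qed.

End CoordVec.

(** * Pull-backs of forms and naturality of d *)

Section PullbackForms.
Variables (m k : nat) (M : manifold R m) (N : manifold R k).

(** The formula is needed on a neighbourhood, not only at p, because it is going to be
    differentiated; the charts c and c' therefore stay fixed while the point moves. *)
Lemma near_comp1_pull (F : M -> N) (al : form1 N) p c c' u :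
  (\forall q \near p, msmooth F q) -> atlas c -> atlas c' ->
  cdom c p -> cdom c' (F p) ->
  \forall y \near cmap c p,
    comp1 (pull1 F al) c u y = comp1 al c' ('D_u (loc F c c') y) (loc F c c' y).
Proof.
move=> sF ac ac' cp cp'.
have nc : nbhs p [set q | msmooth F q /\ cdom c' (F q)].
  apply: filterI => //.
  exact: near_continuous (nbhs_singleton sF).1 (open_near (@cdom_open _ _ _ c') cp').
apply: filterS (near_cmap cp nc) => y [iy [sy cy]].
rewrite /comp1 /pull1 (tmap_coord_vec _ sy ac ac' (cinv_dom iy) cy).
by rewrite (cinvK iy) /loc /= (cmapK cy).
Qed.

Lemma near_comp2_pull (F : M -> N) (B : form2 N) p c c' :
  (\forall q \near p, msmooth F q) -> atlas c -> atlas c' ->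
  cdom c p -> cdom c' (F p) ->
  \forall y \near cmap c p, forall u v, comp2 (pull2 F B) c u v y =
    comp2 B c' ('D_u (loc F c c') y) ('D_v (loc F c c') y) (loc F c c' y).
Proof.
move=> sF ac ac' cp cp'.
have nc : nbhs p [set q | msmooth F q /\ cdom c' (F q)].
  apply: filterI => //.
  exact: near_continuous (nbhs_singleton sF).1 (open_near (@cdom_open _ _ _ c') cp').
apply: filterS (near_cmap cp nc) => y [iy [sy cy]] u v.
rewrite /comp2 /pull2 (tmap_coord_vec u sy ac ac' (cinv_dom iy) cy).
rewrite (tmap_coord_vec v sy ac ac' (cinv_dom iy) cy).
by rewrite (cinvK iy) /loc /= (cmapK cy).
Qed.

Lemma near_comp1_linear (al : form1 N) (c : chart R k N) z :
  (forall p, scalar (al p)) -> atlas c -> cimg c z ->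
  \forall z' \near z, scalar (fun a => comp1 al c a z').
Proof.
move=> lal ac iz; apply: filterS (open_near (@cimg_open _ _ _ c) iz) => z' iz'.
exact: comp1_linear.
Qed.

Lemma near_comp2_linearl (B : form2 N) (c : chart R k N) z :
  (forall p v, scalar (B p ^~ v)) -> atlas c -> cimg c z ->
  \forall z' \near z, forall b, scalar (fun a => comp2 B c a b z').
Proof.
move=> lB ac iz; apply: filterS (open_near (@cimg_open _ _ _ c) iz) => z' iz' b.
exact: comp2_linearl.
Qed.

Lemma near_comp2_linearr (B : form2 N) (c : chart R k N) z :
  (forall p v, scalar (B p v)) -> atlas c -> cimg c z ->
  \forall z' \near z, forall a, scalar (fun b => comp2 B c a b z').
Proof.
move=> lB ac iz; apply: filterS (open_near (@cimg_open _ _ _ c) iz) => z' iz' b.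
exact: comp2_linearr.
Qed.

Lemma smooth_comp2_pull (F : M -> N) (B : form2 N) p c c' u v :
  (\forall q \near p, msmooth F q) -> atlas c -> atlas c' ->
  cdom c p -> cdom c' (F p) ->
  (forall p u, scalar (B p u)) -> (forall p v, scalar (B p ^~ v)) ->
  (forall a b, smooth_at (comp2 B c' a b) (cmap c' (F p))) ->
  smooth_at (comp2 (pull2 F B) c u v) (cmap c p).
Proof.
move=> sF ac ac' cp cp' lr ll sB.
have sl := msmooth_loc (nbhs_singleton sF) ac ac' cp cp'.
have e2 : loc F c c' (cmap c p) = cmap c' (F p) by rewrite /loc /= cmapK.
apply: (@smooth_at_ext _ _ _ (fun y =>
    comp2 B c' ('D_u (loc F c c') y) ('D_v (loc F c c') y) (loc F c c' y))).
  by apply: filterS (near_comp2_pull B sF ac ac' cp cp') => y ->.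
apply: (smooth_at_apply2 _ _ _ sl (smooth_at_derive u sl) (smooth_at_derive v sl)).
- by rewrite e2; apply: near_comp2_linearl => //; exact: cmap_img.
- by rewrite e2; apply: near_comp2_linearr => //; exact: cmap_img.
- by rewrite e2.
Qed.

Lemma smooth_pull2 (F : M -> N) (B : form2 N) :
  (forall p, msmooth F p) -> smooth_bilin B -> smooth_bilin (pull2 F B).
Proof.
move=> sF [lr ll sB]; split=> [p u a v w|p v a u w|c ac u v].
- by rewrite /pull2 (tmap_linear (sF p)) lr.
- by rewrite /pull2 (tmap_linear (sF p)) ll.
apply: smooth_at_Csmooth => y iy; rewrite -(cinvK iy).
apply: (@smooth_comp2_pull F B _ c (chart_at (F (cinv c y)))) => //.
- exact: nearW.
- exact: atlas_chart_at.
- exact: cinv_dom.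
- exact: mem_chart_at.
- move=> a b; apply: Csmooth_at (sB _ (atlas_chart_at _) a b).
    exact: cimg_open.
  exact/cmap_img/mem_chart_at.
Qed.

Lemma closed_pull2 (F : M -> N) (om : form2 N) :
  (forall p, msmooth F p) -> smooth_form2 om -> closed_form2 om ->
  closed_form2 (pull2 F om).
Proof.
move=> sF [[lr ll sB] alt] cl p u v w; rewrite /extd2.
set c := chart_at p; set c' := chart_at (F p).
have ac : atlas c by exact: atlas_chart_at.
have ac' : atlas c' by exact: atlas_chart_at.
have cp : cdom c p by exact: mem_chart_at.
have cp' : cdom c' (F p) by exact: mem_chart_at.
have sl := msmooth_loc (sF p) ac ac' cp cp'.
have e2 : loc F c c' (cmap c p) = cmap c' (F p) by rewrite /loc /= cmapK.
have nsF : \forall q \near p, msmooth F q by exact: nearW.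
have nE := near_comp2_pull om nsF ac ac' cp cp'.
have dE a b z : 'D_z (comp2 (pull2 F om) c a b) (cmap c p) =
    'D_z (fun y => comp2 om c' ('D_a (loc F c c') y) ('D_b (loc F c c') y)
      (loc F c c' y)) (cmap c p).
  by apply: near_eq_derive; apply: filterS nE => y; exact.
apply: etrans (congr2 +%R (congr2 +%R (dE v w u) (dE w u v)) (dE u v w)) _.
apply: etrans (@d_pull2 R _ _ (loc F c c') (comp2 om c') (cmap c p) u v w _ _ _ _ sl) _;
  rewrite e2; last exact: cl.
- by apply: near_comp2_linearl => //; exact: cmap_img.
- by apply: near_comp2_linearr => //; exact: cmap_img.
(* Antisymmetry by polarization: the alternating condition is applied to a + b, written [1 *: a + b]
   to match the shape of [scalar]. *)
- move=> a b; rewrite /comp2; move: (coord_vec _ _ _) (coord_vec _ _ _) => {}a {}b.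
  set q := cinv _ _.
  have := alt q (1 *: a + b); rewrite ll !(lr q _ 1) !alt !mul1r !(addr0, add0r).
  by rewrite -[X in X = 0 -> _]opprK => /eqP; rewrite oppr_eq0 opprD subr_eq0 => /eqP.
- move=> a b; apply: Csmooth_at (sB _ (atlas_chart_at _) a b).
    exact: cimg_open.
  exact/cmap_img/mem_chart_at.
Qed.

End PullbackForms.

Section Forms.
Variables (m : nat) (M : manifold R m).

Lemma smooth_comp1_at (eta : form1 M) c y u :
  smooth_form1 eta -> atlas c -> cimg c y -> smooth_at (comp1 eta c u) y.
Proof. by move=> [_ se] ac iy; exact: Csmooth_at (@cimg_open _ _ _ c) iy (se c ac u). Qed.

Lemma smooth_comp2_at (B : form2 M) c y u v :
  smooth_bilin B -> atlas c -> cimg c y -> smooth_at (comp2 B c u v) y.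
Proof. by move=> [_ _ se] ac iy; exact: Csmooth_at (@cimg_open _ _ _ c) iy (se c ac u v). Qed.

Lemma pull1_id (al : form1 M) : pull1 id al = al.
Proof. by apply/funext => p; apply/funext => u; rewrite /pull1 tmap_id. Qed.

(* [extd1] is computed in the chosen chart; by naturality of the exterior
   derivative any chart of the atlas may be used. *)
Lemma extd1_coord_vec (eta : form1 M) c p u v :
  smooth_form1 eta -> atlas c -> cdom c p ->
  extd1 eta p (coord_vec c u p) (coord_vec c v p) =
  'D_u (comp1 eta c v) (cmap c p) - 'D_v (comp1 eta c u) (cmap c p).
Proof.
move=> se ac cp; have lal := se.1; rewrite /extd1; set d := chart_at p.
have ad : atlas d by exact: atlas_chart_at.
have dp : cdom d p by exact: mem_chart_at.
(* A change of chart is the identity of M read in the charts c and d, so [d_pull1] applies with the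
   transition map as [phi]. *)
have sl := msmooth_loc (@msmooth_id _ M p) ac ad cp dp.
have e2 : loc id c d (cmap c p) = cmap d p by rewrite /loc /= cmapK.
have dE a z : 'D_z (comp1 eta c a) (cmap c p) =
    'D_z (fun y => comp1 eta d ('D_a (loc id c d) y) (loc id c d y)) (cmap c p).
  apply: near_eq_derive; rewrite -[in X in comp1 X c](pull1_id eta).
  by apply: near_comp1_pull => //; apply: nearW; exact: msmooth_id.
apply: esym; apply: etrans (congr2 (fun a b => a - b) (dE v u) (dE u v)) _.
apply: etrans (@d_pull1 R _ _ (loc id c d) (comp1 eta d) (cmap c p) u v _ _ sl) _;
  rewrite e2 //.
- by apply: near_comp1_linear => //; exact: cmap_img.
- by move=> a; apply: smooth_comp1_at => //; exact: cmap_img.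
Qed.

Lemma comp2_extd1 (eta : form1 M) c y u v :
  smooth_form1 eta -> atlas c -> cimg c y ->
  comp2 (extd1 eta) c u v y = 'D_u (comp1 eta c v) y - 'D_v (comp1 eta c u) y.
Proof.
by move=> se ac iy; rewrite /comp2 extd1_coord_vec ?cinvK//; exact: cinv_dom.
Qed.

Lemma extd1_alt (eta : form1 M) p u : extd1 eta p u u = 0.
Proof. by rewrite /extd1 subrr. Qed.

Lemma extd1_antisym (eta : form1 M) p u v : extd1 eta p u v = - extd1 eta p v u.
Proof. by rewrite /extd1 opprB. Qed.

(** The first term is linear in v because the components of [eta] are linear in v near p, the second
    because a derivative is linear in its direction at a point of differentiability. *)
Lemma extd1_linearr (eta : form1 M) p u : smooth_form1 eta -> scalar (extd1 eta p u).
Proof.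
move=> se a v w; rewrite /extd1; set c := chart_at p.
have ac : atlas c by exact: atlas_chart_at.
have ip : cimg c (cmap c p) by exact/cmap_img/mem_chart_at.
have sc b : smooth_at (comp1 eta c b) (cmap c p) by exact: smooth_comp1_at.
have E1 : 'D_u (comp1 eta c (a *: v + w)) (cmap c p) =
    'D_u (fun y => a * comp1 eta c v y + comp1 eta c w y) (cmap c p).
  apply: near_eq_derive; apply: filterS (near_comp1_linear se.1 ac ip) => y ly.
  exact: ly.
have E2 := etrans E1 (derive_lincomb a (smooth_at_derivable (sc v))
  (smooth_at_derivable (sc w))).
have E3 := derive_linear_dir (smooth_at_diffR (sc u)) a v w.
have alg (T1 T2 x1 x2 x3 x4 : R) : T1 = a * x1 + x2 -> T2 = a *: x3 + x4 ->
    T1 - T2 = a * (x1 - x3) + (x2 - x4).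
  by rewrite /GRing.scale /= => -> ->; ring.
exact: alg E2 E3.
Qed.

Lemma extd1_linearl (eta : form1 M) p v : smooth_form1 eta -> scalar (extd1 eta p ^~ v).
Proof.
move=> se a u w /=; rewrite !(extd1_antisym _ _ _ v) (extd1_linearr p v se).
by rewrite opprD mulrN.
Qed.

End Forms.
End ManifoldCalculus.

Local Notation num t := ((t : {posnum _})%:num).

(** * Smooth real functions on a manifold *)

Section ScalarFunctions.
Variable R : realType.

Lemma smooth_at_const_mx m (f : 'rV[R]_m -> R) x :
  smooth_at f x -> smooth_at (fun y => const_mx (f y) : 'rV[R]_1) x.
Proof.
move=> sf; apply/smooth_at_coordP => i.
by under eq_fun do rewrite mxE.
Qed.

Lemma derive_row_mx (V : normedModType R) a b (f : V -> 'rV[R]_a) (g : V -> 'rV[R]_b) x u :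
  derivable f x u -> derivable g x u ->
  'D_u (fun y => row_mx (f y) (g y)) x = row_mx ('D_u f x) ('D_u g x).
Proof.
move=> df dg; have dfg : derivable (fun y => row_mx (f y) (g y)) x u.
  apply/derivable_mxP => i j; case: (split_ordP j) => k ->.
    by under eq_fun do rewrite row_mxEl; move/derivable_mxP : df; exact.
  by under eq_fun do rewrite row_mxEr; move/derivable_mxP : dg; exact.
rewrite (derive_mx dfg) (derive_mx df) (derive_mx dg).
apply/matrixP => i j; rewrite mxE; case: (split_ordP j) => k ->.
  by under eq_fun do rewrite row_mxEl; rewrite row_mxEl mxE.
by under eq_fun do rewrite row_mxEr; rewrite row_mxEr mxE.
Qed.

Section Fsmooth.
Variables (m : nat) (M : manifold R m).
Implicit Types f : M -> R.

Definition fsmooth f p := smooth_at (f \o cinv (chart_at p)) (cmap (chart_at p) p).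

Lemma smooth_at_near_compR j l (f : 'rV[R]_j -> 'rV[R]_l) (g : 'rV[R]_l -> R) h x :
  smooth_at f x -> smooth_at g (f x) -> (\forall y \near x, h y = g (f y)) ->
  smooth_at h x.
Proof.
move=> sf sg hE; apply: smooth_at_ext (smooth_at_compR sf sg).
by apply: filterS hE => y ->.
Qed.

Lemma fsmooth_cont f p : fsmooth f p -> {for p, continuous f}.
Proof.
move=> /smooth_at_cont cf; set c := chart_at p in cf.
have cp : cdom c p by exact: mem_chart_at.
have : {for p, continuous ((f \o cinv c) \o cmap c)}.
  by apply: continuous_comp => //; exact: cmap_cont.
rewrite /prop_for /continuous_at /= (cmapK cp) => h; apply: cvg_trans h.
apply: near_eq_cvg; apply: filterS (open_near (@cdom_open _ _ _ c) cp) => q cq.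
by rewrite /= cmapK.
Qed.

Lemma fsmooth_mul f g p : fsmooth f p -> fsmooth g p -> fsmooth (fun q => f q * g q) p.
Proof. exact: smooth_at_mul. Qed.

Lemma fsmooth_inv f p : f p != 0 -> fsmooth f p -> fsmooth (fun q => (f q)^-1) p.
Proof.
move=> fp; apply: smooth_at_inv => /=.
by rewrite cmapK //; exact: mem_chart_at.
Qed.

Lemma fsmooth_cst a p : fsmooth (fun=> a) p.
Proof. exact: smooth_at_cst. Qed.

End Fsmooth.

Lemma fsmooth_comp m k (M : manifold R m) (N : manifold R k) (F : M -> N) (f : N -> R) p :
  msmooth F p -> fsmooth f (F p) -> fsmooth (f \o F) p.
Proof.
move=> [cF sF] sf.
have e : loc F (chart_at p) (chart_at (F p)) (cmap (chart_at p) p) =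
    cmap (chart_at (F p)) (F p).
  by rewrite /loc /= cmapK //; exact: mem_chart_at.
rewrite /fsmooth -e in sf; apply: (smooth_at_near_compR sF sf).
have nc : nbhs p [set q | cdom (chart_at (F p)) (F q)].
  exact: near_continuous cF (open_near (@cdom_open _ _ _ _) (mem_chart_at (F p))).
by apply: filterS (near_cmap (mem_chart_at p) nc) => y [iy cy]; rewrite /loc /= (cmapK cy).
Qed.

End ScalarFunctions.

(** * The product with the half-line *)

Section Product.
Variables (R : realType) (m : nat) (M : manifold R m).
Notation N := (prod_Rplus M).

Lemma prod_chart_atlas (c : chart R m M) : atlas c -> @atlas _ _ N (prod_chart c).
Proof. by move=> ac; exists c. Qed.

Lemma smooth_lsubmx (y : 'rV[R]_(m + 1)) :
  smooth_at (lsubmx : 'rV[R]_(m + 1) -> 'rV[R]_m) y.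
Proof. by apply: (@smooth_at_linear _ _ _ lsubmx); exact: continuous_lsubmx. Qed.

Lemma smooth_rsubmx (y : 'rV[R]_(m + 1)) :
  smooth_at (rsubmx : 'rV[R]_(m + 1) -> 'rV[R]_1) y.
Proof. by apply: (@smooth_at_linear _ _ _ rsubmx); exact: continuous_rsubmx. Qed.

Lemma derive_lsubmx (y u : 'rV[R]_(m + 1)) :
  'D_u (lsubmx : 'rV[R]_(m + 1) -> 'rV[R]_m) y = lsubmx u.
Proof. by apply: (@derive_lin _ _ _ lsubmx); exact: continuous_lsubmx. Qed.

Lemma derive_rsubmx (y u : 'rV[R]_(m + 1)) :
  'D_u (rsubmx : 'rV[R]_(m + 1) -> 'rV[R]_1) y = rsubmx u.
Proof. by apply: (@derive_lin _ _ _ rsubmx); exact: continuous_rsubmx. Qed.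

Lemma const_mx_rsubmx (y : 'rV[R]_(m + 1)) : const_mx (rsubmx y 0 0) = rsubmx y.
Proof. by apply/rowP => i; rewrite mxE (ord1 i). Qed.

(** A transition between product charts is a transition of M times the identity of the last
    coordinate, hence the block form. *)
Lemma coord_vec_prod (c : chart R m M) (q : N) u : atlas c -> cdom c q.1 ->
  coord_vec (prod_chart c : chart R (m + 1) N) u q =
  row_mx (coord_vec c (lsubmx u) q.1) (rsubmx u).
Proof.
move=> ac cq; set d := chart_at q.1; set y0 := cmap (prod_chart c) q.
have dq : cdom d q.1 by exact: mem_chart_at.
have iy : prod_cimg c y0 by exact: prod_cmap_img.
have ey : lsubmx y0 = cmap c q.1 by rewrite row_mxKl.
have st := transition_smooth ac (atlas_chart_at q.1) cq dq; rewrite -ey in st.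
have sl := smooth_at_comp (smooth_lsubmx y0) st.
transitivity ('D_u (fun y => row_mx ((cmap d \o cinv c) (lsubmx y)) (rsubmx y)) y0).
  apply: near_eq_derive.
  apply: filterS (open_near (@cimg_open _ _ _ (prod_chart c)) iy) => y [iy1 iy2].
  rewrite /= /prod_cmap /prod_cinv /=; congr row_mx.
  by rewrite to_Rplus_num// const_mx_rsubmx.
apply: etrans (derive_row_mx (smooth_at_derivable sl)
  (smooth_at_derivable (smooth_rsubmx _))) _.
apply: congr2 (derive_rsubmx y0 u).
apply: etrans (derive_comp_rV u (smooth_lsubmx y0) st) _.
by rewrite derive_lsubmx [in LHS]ey.
Qed.

Lemma fsmooth_prod_s (q : N) : fsmooth (@prod_s R m M) q.
Proof.
have iy : prod_cimg (chart_at q.1) (cmap (chart_at q) q).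
  exact/prod_cmap_img/(mem_chart_at q).
apply: (@smooth_at_ext _ _ _ (fun y => rsubmx y 0 0)).
  apply: filterS (open_near (@cimg_open _ _ _ (chart_at q)) iy) => y [iy1 iy2].
  by rewrite /= /prod_s /= to_Rplus_num.
exact: ((smooth_at_coordP _ _).1 (smooth_rsubmx _)).
Qed.

Lemma dfun_prod_s (q : N) u : dfun (@prod_s R m M) q u = rsubmx u 0 0.
Proof.
have iy : prod_cimg (chart_at q.1) (cmap (chart_at q) q).
  exact/prod_cmap_img/(mem_chart_at q).
transitivity ('D_u (fun y : 'rV[R]_(m + 1) => rsubmx y 0 0) (cmap (chart_at q) q)).
  apply: near_eq_derive.
  apply: filterS (open_near (@cimg_open _ _ _ (chart_at q)) iy) => y [iy1 iy2].
  by rewrite /= /prod_s /= to_Rplus_num.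
rewrite -derive_coord ?derive_rsubmx//; exact/smooth_at_diff/smooth_rsubmx.
Qed.

Lemma msmooth_prod_pi (q : N) : msmooth (@prod_pi R m M) q.
Proof.
have iy : prod_cimg (chart_at q.1) (cmap (chart_at q) q).
  exact/prod_cmap_img/(mem_chart_at q).
split; first exact: cvg_fst.
apply: smooth_at_ext (smooth_lsubmx _).
apply: filterS (open_near (@cimg_open _ _ _ (chart_at q)) iy) => y [iy1 iy2].
by rewrite /loc /= /prod_pi /= cinvK.
Qed.

Lemma tmap_prod_pi (q : N) u : tmap (@prod_pi R m M) q u = lsubmx u.
Proof.
have iy : prod_cimg (chart_at q.1) (cmap (chart_at q) q).
  exact/prod_cmap_img/(mem_chart_at q).
rewrite -(derive_lsubmx (cmap (chart_at q) q) u) tmapE; apply: near_eq_derive.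
apply: filterS (open_near (@cimg_open _ _ _ (chart_at q)) iy) => y [iy1 iy2].
by rewrite /loc /= /prod_pi /= cinvK.
Qed.

Lemma Rplus_num_continuous_at (T : topologicalType) (f : T -> Rplus R) x :
  {for x, continuous (fun y => num (f y))} -> {for x, continuous f}.
Proof.
move=> cf; have -> : f = @to_Rplus R \o (fun y => num (f y)).
  by apply/funext => y /=; rewrite to_RplusK.
by apply: continuous_comp => //; exact: to_Rplus_cont.
Qed.

Lemma msmooth_prod k (Q : manifold R k) (F : Q -> N) p :
  msmooth (fun x => (F x).1) p -> fsmooth (fun x => num (F x).2) p -> msmooth F p.
Proof.
move=> [c1 s1] s2; split.
  have c2 := Rplus_num_continuous_at (fsmooth_cont s2).
  have -> : F = (fun x => ((F x).1, (F x).2)) by apply/funext => x; case: (F x).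
  exact: cvg_pair c1 c2.
exact: (smooth_at_row_mx s1 (smooth_at_const_mx s2)).
Qed.

Lemma tmap_prod k (Q : manifold R k) (F : Q -> N) p u :
  msmooth (fun x => (F x).1) p -> fsmooth (fun x => num (F x).2) p ->
  tmap F p u = row_mx (tmap (fun x => (F x).1 : M) p u)
    (const_mx (dfun (fun x => num (F x).2) p u)).
Proof.
move=> [c1 s1] s2; have s2' := smooth_at_const_mx s2.
apply: etrans (derive_row_mx (u := u) (smooth_at_derivable s1) (smooth_at_derivable s2')) _.
congr row_mx; apply/rowP => i; rewrite mxE derive_coord; last exact: smooth_at_diff.
by under eq_fun do rewrite mxE.
Qed.

Lemma msmooth_prod_act (t : Rplus R) (q : N) : msmooth (@prod_act R m M t) q.
Proof.
apply: msmooth_prod; first exact: msmooth_prod_pi.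
by apply: fsmooth_mul; [exact: fsmooth_cst|exact: fsmooth_prod_s].
Qed.

Lemma tmap_prod_act (t : Rplus R) (q : N) u :
  tmap (@prod_act R m M t) q u = row_mx (lsubmx u) (num t *: rsubmx u).
Proof.
rewrite tmap_prod; last 2 first.
- exact: msmooth_prod_pi.
- by apply: fsmooth_mul; [exact: fsmooth_cst|exact: fsmooth_prod_s].
congr row_mx; first exact: tmap_prod_pi.
apply/rowP => i; rewrite !mxE.
have ds : derivable (@prod_s R m M \o cinv (chart_at q)) (cmap (chart_at q) q) u.
  exact: smooth_at_derivable (fsmooth_prod_s q).
have := @deriveZ _ _ _ _ (num t) _ _ ds => /= E.
apply: etrans E _; have := dfun_prod_s q u; rewrite /dfun => ->.
by rewrite mxE (ord1 i).
Qed.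

End Product.

Section ScalarLemmas.
Variables (R : realType) (V : lmodType R).
Variables (l : V -> R) (hl : scalar l).

Lemma functional0 : l 0 = 0.
Proof. by have := hl (-1) 0 0; rewrite scaler0 addr0 mulN1r addNr. Qed.

Lemma functionalD u v : l (u + v) = l u + l v.
Proof. by have := hl 1 u v; rewrite scale1r mul1r. Qed.

Lemma functionalZ a u : l (a *: u) = a * l u.
Proof. by have := hl a u 0; rewrite !addr0 functional0 addr0. Qed.

Lemma functionalN u : l (- u) = - l u.
Proof. by rewrite -scaleN1r functionalZ mulN1r. Qed.

Lemma functionalB u v : l (u - v) = l u - l v.
Proof. by rewrite functionalD functionalN. Qed.

End ScalarLemmas.

(** * The model structure on M x R_+ *)

Section ModelForms.
Variables (R : realType) (m : nat) (M : manifold R m).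
Notation N := (prod_Rplus M).

Lemma omega_ofE (eta : form1 M) (q : N) u v :
  omega_of eta q u v = rsubmx u 0 0 * eta q.1 (lsubmx v)
  - rsubmx v 0 0 * eta q.1 (lsubmx u) + num q.2 * extd1 eta q.1 (lsubmx u) (lsubmx v).
Proof.
by rewrite /omega_of /wedge1 !dfun_prod_s /pull1 /pull2 !tmap_prod_pi.
Qed.

Lemma g_ofE (gM : form2 M) (mu : form1 M) (q : N) u v :
  g_of gM mu q u v = num q.2 *
    ((rsubmx u 0 0 / num q.2 + mu q.1 (lsubmx u)) *
     (rsubmx v 0 0 / num q.2 + mu q.1 (lsubmx v)) + gM q.1 (lsubmx u) (lsubmx v)).
Proof.
by rewrite /g_of /sq1 !dfun_prod_s /pull1 /pull2 !tmap_prod_pi.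
Qed.

Lemma rsubmx_lin a (u v : 'rV[R]_(m + 1)) :
  rsubmx (a *: u + v) 0 0 = a * rsubmx u 0 0 + rsubmx v 0 0.
Proof. by rewrite GRing.linearP !mxE. Qed.

Lemma lsubmx_lin a (u v : 'rV[R]_(m + 1)) :
  lsubmx (a *: u + v) = a *: lsubmx u + lsubmx v.
Proof. by rewrite GRing.linearP. Qed.

Lemma derive_comp_lsubmx (f : 'rV[R]_m -> R) (y u : 'rV[R]_(m + 1)) :
  'D_u (fun z : 'rV[R]_(m + 1) => f (lsubmx z)) y = 'D_(lsubmx u) f (lsubmx y).
Proof. exact: (@derive_lin_pre _ _ _ _ lsubmx). Qed.

(* the components of the 1-form [s eta] *)
Definition cone_form (eta : form1 M) (c : chart R m M) (w y : 'rV[R]_(m + 1)) : R :=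
  rsubmx y 0 0 * comp1 eta c (lsubmx w) (lsubmx y).

Lemma smooth_rsubmx00 (y : 'rV[R]_(m + 1)) :
  smooth_at (fun y : 'rV[R]_(m + 1) => rsubmx y 0 0) y.
Proof. exact: ((smooth_at_coordP _ _).1 (smooth_rsubmx _)). Qed.

Lemma derive_rsubmx00 (y u : 'rV[R]_(m + 1)) :
  'D_u (fun y : 'rV[R]_(m + 1) => rsubmx y 0 0) y = rsubmx u 0 0.
Proof.
rewrite -derive_coord ?derive_rsubmx//; exact/smooth_at_diff/smooth_rsubmx.
Qed.

Lemma smooth_comp_lsubmx (f : 'rV[R]_m -> R) (y : 'rV[R]_(m + 1)) :
  smooth_at f (lsubmx y) -> smooth_at (fun y : 'rV[R]_(m + 1) => f (lsubmx y)) y.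
Proof. exact: (smooth_at_compR (smooth_lsubmx y)). Qed.

Lemma smooth_cone_form (eta : form1 M) c w y : smooth_form1 eta -> atlas c ->
  cimg c (lsubmx y) -> smooth_at (cone_form eta c w) y.
Proof.
move=> se ac iy; apply: smooth_at_mul; first exact: smooth_rsubmx00.
by apply: smooth_comp_lsubmx; exact: smooth_comp1_at.
Qed.

Lemma derive_cone_form (eta : form1 M) c w y u : smooth_form1 eta -> atlas c ->
  cimg c (lsubmx y) -> 'D_u (cone_form eta c w) y =
  rsubmx y 0 0 * 'D_(lsubmx u) (comp1 eta c (lsubmx w)) (lsubmx y) +
  rsubmx u 0 0 * comp1 eta c (lsubmx w) (lsubmx y).
Proof.
move=> se ac iy; have sc := smooth_comp1_at (lsubmx w) se ac iy.
have d1 := smooth_at_derivable (v := u) (smooth_rsubmx00 y).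
have d2 := smooth_at_derivable (v := u) (smooth_comp_lsubmx sc).
apply: etrans (deriveM d1 d2) _.
have e1 := derive_rsubmx00 y u.
have e2 := derive_comp_lsubmx (comp1 eta c (lsubmx w)) y u.
have alg (a b p q p' q' : R) : p = p' -> q = q' -> a *: p + b *: q = a * p' + q' * b.
  by rewrite /GRing.scale /= => -> ->; ring.
exact: (alg _ _ _ _ _ _ e2 e1).
Qed.

(** This is omega = d (s eta) in a product chart: differentiating the factor s gives ds /\ eta,
    differentiating eta gives s d eta. *)
Lemma comp2_omega_of (eta : form1 M) c y u v : smooth_form1 eta -> atlas c ->
  prod_cimg c y ->
  comp2 (omega_of eta) (prod_chart c : chart R (m + 1) N) u v y =
  'D_u (cone_form eta c v) y - 'D_v (cone_form eta c u) y.
Proof.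
move=> se ac [iy y0].
have L : comp2 (omega_of eta) (prod_chart c : chart R (m + 1) N) u v y =
    rsubmx u 0 0 * comp1 eta c (lsubmx v) (lsubmx y)
    - rsubmx v 0 0 * comp1 eta c (lsubmx u) (lsubmx y)
    + rsubmx y 0 0 * comp2 (extd1 eta) c (lsubmx u) (lsubmx v) (lsubmx y).
  rewrite [in LHS]/comp2 omega_ofE coord_vec_prod; [|exact: ac|exact: cinv_dom].
  rewrite coord_vec_prod; [|exact: ac|exact: cinv_dom].
  by rewrite !row_mxKl !row_mxKr [in LHS]/= to_Rplus_num.
have alg (t r1 c1 r2 c2 r x d1 d2 t1 t2 : R) : t = r1 * c1 - r2 * c2 + r * x ->
    x = d1 - d2 -> t1 = r * d1 + r1 * c1 -> t2 = r * d2 + r2 * c2 -> t = t1 - t2.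
  by move=> -> -> -> ->; ring.
exact: (alg _ _ _ _ _ _ _ _ _ _ _ L (comp2_extd1 (lsubmx u) (lsubmx v) se ac iy)
  (derive_cone_form v u se ac iy) (derive_cone_form u v se ac iy)).
Qed.

Lemma smooth_omega_of (eta : form1 M) : smooth_form1 eta -> smooth_form2 (omega_of eta).
Proof.
move=> se; split; last first.
  by move=> q u; rewrite omega_ofE subrr extd1_alt mulr0 addr0.
have lr q u : scalar (omega_of eta q u).
  move=> a v w; rewrite !omega_ofE rsubmx_lin lsubmx_lin (se.1 _) (extd1_linearr _ _ se).
  have alg (ru rv rw eu ev ew t dv dw : R) :
      ru * (a * ev + ew) - (a * rv + rw) * eu + t * (a * dv + dw) =
      a * (ru * ev - rv * eu + t * dv) + (ru * ew - rw * eu + t * dw) by ring.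
  exact: alg.
have anti q u v : omega_of eta q u v = - omega_of eta q v u.
  have alg (a b t d d' : R) : d = - d' -> a - b + t * d = - (b - a + t * d').
    by move=> ->; ring.
  by rewrite !omega_ofE; apply: alg; exact: extd1_antisym.
split=> [//|q v a u w|_ [c ac <-] u v].
  by rewrite !(anti q _ v) lr opprD mulrN.
apply: smooth_at_Csmooth => y iy.
apply: (@smooth_at_ext _ _ _ (fun y =>
    'D_u (cone_form eta c v) y + (-1) * 'D_v (cone_form eta c u) y)).
  apply: filterS (open_near (@cimg_open _ _ _ (prod_chart c)) iy) => z iz.
  by rewrite comp2_omega_of// mulN1r.
have sc w := smooth_cone_form w se ac iy.1.
apply: smooth_at_add; first exact: smooth_at_derive.
by apply: smooth_at_mul; [exact: smooth_at_cst|exact: smooth_at_derive].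
Qed.

(** An instance of d d = 0: the six second derivatives of the components of s eta cancel in
    pairs. *)
Lemma closed_omega_of (eta : form1 M) : smooth_form1 eta -> closed_form2 (omega_of eta).
Proof.
move=> se q u v w; set c := chart_at q.1.
have ac : atlas c by exact: atlas_chart_at.
have iy : prod_cimg c (prod_cmap c q) by exact/prod_cmap_img/(mem_chart_at q).
have sc w' := smooth_cone_form w' se ac iy.1.
have dE a b z : 'D_z (comp2 (omega_of eta) (chart_at q) a b) (prod_cmap c q) =
    'D_z (fun y => 'D_a (cone_form eta c b) y) (prod_cmap c q) -
    'D_z (fun y => 'D_b (cone_form eta c a) y) (prod_cmap c q).
  have E1 : 'D_z (comp2 (omega_of eta) (chart_at q) a b) (prod_cmap c q) =
    'D_z ((fun y => 'D_a (cone_form eta c b) y) - (fun y => 'D_b (cone_form eta c a) y))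
      (prod_cmap c q).
    apply: near_eq_derive.
    apply: filterS (open_near (@cimg_open _ _ _ (prod_chart c)) iy) => y iy'.
    exact: comp2_omega_of.
  apply: etrans E1 _; apply: deriveB;
    exact: smooth_at_derivable (smooth_at_derive _ (sc _)).
have cl a b z := smooth_derive_commR a b (sc z).
have alg (t1 t2 t3 a1 b1 a2 b2 a3 b3 : R) : t1 = a1 - b1 -> t2 = a2 - b2 ->
    t3 = a3 - b3 -> b1 = a3 -> b2 = a1 -> b3 = a2 -> t1 + t2 + t3 = 0.
  by move=> -> -> -> -> -> ->; ring.
exact: (alg _ _ _ _ _ _ _ _ _ (dE v w u) (dE w u v) (dE u v w)
  (cl w u v) (cl u v w) (cl v w u)).
Qed.

Lemma riemannian_g_of (gM : form2 M) (mu : form1 M) :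
  riemannian gM -> smooth_form1 mu -> riemannian (g_of gM mu).
Proof.
move=> [[lr ll sg] sym pos] sm; split.
- have lrg q u : scalar (g_of gM mu q u).
    move=> a v w; rewrite !g_ofE rsubmx_lin lsubmx_lin (sm.1 _) (lr _ _).
    have alg (t si x rv rw mv mw gv gw : R) :
        t * (x * ((a * rv + rw) * si + (a * mv + mw)) + (a * gv + gw)) =
        a * (t * (x * (rv * si + mv) + gv)) + t * (x * (rw * si + mw) + gw) by ring.
    exact: alg.
  have symg q u v : g_of gM mu q u v = g_of gM mu q v u.
    by rewrite !g_ofE sym [in LHS](mulrC (_ / _ + _)).
  split=> [//|q v a u w|_ [c ac <-] u v].
    by rewrite !(symg q _ v) lrg.
  apply: smooth_at_Csmooth => y [iy y0].
  apply: (@smooth_at_ext _ _ _ (fun y : 'rV[R]_(m + 1) => rsubmx y 0 0 *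
    ((rsubmx u 0 0 * (rsubmx y 0 0)^-1 + comp1 mu c (lsubmx u) (lsubmx y)) *
     (rsubmx v 0 0 * (rsubmx y 0 0)^-1 + comp1 mu c (lsubmx v) (lsubmx y)) +
     comp2 gM c (lsubmx u) (lsubmx v) (lsubmx y)))).
    apply: filterS (open_near (@cimg_open _ _ _ (prod_chart c)) (conj iy y0)) => z [iz z0].
    rewrite [in RHS]/comp2 g_ofE !coord_vec_prod//; try exact: cinv_dom.
    by rewrite !row_mxKl !row_mxKr /= to_Rplus_num.
  have sr := smooth_rsubmx00 y.
  have si : smooth_at (fun y : 'rV[R]_(m + 1) => (rsubmx y 0 0)^-1) y.
    by apply: smooth_at_inv => //; rewrite gt_eqF.
  have s1 w : smooth_at (fun y : 'rV[R]_(m + 1) =>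
      rsubmx w 0 0 * (rsubmx y 0 0)^-1 + comp1 mu c (lsubmx w) (lsubmx y)) y.
    apply: smooth_at_add.
      by apply: smooth_at_mul => //; exact: smooth_at_cst.
    by apply: smooth_comp_lsubmx; exact: smooth_comp1_at.
  apply: smooth_at_mul => //; apply: smooth_at_add; first exact: smooth_at_mul.
  by apply: smooth_comp_lsubmx; exact: smooth_comp2_at.
- by move=> q u v; rewrite !g_ofE sym [in LHS](mulrC (_ / _ + _)).
move=> q u u0; rewrite g_ofE; apply: mulr_gt0; first by [].
(* If the component of u along M vanishes, only the square of ds/s remains; otherwise the term in
   [gM] is already positive. *)
rewrite -expr2; have [lu0|lu0] := eqVneq (lsubmx u) 0; last first.
  by apply: ltr_wpDl; [exact: sqr_ge0|exact: pos].
rewrite lu0 (functional0 (lr _ _)) addr0 (functional0 (sm.1 _)) addr0 exprn_even_gt0//=.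
rewrite mulf_neq0 ?invr_eq0//; apply: contra_neq u0 => ru0.
rewrite -[LHS]hsubmxK lu0 (_ : rsubmx u = 0) ?row_mx0//.
by apply/rowP => i; rewrite (ord1 i) ru0 mxE.
Qed.

Lemma prod_principal_bundle : principal_bundle (@prod_pi R m M) (@prod_act R m M).
Proof.
split.
- by move=> [x s]; congr pair; apply: Rplus_inj; rewrite /= mul1r.
- by move=> s t [x r]; congr pair; apply: Rplus_inj; rewrite /= mulrA.
- apply: msmooth_smooth_on; first exact: openT.
  move=> p _; apply: msmooth_prod.
    exact: (msmooth_comp (@msmooth_prod_pi _ _ N p) (@msmooth_prod_pi _ _ M _)).
  apply: fsmooth_mul; first exact: (@fsmooth_prod_s _ _ N).
  exact: (fsmooth_comp (@msmooth_prod_pi _ _ N p) (@fsmooth_prod_s _ _ M _)).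
- split=> //; apply: msmooth_smooth_on; first exact: openT.
  by move=> p _; exact: msmooth_prod_pi.
- move=> x; exists setT, id; split => //; split; first exact: openT.
  have si (A : set N) : open A -> smooth_on A (id : N -> N).
    by move=> oA; apply: msmooth_smooth_on => // p _; exact: msmooth_id.
  exists id; split => //; apply: si; first exact: openT.
  by rewrite (_ : mkset _ = setT) //; exact: openT.
Qed.

Lemma model_hom_almost_kahler (eta : form1 M) (gM : form2 M) (mu : form1 M) :
  contact_metric eta gM -> compatible eta gM mu ->
  hom_almost_kahler (@prod_pi R m M) (@prod_act R m M) (omega_of eta) (g_of gM mu).
Proof.
move=> [[se _] [rg levi [phi hphi]]] [sm [A split_A muA]].
have le p := se.1 p; have lm p := sm.1 p.
have [[lr ll _] sym _] := rg.
have dr p u := extd1_linearr p u se; have dl p u := extd1_linearl p u se.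
(* [cc] is the projection onto C = ker eta along the split field. *)
have [cc ccE] : exists cc : M -> 'rV[R]_m -> 'rV[R]_m,
  forall p u, cc p u = u - eta p u *: A p by exists (fun p u => u - eta p u *: A p).
have etaA p : eta p (A p) = 1 by have [] := split_A p.
have perp p u : eta p u = 0 -> gM p (A p) u = 0 by have [+ _] := split_A p; exact.
have cc0 p u : eta p (cc p u) = 0.
  by rewrite ccE (functionalB (le p)) (functionalZ (le p)) etaA mulr1 subrr.
have ccK p u : u = eta p u *: A p + cc p u by rewrite ccE addrC subrK.
have gAA p : gM p (A p) (A p) = 1.
  by rewrite (levi _ _ (split_A p).1) etaA normr1 expr1n.
(* [z q v] is the component of J v along M. The component along R_+ is the solution r of r / s + mu
   (z) = - eta (v), so that theta (J v) = - eta (v), while eta (J v) = theta (v) is [etaz]. *)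
pose th (q : N) (u : 'rV[R]_(m + 1)) : R := rsubmx u 0 0 / num q.2 + mu q.1 (lsubmx u).
pose z (q : N) (v : 'rV[R]_(m + 1)) : 'rV[R]_m :=
  th q v *: A q.1 + phi q.1 (cc q.1 (lsubmx v)).
pose J (q : N) (v : 'rV[R]_(m + 1)) := row_mx (z q v)
  (const_mx (num q.2 * (- eta q.1 (lsubmx v) - mu q.1 (z q v)))) : 'rV[R]_(m + 1).
have lJ q v : lsubmx (J q v) = z q v by rewrite row_mxKl.
have rJ q v : rsubmx (J q v) 0 0 = num q.2 * (- eta q.1 (lsubmx v) - mu q.1 (z q v)).
  by rewrite row_mxKr mxE.
have etaz q v : eta q.1 (z q v) = th q v.
  have [e0 _ _] := hphi q.1 _ (cc0 q.1 (lsubmx v)).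
  by rewrite /z (functionalD (le _)) (functionalZ (le _)) etaA mulr1 e0 addr0.
have thJ q v : th q (J q v) = - eta q.1 (lsubmx v).
  by rewrite /th lJ rJ mulrAC divff// mul1r subrK.
have gJ q u v : g_of gM mu q u v = omega_of eta q u (J q v).
  rewrite g_ofE omega_ofE lJ rJ etaz -/(th q u) -/(th q v).
  have [e0 gphi _] := hphi q.1 _ (cc0 q.1 (lsubmx v)).
  (* Both arguments are split along A and C; compatibility of [mu] evaluates the two mixed terms.
     The term with [mu (phi _)] later cancels against the one in the last component of J v. *)
  have dE : extd1 eta q.1 (lsubmx u) (z q v) =
      - eta q.1 (lsubmx u) * mu q.1 (phi q.1 (cc q.1 (lsubmx v)))
      + th q v * mu q.1 (cc q.1 (lsubmx u))
      + gM q.1 (cc q.1 (lsubmx u)) (cc q.1 (lsubmx v)).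
    rewrite [in LHS](ccK q.1 (lsubmx u)) (functionalD (dl _ _)) (functionalZ (dl _ _)).
    rewrite /z !(functionalD (dr _ _)) !(functionalZ (dr _ _)) extd1_alt mulr0 add0r.
    rewrite (muA _ _ (cc0 _ _)) (muA _ _ e0) (gphi _ (cc0 _ _)).
    have alg (x x' y r t : R) : x = - x' -> y * x + (t + r) = - y * x' + t + r.
      by move=> ->; rewrite mulrN mulNr addrA.
    by apply: alg; exact: extd1_antisym.
  have gE : gM q.1 (lsubmx u) (lsubmx v) = eta q.1 (lsubmx u) * eta q.1 (lsubmx v)
      + gM q.1 (cc q.1 (lsubmx u)) (cc q.1 (lsubmx v)).
    rewrite [in LHS](ccK q.1 (lsubmx u)) [in LHS](ccK q.1 (lsubmx v)).
    rewrite (functionalD (ll _ _)) (functionalZ (ll _ _)).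
    rewrite !(functionalD (lr _ _)) !(functionalZ (lr _ _)).
    rewrite gAA (perp _ _ (cc0 _ _)) (sym _ _ (A _)) (perp _ _ (cc0 _ _)).
    by rewrite mulr0 addr0 mulr1 add0r.
  have muz : mu q.1 (z q v) = th q v * mu q.1 (A q.1)
      + mu q.1 (phi q.1 (cc q.1 (lsubmx v))).
    by rewrite /z (functionalD (lm _)) (functionalZ (lm _)).
  have muu : mu q.1 (lsubmx u) = eta q.1 (lsubmx u) * mu q.1 (A q.1)
      + mu q.1 (cc q.1 (lsubmx u)).
    by rewrite [in LHS](ccK q.1 (lsubmx u)) (functionalD (lm _)) (functionalZ (lm _)).
  have alg (t x tv eu ev mA mf mc gc d mz mu' : R) :
      d = - eu * mf + tv * mc + gc -> mz = tv * mA + mf -> mu' = eu * mA + mc ->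
      t != 0 ->
      t * ((x / t + mu') * tv + (eu * ev + gc)) =
      x * tv - t * (- ev - mz) * eu + t * d.
    by move=> -> -> -> t0; field.
  by rewrite gE; apply: (alg _ _ _ _ _ _ _ _ _ _ _ _ dE muz muu).
have JJ q v : J q (J q v) = - v.
  have [e0 _ pp] := hphi q.1 _ (cc0 q.1 (lsubmx v)).
  have zz : z q (J q v) = - lsubmx v.
    rewrite /z thJ lJ; have -> : cc q.1 (z q v) = phi q.1 (cc q.1 (lsubmx v)).
      by rewrite ccE etaz /z addrC addKr.
    by rewrite pp [in RHS](ccK q.1 (lsubmx v)) opprD scaleNr.
  rewrite -[RHS]hsubmxK {1}/J zz !GRing.linearN /=; congr row_mx.
  apply/rowP => i; rewrite !mxE (ord1 i) lJ etaz (functionalN (lm _)) opprK /th.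
  by rewrite opprD subrK mulrN mulrCA divff// mulr1 mxE.
split; first exact: prod_principal_bundle.
- have rgN := riemannian_g_of rg sm.
  split=> //; split; [exact: smooth_omega_of|exact: closed_omega_of|].
  move=> q u u0; exists (J q u); rewrite -gJ gt_eqF//.
  by have [_ _] := rgN; exact.
- move=> t q u v; rewrite /pull2 !tmap_prod_act !omega_ofE !row_mxKl !row_mxKr.
  have alg (a s ru ev rv eu d : R) :
    a * ru * ev - a * rv * eu + a * s * d = a * (ru * ev - rv * eu + s * d) by ring.
  have E w : (num t *: rsubmx w) 0 0 = num t * rsubmx w 0 0 by rewrite mxE.
  by rewrite !E; exact: alg.
- move=> t q u v; rewrite /pull2 !tmap_prod_act !g_ofE !row_mxKl !row_mxKr.
  have alg (a s ru mu' rv mv g : R) : a != 0 ->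
      a * s * ((a * ru / (a * s) + mu') * (a * rv / (a * s) + mv) + g) =
      a * (s * ((ru / s + mu') * (rv / s + mv) + g)).
    by move=> a0; rewrite -!mulf_div divff// !mul1r mulrA.
  have E w : (num t *: rsubmx w) 0 0 = num t * rsubmx w 0 0 by rewrite mxE.
  by rewrite !E; exact: alg.
- by exists J.
Qed.

End ModelForms.

(** * Symplectic bases and top-degree wedge powers *)

Section SymplecticFamilies.
Variables (R : realType) (V : lmodType R).

(** Matrix of the standard symplectic form in a basis ordered e_0, f_0, e_1, f_1, ...: the conjugate
    pairs occupy the indices 2k and 2k+1. *)
Definition symp (i j : nat) : R :=
  if ~~ odd i && (j == i.+1) then 1 else if odd i && (i == j.+1) then -1 else 0.

Lemma symp_anti i j : symp i j = - symp j i.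
Proof.
rewrite /symp; have [->|ji] := eqVneq j i.+1.
  have -> : (i == i.+2) = false by lia.
  by rewrite /= ?eqxx ?andbF ?andbT; case: (odd i); rewrite ?oppr0 ?opprK.
have [->|ij] := eqVneq i j.+1; last by rewrite !andbF oppr0.
by rewrite /= ?eqxx ?andbF ?andbT; case: (odd j); rewrite ?oppr0 ?opprK.
Qed.

(** Removing the point i from s leaves a permutation of one letter less, whose sign is related to
    that of s by [odd_lift_perm]; this drives the inductions over permutations below. *)
Lemma perm_lift n (s : 'S_n.+1) i : exists s', s = lift_perm i (s i) s'.
Proof.
have h k : s i != s (lift i k) by rewrite (inj_eq perm_inj) neq_lift.
pose f k := sval (unlift_some (h k)).
have fE k : s (lift i k) = lift (s i) (f k) by rewrite /f; case: unlift_some.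
have f_inj : injective f.
  move=> k l fkl; apply: (@lift_inj _ i); apply: (@perm_inj _ s).
  by rewrite !fE fkl.
exists (perm f_inj); apply/permP => k; case: (unliftP i k) => [l|] ->.
  by rewrite lift_perm_lift permE fE.
by rewrite lift_perm_id.
Qed.

Lemma wedge_perm p q (al : ('I_p -> V) -> R) (be : ('I_q -> V) -> R)
    (v : 'I_(p + q) -> V) (t : 'S_(p + q)) :
  wedge al be (v \o t) = (-1) ^+ t * wedge al be v.
Proof.
rewrite /wedge mulrCA; congr (_ * _).
rewrite (reindex_inj (mulIg t^-1)%g) mulr_sumr; apply: eq_bigr => s _ /=.
rewrite odd_permM odd_permV signr_addb [X in X * _]mulrC -mulrA; congr (_ * (_ * (_ * _))).
  by congr al; apply/funext => i; rewrite permM permKV.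
by congr be; apply/funext => i; rewrite permM permKV.
Qed.

Lemma wedge_exp_perm (Om : V -> V -> R) n (v : 'I_n.*2 -> V) (t : 'S_n.*2) :
  wedge_exp Om (v \o t) = (-1) ^+ t * wedge_exp Om v.
Proof.
case: n v t => [|n] v t; last exact: (@wedge_perm 2 n.*2).
rewrite /= mulr1 (_ : t = 1%g) ?odd_perm1//.
by apply/permP => -[].
Qed.

(** The increasing enumeration of the naturals other than k and k+1. *)
Definition skip2 k y := if (y < k)%N then y else y.+2.

(** For even k a whole conjugate pair is deleted. Indices below k are unchanged and those above move
    by 2, so parities survive and the remaining pairs stay adjacent. *)
Lemma symp_skip2 k x y : ~~ odd k -> symp (skip2 k x) (skip2 k y) = symp x y.
Proof.
move=> ek; rewrite /symp /skip2; case: ltnP => xk; case: ltnP => yk /=;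
  rewrite ?negbK //.
- case: (boolP (odd x)) => ox /=; first by do 2 case: eqP => //; lia.
  case: eqP => [|_]; first lia.
  case: eqP => // yE; move: ek; have -> : k = x.+1 by lia.
  by rewrite /= ox.
- case: (boolP (odd x)) => ox /=; last by do 2 case: eqP => //; lia.
  case: eqP => [|_]; first lia.
  case: eqP => // yE; move: ek; have -> : k = x by lia.
  by rewrite ox.
Qed.

(* No term of the sum over permutations is negative.  If the first two entries of
   [s] form a pair [2k, 2k+1] in this order, then [s] is even or odd together with
   the permutation it induces on the other pairs, and that sign cancels against
   the one in [wedge_exp_perm]; if they come in the opposite order, composing with
   a transposition changes both the sign of [s] and that of [Om]. *)
Lemma wedge_exp_gt0 (Om : V -> V -> R) n (b : nat -> V) :
  (forall i j, (i < n.*2)%N -> (j < n.*2)%N -> Om (b i) (b j) = symp i j) ->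
  0 < wedge_exp Om (fun i : 'I_n.*2 => b i).
Proof.
elim: n b => [|n IH] b hb; first exact: ltr01.
pose T (s : 'S_(2 + n.*2)) := (-1) ^+ s *
  (Om (b (s (lshift n.*2 (ord0 : 'I_2)))) (b (s (lshift n.*2 (ord_max : 'I_2)))) *
   wedge_exp Om (fun j : 'I_n.*2 => b (s (rshift 2 j)))).
rewrite -[wedge_exp _ _]/((2`! * (n.*2)`!)%:R^-1 * \sum_(s : 'S_(2 + n.*2)) T s).
apply: mulr_gt0; first by rewrite invr_gt0 ltr0n muln_gt0 !fact_gt0.
pose i0 : 'I_(2 + n.*2) := lshift n.*2 (ord0 : 'I_2).
pose i1 : 'I_(2 + n.*2) := lshift n.*2 (ord_max : 'I_2).
have std (s : 'S_(2 + n.*2)) : ~~ odd (s i0) -> s i1 = (s i0).+1 :> nat -> 0 < T s.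
  move=> ev s1E; have [t tE] := @perm_lift n.*2.+1 s ord0.
  have [r rE] := @perm_lift n.*2 t ord0.
  set k : 'I_(2 + n.*2) := s ord0 in tE; set l : 'I_n.*2.+1 := t ord0 in rE.
  have e0 : i0 = ord0 by apply: val_inj.
  have e1 : i1 = lift ord0 (ord0 : 'I_n.*2.+1) by apply: val_inj.
  have s1 : s i1 = lift k l by rewrite e1 tE lift_perm_lift rE lift_perm_id.
  (* Removing k lowers the index k+1 of the second entry to k, so the second removal takes place at
     k as well, and the two lifts together give [skip2 k]. *)
  rewrite e0 -/k in ev s1E; have lE : l = k :> nat.
    have bump_succ (a c : nat) : bump a c = a.+1 -> c = a.
      by rewrite /bump; case: leqP => ac /=; lia.
    by apply: bump_succ; rewrite -s1E s1.
  have sx (x : 'I_n.*2) : s (rshift 2 x) = skip2 k (r x) :> nat.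
    have -> : rshift 2 x = lift ord0 (lift ord0 x : 'I_n.*2.+1) by apply: val_inj.
    have bump2 (a c : nat) : bump a (bump a c) = skip2 a c.
      by rewrite /bump /skip2; case: (ltnP c a) => ca /=; case: leqP => ? /=; lia.
    by rewrite tE lift_perm_lift rE lift_perm_lift /= lE bump2.
  (* Both lifts send 0 to the even index k, which leaves the parity unchanged. *)
  have sgn : (-1) ^+ s = (-1) ^+ r :> R.
    rewrite tE odd_lift_perm rE odd_lift_perm /= -/l -/k lE.
    by rewrite (negbTE ev).
  have kn : (k < n.*2.+1)%N by rewrite -lE.
  rewrite /T -/i0 -/i1 sgn s1E e0 -/k hb; last 2 first.
  - exact: ltn_ord.
  - by rewrite doubleS.
  rewrite {1}/symp ev eqxx /= mul1r.
  have -> : (fun j : 'I_n.*2 => b (s (rshift 2 j))) =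
      (fun j : 'I_n.*2 => b (skip2 k j)) \o r.
    by apply/funext => j; rewrite /= sx.
  rewrite wedge_exp_perm mulrA -expr2 sqrr_sign mul1r.
  apply: (IH (fun j => b (skip2 k j))) => i j ik jk.
  rewrite hb ?symp_skip2//; rewrite /skip2 doubleS; case: ifP => _; lia.
have swap (s : 'S_(2 + n.*2)) : T (tperm i0 i1 * s)%g = T s.
  rewrite /T -/i0 -/i1 !permM tpermL tpermR odd_permM odd_tperm.
  have anti i j : (i < n.+1.*2)%N -> (j < n.+1.*2)%N ->
      Om (b i) (b j) = - Om (b j) (b i).
    by move=> hi hj; rewrite !hb// -symp_anti.
  rewrite (anti (s i1) (s i0)); [|exact: ltn_ord|exact: ltn_ord].
  rewrite (_ : i0 != i1) // addTb signrN !mulNr mulrN opprK.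
  congr (_ * (_ * wedge_exp _ _)); apply/funext => j; rewrite permM tpermD//.
have T0 (s : 'S_(2 + n.*2)) : 0 <= T s.
  have [/eqP z|nz] := boolP (symp (s i0) (s i1) == 0).
    by rewrite /T -/i0 -/i1 hb ?z ?mul0r ?mulr0//; exact: ltn_ord.
  move: nz; rewrite /symp.
  case: ifP => [/andP[ev /eqP h] _|_]; first by apply/ltW/std.
  case: ifP => [/andP[od /eqP h] _|]; last by rewrite eqxx.
  rewrite -swap; apply/ltW/std; rewrite !permM ?tpermL ?tpermR//.
  by move: od; rewrite h /=.
(* The identity permutation is of the standard kind, so its term is strictly positive. *)
rewrite (bigD1 1%g) //=; apply: ltr_pwDl; last by apply: sumr_ge0 => s _.
by apply: std; rewrite !perm1.
Qed.

(** [eta] vanishes on every vector of the family except A, so only permutations fixing the first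
    index contribute. Each contributes the same positive number [W]: its sign appears once in the
    sum and once more when the wedge power is reordered. *)
Lemma contact_wedge_neq0 (eta : V -> R) (Om : V -> V -> R) n (A : V) (b : nat -> V) :
  eta A = 1 -> (forall i, (i < n.*2)%N -> eta (b i) = 0) ->
  (forall i j, (i < n.*2)%N -> (j < n.*2)%N -> Om (b i) (b j) = symp i j) ->
  wedge (p := 1) (fun w => eta (w ord0)) (@wedge_exp R V Om n)
    (fun i : 'I_(1 + n.*2) => if i is Ordinal j.+1 _ then b j else A) != 0.
Proof.
move=> eA eb hb; apply: lt0r_neq0; set v := fun i : 'I__ => _.
apply: mulr_gt0; first by rewrite invr_gt0 ltr0n muln_gt0 !fact_gt0.
pose i0 : 'I_(1 + n.*2) := lshift n.*2 (ord0 : 'I_1).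
have e0 : i0 = ord0 by apply: val_inj.
have v0 : v ord0 = A by [].
have vS (j : 'I_n.*2) : v (rshift 1 j) = b j by [].
pose W := wedge_exp Om (fun i : 'I_n.*2 => b i).
have W0 : 0 < W by exact: wedge_exp_gt0.
have TE (s : 'S_(1 + n.*2)) : (-1) ^+ s * (eta (v (s i0)) *
   wedge_exp Om (fun j : 'I_n.*2 => v (s (rshift 1 j)))) = if s i0 == i0 then W else 0.
  case: (eqVneq (s i0) i0) => [s0|s0]; last first.
    rewrite -(_ : 0 = eta (v (s i0))) ?mul0r ?mulr0//.
    case: (s i0) s0 => -[|j] jn //=; last by rewrite eb.
  rewrite e0 in s0 *.
  have [r rE] := @perm_lift n.*2 s ord0; rewrite s0 in rE *.
  have -> : (fun j : 'I_n.*2 => v (s (rshift 1 j))) = (fun j : 'I_n.*2 => b j) \o r.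
    apply/funext => j; have -> : rshift 1 j = lift ord0 j by apply: val_inj.
    by rewrite rE lift_perm_lift.
  rewrite wedge_exp_perm v0 eA mul1r rE odd_lift_perm /= mulrA -expr2 sqrr_sign.
  by rewrite mul1r.
under eq_bigr do rewrite TE.
rewrite (bigD1 1%g) //= perm1 eqxx; apply: ltr_pwDl => //.
by apply: sumr_ge0 => s _; case: ifP => // _; exact: ltW.
Qed.

End SymplecticFamilies.

(** * Existence of symplectic bases *)

Section SymplecticBasis.
Variables (R : realType) (k : nat).
Variables (Om : 'rV[R]_k -> 'rV[R]_k -> R).
Hypotheses (lr : forall u, scalar (Om u)) (ll : forall v, scalar (Om^~ v)).
Hypothesis (alt : forall u, Om u u = 0).

Lemma alternating_anti u v : Om u v = - Om v u.
Proof.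
have := alt (u + v); rewrite (functionalD (lr _)) !(functionalD (ll _)) !alt addr0 add0r.
by move=> /eqP; rewrite addrC addr_eq0 => /eqP.
Qed.

(** Symplectic Gram-Schmidt: take u and v in W with Om u v = 1 and recurse on the part of W
    orthogonal to both. Its dimension is smaller by exactly 2, as w |-> (Om u w, Om v w) maps W onto
    the plane. *)
Lemma symplectic_basis (W : {vspace 'rV[R]_k}) :
  (forall u, u \in W -> u != 0 -> exists2 v, v \in W & Om u v != 0) ->
  exists n (b : nat -> 'rV[R]_k), [/\ \dim W = n.*2,
    forall i, (i < n.*2)%N -> b i \in W &
    forall i j, (i < n.*2)%N -> (j < n.*2)%N -> Om (b i) (b j) = symp R i j].
Proof.
have [d] := ubnP (\dim W); elim: d W => // d IH W; rewrite ltnS => Wd nd.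
have [W0|W0] := eqVneq W 0%VS.
  by exists 0%N, (fun=> 0); split => //; rewrite W0 dimv0.
pose u := vpick W.
have uW : u \in W by exact: memv_pick.
have u0 : u != 0 by rewrite vpick0.
have [v0 v0W uv0] := nd u uW u0.
have [v vW uv] : exists2 v, v \in W & Om u v = 1.
  by exists ((Om u v0)^-1 *: v0); rewrite ?memvZ// (functionalZ (lr _)) mulVf.
have vu : Om v u = -1 by rewrite alternating_anti uv.
pose F w : 'rV[R]_2 := \row_(i < 2) (if i == 0 then Om u w else Om v w).
have lF : linear F.
  by move=> a x y; apply/rowP => i; rewrite !mxE; case: ifP => _; rewrite (lr _).
pose FL : {linear 'rV[R]_k -> 'rV[R]_2} := HB.pack F (GRing.isLinear.Build _ _ _ _ F lF).
pose f : 'Hom('rV[R]_k, 'rV[R]_2) := linfun FL.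
have fE w : f w = F w by rewrite lfunE.
have imf : (f @: W)%VS = fullv.
  apply/eqP; rewrite eqEsubv subvf /=; apply/subvP => x _.
  have -> : x = f (x 0 0 *: v - x 0 1 *: u).
    rewrite fE; apply/rowP => i; rewrite mxE.
    rewrite !(functionalB (lr _)) !(functionalZ (lr _)) !alt uv vu.
    rewrite mulr1 !mulr0 subr0 mulrN1 opprK add0r.
    case: (eqVneq i 0) => [->|i0] //.
    by congr (x 0 _); apply: val_inj; case: i i0 => -[|[|]].
  by apply: memv_img; rewrite memvB// memvZ.
pose W' := (W :&: lker f)%VS.
have W'P w : w \in W' -> [/\ w \in W, Om u w = 0 & Om v w = 0].
  rewrite memv_cap memv_ker fE => /andP[wW /eqP/rowP Fw]; split => //.
    by have := Fw 0; rewrite !mxE.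
  by have := Fw 1; rewrite !mxE.
have dimW : \dim W = (\dim W').+2.
  by rewrite -(limg_ker_dim f W) imf dimvf /dim /= mul1n addn2.
have [||n [b [dn bW' bs]]] := IH W'.
- by rewrite (leq_trans _ Wd)// dimW.
- move=> w /W'P[wW uw vw] w0; have [y yW wy] := nd w wW w0.
  (* The projection of y to W' along u and v; its pairing with w is unchanged because w is
     orthogonal to both. *)
  exists (y - Om u y *: v + Om v y *: u).
    rewrite memv_cap memvD ?memvB ?memvZ//= memv_ker fE; apply/eqP/rowP => i.
    rewrite !mxE !(functionalD (lr _)) !(functionalN (lr _)) !(functionalZ (lr _)) !alt uv vu.
    by rewrite !mulr0 mulr1 mulrN1 oppr0 !addr0 !subrr; case: ifP.
  rewrite !(functionalD (lr _)) !(functionalN (lr _)) !(functionalZ (lr _)).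
  by rewrite (alternating_anti w v) (alternating_anti w u) uw vw !oppr0 !mulr0 oppr0 !addr0.
exists n.+1, (fun i => if i is j.+1 then (if j is l.+1 then b l else v) else u).
split; first by rewrite dimW dn doubleS.
- by move=> [|[|i]] //; rewrite doubleS !ltnS => /bW' /W'P[].
move=> [|[|i]] [|[|j]]; rewrite ?doubleS ?ltnS ?alt ?uv ?vu => hi hj //=.
- by have [_ -> _] := W'P _ (bW' _ hj).
- by have [_ _ ->] := W'P _ (bW' _ hj).
- rewrite alternating_anti; have [_ -> _] := W'P _ (bW' _ hi).
  by rewrite oppr0 /symp /= andbF /= andbF.
- rewrite alternating_anti; have [_ _ ->] := W'P _ (bW' _ hi).
  by rewrite oppr0; case: i hi => [|i] hi; rewrite /symp /= ?andbF.
- by rewrite bs// /symp /= !negbK !eqSS.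
Qed.

(** [symplectic_basis] is applied to ker eta. As eta A = 1, this kernel has codimension one, which
    makes k odd. *)
Lemma contact_dual_basis (eta : 'rV[R]_k -> R) (A : 'rV[R]_k) :
  scalar eta -> eta A = 1 ->
  (forall u, eta u = 0 -> u != 0 -> exists2 v, eta v = 0 & Om u v != 0) ->
  exists n (b : nat -> 'rV[R]_k), [/\ k = n.*2.+1,
    forall i, (i < n.*2)%N -> eta (b i) = 0 &
    forall i j, (i < n.*2)%N -> (j < n.*2)%N -> Om (b i) (b j) = symp R i j].
Proof.
move=> le eA nd.
pose F w : 'rV[R]_1 := const_mx (eta w).
have lF : linear F by move=> a x y; apply/rowP => i; rewrite !mxE le.
pose FL : {linear 'rV[R]_k -> 'rV[R]_1} := HB.pack F (GRing.isLinear.Build _ _ _ _ F lF).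
pose f : 'Hom('rV[R]_k, 'rV[R]_1) := linfun FL.
have fE w : f w = F w by rewrite lfunE.
have kerP w : w \in lker f -> eta w = 0.
  by rewrite memv_ker fE => /eqP/rowP /(_ 0); rewrite !mxE.
have kerI w : eta w = 0 -> w \in lker f.
  by move=> ew; rewrite memv_ker fE; apply/eqP/rowP => i; rewrite !mxE ew.
have imf : limg f = fullv.
  apply/eqP; rewrite eqEsubv subvf /=; apply/subvP => x _.
  have -> : x = f (x 0 0 *: A).
    by rewrite fE; apply/rowP => i; rewrite mxE (functionalZ le) eA mulr1 (ord1 i).
  exact/memv_img/memvf.
have [|n [b [dn bW bs]]] := @symplectic_basis (lker f).
  by move=> u /kerP u0 un0; have [v /kerI vk uv] := nd u u0 un0; exists v.
exists n, b; split => //; last by move=> i /bW /kerP.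
have := limg_ker_dim f fullv; rewrite capfv dn imf !dimvf /dim /= !mul1n addn1.
by move=> <-.
Qed.

End SymplecticBasis.

(** * Homogeneous structures on the product *)

Section Slice.
Variables (R : realType) (m : nat) (M : manifold R m).
Notation N := (prod_Rplus M).

Definition unit_pt (x : M) : N := (x, 1%:pos : Rplus R).
Definition hvec (u : 'rV[R]_m) : 'rV[R]_(m + 1) := row_mx u 0.
(** The vector d/ds, which on the slice s = 1 is the generator Delta of the action; the vectors
    [hvec u] are those tangent to the slices s = const. *)
Definition evec : 'rV[R]_(m + 1) := row_mx 0 (const_mx 1).

Lemma hvec_linear : linear hvec.
Proof. by move=> a u v; rewrite /hvec scale_row_mx add_row_mx scaler0 addr0. Qed.

Lemma vec_decomp (w : 'rV[R]_(m + 1)) :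
  w = rsubmx w 0 0 *: evec + hvec (lsubmx w).
Proof.
rewrite /evec /hvec scale_row_mx add_row_mx scaler0 add0r addr0 -[LHS]hsubmxK.
by congr row_mx; apply/rowP => i; rewrite (ord1 i) [RHS]mxE [X in _ * X]mxE mulr1.
Qed.

Lemma lsubmx_evec : lsubmx evec = 0. Proof. exact: row_mxKl. Qed.
Lemma rsubmx_evec : rsubmx evec 0 0 = 1. Proof. by rewrite row_mxKr mxE. Qed.
Lemma lsubmx_hvec u : lsubmx (hvec u) = u. Proof. exact: row_mxKl. Qed.
Lemma rsubmx_hvec u : rsubmx (hvec u) 0 0 = 0. Proof. by rewrite row_mxKr mxE. Qed.

Lemma slice_cimg (c : chart R m M) y : cimg c y ->
  prod_cimg c (row_mx y (const_mx 1)).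
Proof. by move=> iy; split; rewrite ?row_mxKl ?row_mxKr ?mxE. Qed.

Lemma slice_cinv (c : chart R m M) y :
  prod_cinv c (row_mx y (const_mx 1)) = unit_pt (cinv c y).
Proof.
rewrite /prod_cinv row_mxKl row_mxKr mxE; congr pair.
by apply: Rplus_inj; rewrite to_Rplus_num.
Qed.

Lemma coord_vec_hvec (c : chart R m M) (q : N) u : atlas c -> cdom c q.1 ->
  coord_vec (prod_chart c : chart R (m + 1) N) (hvec u) q = hvec (coord_vec c u q.1).
Proof. by move=> ac cq; rewrite coord_vec_prod// /hvec row_mxKl row_mxKr. Qed.

Lemma coord_vec_evec (c : chart R m M) (q : N) : atlas c -> cdom c q.1 ->
  coord_vec (prod_chart c : chart R (m + 1) N) evec q = evec.
Proof.
move=> ac cq; rewrite coord_vec_prod// lsubmx_evec /evec row_mxKr; congr row_mx.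
have := coord_vec_linear ac cq (-1) 0 0.
by rewrite scaler0 addr0 scaleN1r addNr.
Qed.

Lemma smooth_slice (B : form2 N) (c : chart R m M) a b y :
  smooth_bilin B -> atlas c -> cimg c y ->
  smooth_at (fun z => comp2 B (prod_chart c) a b (row_mx z (const_mx 1))) y.
Proof.
move=> sB ac iy; have sz : smooth_at (fun z : 'rV[R]_m => row_mx z (const_mx 1 : 'rV[R]_1)) y.
  by apply: smooth_at_row_mx; [exact: smooth_at_id|exact: smooth_at_cst].
apply: (smooth_at_compR sz); apply: smooth_comp2_at => //.
  exact: prod_chart_atlas.
exact: slice_cimg.
Qed.

Lemma comp2_slice_hh (B : form2 N) (c : chart R m M) u v y : atlas c -> cimg c y ->
  comp2 B (prod_chart c) (hvec u) (hvec v) (row_mx y (const_mx 1)) =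
  comp2 (fun x u v => B (unit_pt x) (hvec u) (hvec v)) c u v y.
Proof.
move=> ac iy; rewrite /comp2 /= slice_cinv.
by rewrite !coord_vec_hvec//; exact: cinv_dom.
Qed.

Lemma comp2_slice_eh (B : form2 N) (c : chart R m M) u y : atlas c -> cimg c y ->
  comp2 B (prod_chart c) evec (hvec u) (row_mx y (const_mx 1)) =
  comp1 (fun x u => B (unit_pt x) evec (hvec u)) c u y.
Proof.
move=> ac iy; rewrite /comp2 /comp1 /= slice_cinv.
by rewrite coord_vec_hvec ?coord_vec_evec//; exact: cinv_dom.
Qed.

Lemma smooth_slice_eh (B : form2 N) :
  smooth_bilin B -> smooth_form1 (fun x u => B (unit_pt x) evec (hvec u)).
Proof.
move=> sB; have [lr ll _] := sB; split=> [x a u v|c ac u].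
  by rewrite hvec_linear lr.
apply: smooth_at_Csmooth => y iy; apply: smooth_at_ext (smooth_slice evec (hvec u) sB ac iy).
apply: filterS (open_near (@cimg_open _ _ _ c) iy) => z iz.
exact: comp2_slice_eh.
Qed.

Lemma smooth_slice_hh (B : form2 N) :
  smooth_bilin B -> smooth_bilin (fun x u v => B (unit_pt x) (hvec u) (hvec v)).
Proof.
move=> sB; have [lr ll _] := sB; split=> [x w a u v|x w a u v|c ac u v].
- by rewrite hvec_linear lr.
- by rewrite hvec_linear ll.
apply: smooth_at_Csmooth => y iy.
apply: smooth_at_ext (smooth_slice (hvec u) (hvec v) sB ac iy).
apply: filterS (open_near (@cimg_open _ _ _ c) iy) => z iz.
exact: comp2_slice_hh.
Qed.

Lemma fsmooth_slice_ee (B : form2 N) (x : M) :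
  smooth_bilin B -> fsmooth (fun x => B (unit_pt x) evec evec) x.
Proof.
move=> sB; have ac := atlas_chart_at x; have cx := mem_chart_at x.
apply: smooth_at_ext (smooth_slice evec evec sB ac (cmap_img cx)).
apply: filterS (open_near (@cimg_open _ _ _ _) (cmap_img cx)) => z iz.
rewrite /comp2 /= slice_cinv coord_vec_evec//; exact: cinv_dom.
Qed.

End Slice.

(** * Recovering eta, mu and g_M from the slice s = 1 *)

Section HomogeneousProduct.
Variables (R : realType) (m : nat) (M : manifold R m).
Notation N := (prod_Rplus M).
Notation evec := (evec R m).

Section Bilinear.
Variable B : form2 N.
Hypotheses (lr : forall q u, scalar (B q u)) (ll : forall q v, scalar (B q ^~ v)).

Lemma bilin_decomp q u v : B q u v =
  rsubmx u 0 0 * (rsubmx v 0 0 * B q evec evec + B q evec (hvec (lsubmx v)))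
  + (rsubmx v 0 0 * B q (hvec (lsubmx u)) evec
  + B q (hvec (lsubmx u)) (hvec (lsubmx v))).
Proof.
by rewrite {1}(vec_decomp u) ll {1 2}(vec_decomp v) !lr.
Qed.

(** The action of t = [q.2] carries [unit_pt q.1] to q, and its tangent map multiplies the last
    component by t; hence the inverse factors. *)
Lemma homogeneous_rescale (q : N) u v :
  (forall t q u v, pull2 (@prod_act R m M t) B q u v = num t * B q u v) ->
  B q u v = num q.2 * B (unit_pt q.1)
    (row_mx (lsubmx u) ((num q.2)^-1 *: rsubmx u))
    (row_mx (lsubmx v) ((num q.2)^-1 *: rsubmx v)).
Proof.
move=> hom; rewrite -hom /pull2 !tmap_prod_act !row_mxKl !row_mxKr.
rewrite !scalerA divff// !scale1r !hsubmxK; congr (B _ u v).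
by case: q => x s; congr pair; apply: Rplus_inj; rewrite /= mulr1.
Qed.

End Bilinear.

Variables (om g : form2 N) (J : N -> 'rV[R]_(m + 1) -> 'rV[R]_(m + 1)).
Hypotheses (som : smooth_form2 om) (clom : closed_form2 om) (rg : riemannian g).
Hypothesis hom_om : forall t q u v, pull2 (@prod_act R m M t) om q u v = num t * om q u v.
Hypothesis hom_g : forall t q u v, pull2 (@prod_act R m M t) g q u v = num t * g q u v.
Hypothesis gJ : forall q u v, g q u v = om q u (J q v).
Hypothesis JJ : forall q v, J q (J q v) = - v.
(** The normalization s = g (Delta, Delta) of the coordinate, read at s = 1. *)
Hypothesis gee : forall x, g (unit_pt x) evec evec = 1.

Let eta : form1 M := fun x u => om (unit_pt x) evec (hvec u).
Let mu : form1 M := fun x u => g (unit_pt x) evec (hvec u).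
Let B : form2 M := fun x u v => om (unit_pt x) (hvec u) (hvec v).
Let gM : form2 M := fun x u v =>
  g (unit_pt x) (hvec u) (hvec v) - mu x u * mu x v.

Let lro q u : scalar (om q u). Proof. by case: som => -[lr _ _] _; exact: lr. Qed.
Let llo q v : scalar (om q ^~ v). Proof. by case: som => -[_ ll _] _; exact: ll. Qed.
Let alto q u : om q u u = 0. Proof. by case: som => _ alt; exact: alt. Qed.
Let lrg q u : scalar (g q u). Proof. by case: rg => -[lr _ _] _ _; exact: lr. Qed.
Let llg q v : scalar (g q ^~ v). Proof. by case: rg => -[_ ll _] _ _; exact: ll. Qed.
Let symg q u v : g q u v = g q v u. Proof. by case: rg => _ sym _; exact: sym. Qed.
Let antio q u v : om q u v = - om q v u.
Proof. by apply: alternating_anti; [exact: lro|exact: llo|exact: alto]. Qed.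
Let seta : smooth_form1 eta. Proof. exact: smooth_slice_eh som.1. Qed.
Let smu : smooth_form1 mu. Proof. by case: rg => sg _ _; exact: smooth_slice_eh sg. Qed.
Let sB : smooth_bilin B. Proof. exact: smooth_slice_hh som.1. Qed.

Lemma slice_om x u v : om (unit_pt x) u v =
  rsubmx u 0 0 * eta x (lsubmx v) - rsubmx v 0 0 * eta x (lsubmx u)
  + B x (lsubmx u) (lsubmx v).
Proof.
rewrite (bilin_decomp lro llo) alto mulr0 add0r (antio _ (hvec _) evec).
by rewrite mulrN addrA.
Qed.

(** Completing the square in the vertical component, whose coefficient is 1 by [gee]. *)
Lemma slice_g x u v : g (unit_pt x) u v =
  (rsubmx u 0 0 + mu x (lsubmx u)) * (rsubmx v 0 0 + mu x (lsubmx v))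
  + gM x (lsubmx u) (lsubmx v).
Proof.
rewrite (bilin_decomp lrg llg) gee (symg _ (hvec _) evec) /gM -/(mu x _) -/(mu x _).
by ring.
Qed.

Lemma cone_om q u v : om q u v =
  rsubmx u 0 0 * eta q.1 (lsubmx v) - rsubmx v 0 0 * eta q.1 (lsubmx u)
  + num q.2 * B q.1 (lsubmx u) (lsubmx v).
Proof.
rewrite (homogeneous_rescale q u v hom_om) slice_om !row_mxKl !row_mxKr.
have E w : ((num q.2)^-1 *: rsubmx w) 0 0 = (num q.2)^-1 * rsubmx w 0 0 by rewrite mxE.
rewrite !E; have alg (s a b c d r : R) : s != 0 ->
  s * (s^-1 * a * b - s^-1 * c * d + r) = a * b - c * d + s * r by move=> s0; field.
exact: alg.
Qed.

Lemma cone_om_hh q u v : om q (hvec u) (hvec v) = num q.2 * B q.1 u v.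
Proof. by rewrite cone_om !rsubmx_hvec !lsubmx_hvec !mul0r subrr add0r. Qed.

Lemma cone_om_eh q u : om q evec (hvec u) = eta q.1 u.
Proof.
rewrite cone_om rsubmx_hvec rsubmx_evec lsubmx_hvec lsubmx_evec mul0r mul1r subr0.
by case: sB => _ ll _; rewrite (functional0 (ll _ u)) mulr0 addr0.
Qed.

Lemma cone_g q u v : g q u v = g_of gM mu q u v.
Proof.
rewrite (homogeneous_rescale q u v hom_g) slice_g g_ofE !row_mxKl !row_mxKr.
have E w : ((num q.2)^-1 *: rsubmx w) 0 0 = rsubmx w 0 0 / num q.2.
  by rewrite mxE mulrC.
by rewrite !E.
Qed.

(* This is [d om (Delta, X, Y) = 0] for coordinate fields [X], [Y] of [M]. *)
Lemma slice_extd1 x u v : B x u v = extd1 eta x u v.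
Proof.
set c := chart_at x; have ac : atlas c by exact: atlas_chart_at.
have cx : cdom c x by exact: mem_chart_at.
have ix : cimg c (cmap c x) by exact: cmap_img.
set y := prod_cmap c (unit_pt x).
have iy : prod_cimg c y by exact/prod_cmap_img/(mem_chart_at (unit_pt x)).
have ly : lsubmx y = cmap c x by rewrite row_mxKl.
have near_img : \forall z \near y, prod_cimg c z.
  exact: open_near (@cimg_open _ _ _ (prod_chart c)) iy.
(* On vectors tangent to the slices, [om] is s times [B], and [B] does not depend on s. On pairs
   with [evec] it is [eta], again independent of s ([deh]). *)
have dB : 'D_evec (comp2 om (prod_chart c) (hvec u) (hvec v)) y = B x u v.
  have E : 'D_evec (comp2 om (prod_chart c) (hvec u) (hvec v)) y =
      'D_evec (fun z : 'rV[R]_(m + 1) => rsubmx z 0 0 * comp2 B c u v (lsubmx z)) y.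
    apply: near_eq_derive; apply: filterS near_img => z [iz z0].
    rewrite [in LHS]/comp2 coord_vec_hvec; [|exact: ac|exact: cinv_dom].
    rewrite coord_vec_hvec; [|exact: ac|exact: cinv_dom].
    rewrite cone_om_hh; congr (_ * _); exact: to_Rplus_num.
  have sc : smooth_at (comp2 B c u v) (lsubmx y).
    by rewrite ly; exact: smooth_comp2_at.
  apply: etrans E _.
  apply: etrans (deriveM (smooth_at_derivable (smooth_rsubmx00 y))
    (smooth_at_derivable (smooth_comp_lsubmx sc))) _.
  have e1 : 'D_evec (fun z : 'rV[R]_(m + 1) => comp2 B c u v (lsubmx z)) y = 0.
    by rewrite derive_comp_lsubmx lsubmx_evec derive0.
  have e2 := derive_rsubmx00 y evec.
  have e3 : comp2 B c u v (lsubmx y) = B x u v.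
    by rewrite ly /comp2 cmapK// !coord_vec_at.
  have alg (r d b d' : R) : d = 0 -> d' = 1 -> r *: d + b *: d' = b.
    by move=> -> ->; rewrite scaler0 add0r /GRing.scale /= mulr1.
  by rewrite -[RHS]e3; apply: alg e1 _; rewrite -[RHS](rsubmx_evec R m).
have deh a b : 'D_(hvec b) (comp2 om (prod_chart c) evec (hvec a)) y =
    'D_b (comp1 eta c a) (cmap c x).
  have E : 'D_(hvec b) (comp2 om (prod_chart c) evec (hvec a)) y =
      'D_(hvec b) (fun z : 'rV[R]_(m + 1) => comp1 eta c a (lsubmx z)) y.
    apply: near_eq_derive; apply: filterS near_img => z [iz z0].
    rewrite [in LHS]/comp2 coord_vec_hvec; [|exact: ac|exact: cinv_dom].
    rewrite coord_vec_evec; [|exact: ac|exact: cinv_dom].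
    exact: cone_om_eh.
  apply: etrans E _; apply: etrans (derive_comp_lsubmx _ _ _) _.
  by rewrite lsubmx_hvec ly.
have dhe a b : 'D_(hvec b) (comp2 om (prod_chart c) (hvec a) evec) y =
    - 'D_b (comp1 eta c a) (cmap c x).
  have E : 'D_(hvec b) (comp2 om (prod_chart c) (hvec a) evec) y =
      'D_(hvec b) (- comp2 om (prod_chart c) evec (hvec a)) y.
    apply: near_eq_derive; apply: filterS near_img => z iz.
    exact: antio.
  have sc := smooth_comp2_at evec (hvec a) som.1 (prod_chart_atlas ac) iy.
  apply: etrans E _; apply: etrans (deriveN (smooth_at_derivable sc)) _.
  by rewrite (deh a b).
have alg (t1 t2 t3 b d1 d2 : R) : t1 + t2 + t3 = 0 -> t1 = b -> t2 = - d1 -> t3 = d2 ->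
    b = d1 - d2.
  by move=> h e1 e2 e3; move: h; rewrite e1 e2 e3 => h; lra.
exact: (alg _ _ _ _ _ _ (clom (unit_pt x) evec (hvec u) (hvec v)) dB (dhe v u) (deh u v)).
Qed.

Lemma om_omega_of q u v : om q u v = omega_of eta q u v.
Proof. by rewrite cone_om omega_ofE slice_extd1. Qed.

(* [ds/s + mu] at [s = 1] *)
Let th x (w : 'rV[R]_(m + 1)) : R := rsubmx w 0 0 + mu x (lsubmx w).

Lemma slice_g_evec x w : g (unit_pt x) evec w = th x w.
Proof.
rewrite slice_g rsubmx_evec lsubmx_evec (functional0 (smu.1 x)) addr0 mul1r.
have z0 : hvec (0 : 'rV[R]_m) = 0 by rewrite /hvec row_mx0.
by rewrite /gM z0 (functional0 (llg _ _)) (functional0 (smu.1 x)) mul0r subrr addr0.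
Qed.

Lemma slice_om_evec x w : om (unit_pt x) evec w = eta x (lsubmx w).
Proof.
rewrite slice_om rsubmx_evec lsubmx_evec mul1r (functional0 (seta.1 x)) mulr0 subr0.
have z0 : hvec (0 : 'rV[R]_m) = 0 by rewrite /hvec row_mx0.
by rewrite /B z0 (functional0 (llo _ _)) addr0.
Qed.

(** Since theta = g (Delta, _) and eta = om (Delta, _), the relation g = om (_, J _) gives eta (J w)
    = theta (w) at once, and together with J^2 = -1 it gives theta (J w) = - eta (w). *)
Lemma th_J x w : th x (J (unit_pt x) w) = - eta x (lsubmx w).
Proof.
by rewrite -slice_g_evec gJ JJ (functionalN (lro _ _)) slice_om_evec.
Qed.

Lemma eta_J x w : eta x (lsubmx (J (unit_pt x) w)) = th x w.
Proof. by rewrite -slice_om_evec -gJ slice_g_evec. Qed.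

Let A x := lsubmx (J (unit_pt x) evec).
Let V x (v : 'rV[R]_m) : 'rV[R]_(m + 1) := hvec v - mu x v *: evec.
Let phi x v := lsubmx (J (unit_pt x) (V x v)).

Lemma th_V x v : th x (V x v) = 0.
Proof.
rewrite -slice_g_evec (functionalB (lrg _ _)) (functionalZ (lrg _ _)) gee mulr1.
by rewrite -/(mu x v) subrr.
Qed.

Lemma lsubmx_V x v : lsubmx (V x v) = v.
Proof.
by rewrite GRing.linearB /= lsubmx_hvec GRing.linearZ /= lsubmx_evec scaler0 subr0.
Qed.

(** A vector orthogonal to Delta is determined by its projection to M. This is how values of [J] are
    recognized as lifts in [J_evec_V] and [phi_spec]. *)
Lemma th0_V x w : th x w = 0 -> w = V x (lsubmx w).
Proof.
move=> /eqP; rewrite addr_eq0 => /eqP rw; rewrite [LHS]vec_decomp rw.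
by rewrite /V scaleNr addrC.
Qed.

Lemma eta_A x : eta x (A x) = 1.
Proof.
by rewrite eta_J -slice_g_evec gee.
Qed.

Lemma gM_V x u v : gM x u v = g (unit_pt x) (hvec u) (V x v).
Proof. by rewrite slice_g -/(th x (V x v)) th_V mulr0 add0r lsubmx_hvec lsubmx_V. Qed.

Lemma J_evec_V x : J (unit_pt x) evec = V x (A x).
Proof.
by apply: th0_V; rewrite th_J lsubmx_evec (functional0 (seta.1 x)) oppr0.
Qed.

(** So A is dual to eta under g_M: it is orthogonal to C and has length eta (A) = 1. *)
Lemma gM_A x u : gM x u (A x) = eta x u.
Proof. by rewrite gM_V -J_evec_V gJ JJ (functionalN (lro _ _)) -antio. Qed.

Lemma smooth_gM : smooth_bilin gM.
Proof.
have [sg _ _] := rg; have [lr ll _] := smooth_slice_hh sg; have lm := smu.1.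
split=> [x w a u v|x w a u v|c ac u v].
- by rewrite /gM lr lm; ring.
- by rewrite /gM ll lm; ring.
apply: smooth_at_Csmooth => y iy.
rewrite (_ : comp2 gM c u v = fun y =>
  comp2 (fun x u v => g (unit_pt x) (hvec u) (hvec v)) c u v y
  + (-1) * (comp1 mu c u y * comp1 mu c v y)); last first.
  by apply/funext => z; rewrite mulN1r.
apply: smooth_at_add; first exact: smooth_comp2_at (smooth_slice_hh sg) ac iy.
apply: smooth_at_mul; first exact: smooth_at_cst.
by apply: smooth_at_mul; exact: smooth_comp1_at.
Qed.

Lemma riemannian_gM : riemannian gM.
Proof.
split; first exact: smooth_gM.
  by move=> x u v; rewrite /gM symg mulrC.
(* g_M is g evaluated on the lifts orthogonal to Delta, so it inherits positivity. *)
move=> x u u0; have -> : gM x u u = g (unit_pt x) (V x u) (V x u).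
  by rewrite gM_V slice_g (slice_g x (V x u)) -/(th x (V x u)) th_V mulr0 mul0r
    lsubmx_V lsubmx_hvec.
have [_ _ pos] := rg; apply: pos; apply: contra_neq u0 => V0.
by rewrite -(lsubmx_V x u) V0 GRing.raddf0.
Qed.

(** For v in C, the vector J (V v) is killed by theta and its projection by eta, so it is the lift
    of a vector of C. Thus J preserves the lift of C, and J^2 = -1 descends to [phi]. *)
Lemma phi_spec x v : eta x v = 0 -> [/\ eta x (phi x v) = 0,
  forall u, eta x u = 0 -> gM x u v = extd1 eta x u (phi x v) &
  phi x (phi x v) = - v].
Proof.
move=> ev; have JV : J (unit_pt x) (V x v) = V x (phi x v).
  by apply: th0_V; rewrite th_J lsubmx_V ev oppr0.
split.
- by rewrite eta_J th_V.
- move=> u eu; rewrite gM_V gJ slice_om lsubmx_hvec rsubmx_hvec eu mul0r mulr0 subrr add0r.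
  exact: slice_extd1.
- by rewrite {1}/phi -JV JJ GRing.raddfN /= lsubmx_V.
Qed.

Lemma homogeneous_product_contact : contact_metric eta gM.
Proof.
split; last first.
  split; [exact: riemannian_gM| |by exists phi => x v; exact: phi_spec].
  move=> x z zperp; have le := seta.1 x; have [lr _ _] := smooth_gM.
  (* The vector z - eta (z) A lies in C, so g_M (z, z) = eta (z) g_M (z, A), which is eta (z)^2 by
     [gM_A]. *)
  have w0 : gM x z (z - eta x z *: A x) = 0.
    by apply: zperp; rewrite (functionalB le) (functionalZ le) eta_A mulr1 subrr.
  move: w0; rewrite (functionalB (lr _ _)) (functionalZ (lr _ _)) gM_A.
  by move=> /eqP; rewrite subr_eq0 => /eqP ->; rewrite real_normK ?num_real// expr2.
split=> //.
have basis x := contact_dual_basis (fun u => extd1_linearr x u seta)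
  (fun v => extd1_linearl x v seta) (extd1_alt eta x) (seta.1 x) (eta_A x).
(* d eta is nondegenerate on C because d eta (u, phi u) = g_M (u, u) > 0. *)
have nd x u : eta x u = 0 -> u != 0 -> exists2 v, eta x v = 0 & extd1 eta x u v != 0.
  move=> eu u0; have [ep gp _] := phi_spec eu; exists (phi x u) => //.
  by rewrite -(gp _ eu) gt_eqF//; have [_ _] := riemannian_gM; exact.
(* The exponent n is read off at one point; at any other point m = 2n' + 1 forces n' = n. *)
have [x0] := manifold_nonempty M.
have [n [_ [mn _ _]]] := basis x0 (nd x0); exists n => // x.
have [n' [b [mn' eb bs]]] := basis x (nd x).
have nn : n' = n.
  by apply: double_inj; apply: succn_inj; rewrite -mn -mn'.
rewrite {}nn in eb bs.
have h := contact_wedge_neq0 (eta_A x) eb bs.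
by eexists; exact: h.
Qed.

(** For u in C: mu (u) = g (u, Delta) = om (u, J Delta) = d eta (u, A), with A in the last slot. *)
Lemma homogeneous_product_compatible : compatible eta gM mu.
Proof.
split=> //; exists A => [x|x u eu].
  split; last exact: eta_A.
  by move=> u eu; have [_ sym _] := riemannian_gM; rewrite sym gM_A.
have -> : mu x u = g (unit_pt x) (hvec u) evec by rewrite symg.
rewrite gJ slice_om lsubmx_hvec rsubmx_hvec eu mul0r mulr0 subrr add0r.
exact: slice_extd1.
Qed.

Lemma homogeneous_product_structure :
  exists (eta : form1 M) (gM : form2 M) (mu : form1 M),
    [/\ contact_metric eta gM, compatible eta gM mu,
      forall q u v, om q u v = omega_of eta q u v &
      forall q u v, g q u v = g_of gM mu q u v].
Proof.
exists eta, gM, mu; split.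
- exact: homogeneous_product_contact.
- exact: homogeneous_product_compatible.
- exact: om_omega_of.
- exact: cone_g.
Qed.

End HomogeneousProduct.

(** * The trivialization given by the norm of the Euler field *)

Section Differentials.
Variables (R : realType).

Lemma near_dfun m (M : manifold R m) (f f' : M -> R) p u :
  (\forall q \near p, f q = f' q) -> dfun f p u = dfun f' p u.
Proof.
move=> ff'; apply: near_eq_derive.
by apply: filterS (near_cmap (mem_chart_at p) ff') => y [].
Qed.

Lemma dfun_mul m (M : manifold R m) (f f' : M -> R) p u :
  fsmooth f p -> fsmooth f' p ->
  dfun (fun q => f q * f' q) p u = f p * dfun f' p u + f' p * dfun f p u.
Proof.
move=> sf sf'; apply: etrans (deriveM (smooth_at_derivable sf) (smooth_at_derivable sf')) _.
by rewrite /= (cmapK (mem_chart_at p)).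
Qed.

Lemma dfun_comp m k (M : manifold R m) (N : manifold R k) (F : M -> N) (f : N -> R) p u :
  msmooth F p -> fsmooth f (F p) -> dfun f (F p) (tmap F p u) = dfun (f \o F) p u.
Proof.
move=> [cF sF] sf.
have e : loc F (chart_at p) (chart_at (F p)) (cmap (chart_at p) p) =
    cmap (chart_at (F p)) (F p).
  by rewrite /loc /= cmapK //; exact: mem_chart_at.
rewrite /fsmooth -e in sf; apply: esym; rewrite /dfun tmapE -e.
have dF := smooth_at_diff sF; have df := smooth_at_diffR sf.
apply: etrans (derive_chain u dF df); apply: near_eq_derive.
have nc : nbhs p [set q | cdom (chart_at (F p)) (F q)].
  exact: near_continuous cF (open_near (@cdom_open _ _ _ _) (mem_chart_at (F p))).
by apply: filterS (near_cmap (mem_chart_at p) nc) => y [iy cy]; rewrite /loc /= (cmapK cy).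
Qed.

Lemma tmap0 m k (M : manifold R m) (N : manifold R k) (F : M -> N) p : tmap F p 0 = 0.
Proof. exact: derive0. Qed.

Lemma tmapN m k (M : manifold R m) (N : manifold R k) (F : M -> N) p u :
  msmooth F p -> tmap F p (- u) = - tmap F p u.
Proof.
move=> sF; have := tmap_linear sF (-1) u 0.
by rewrite !scaleN1r addr0 tmap0 addr0.
Qed.

Lemma msmooth_fst_map m k (M : manifold R m) (N : manifold R k) (F : M -> N)
    (q : prod_Rplus M) : msmooth F q.1 ->
  msmooth (fun q : prod_Rplus M => (F q.1, q.2) : prod_Rplus N) q.
Proof.
move=> sF; apply: msmooth_prod; last exact: fsmooth_prod_s.
exact: (msmooth_comp (@msmooth_prod_pi _ _ M q) sF).
Qed.

(** A map acting only on the first factor fixes d/ds. Composed with the action, this shows that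
    equivariant maps carry the Euler field to the Euler field. *)
Lemma tmap_fst_map_evec m k (M : manifold R m) (N : manifold R k) (F : M -> N)
    (q : prod_Rplus M) : msmooth F q.1 ->
  tmap (fun q : prod_Rplus M => (F q.1, q.2) : prod_Rplus N) q (evec R m) = evec R k.
Proof.
move=> sF; rewrite tmap_prod; last 2 first.
- exact: (msmooth_comp (@msmooth_prod_pi _ _ M q) sF).
- exact: fsmooth_prod_s.
rewrite /evec; congr row_mx.
  apply: etrans (tmap_comp _ (@msmooth_prod_pi _ _ M q) sF) _.
  by rewrite tmap_prod_pi lsubmx_evec tmap0.
by congr const_mx; apply: etrans (dfun_prod_s _ _) _; exact: rsubmx_evec.
Qed.

Lemma msmooth_pair_cst m (M : manifold R m) (t : Rplus R) p :
  msmooth (fun p : M => (p, t) : prod_Rplus M) p.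
Proof. by apply: msmooth_prod; [exact: msmooth_id|exact: fsmooth_cst]. Qed.

End Differentials.

Section PrincipalBundle.
Variables (R : realType) (m : nat) (M : manifold R m) (P : manifold R (m + 1)).
Variables (pi : P -> M) (h : Rplus R -> P -> P).
Hypothesis pb : principal_bundle pi h.
Notation N := (prod_Rplus M).
Notation PN := (prod_Rplus P).
Notation evecP := (evec R (m + 1)).

(** The group variable is the last coordinate, so Delta at y is the image of d/ds at (y, 1) under
    the tangent map. *)
Definition act_map : PN -> P := fun q => h q.2 q.1.

Lemma msmooth_act_map q : msmooth act_map q.
Proof. by have [_ _ sa _ _] := pb; exact: smooth_on_msmooth sa _. Qed.

Lemma msmooth_pi y : msmooth pi y.
Proof. by have [_ _ _ [sp _] _] := pb; exact: smooth_on_msmooth sp _. Qed.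

Lemma pi_act t y : pi (h t y) = pi y.
Proof. by have [_ _ _ [_ hp] _] := pb; exact: hp. Qed.

Lemma act1 y : h (1%:pos : {posnum R}) y = y.
Proof. by have [h1 _ _ _ _] := pb; exact: h1. Qed.

Lemma actM s t y : h (Rplus_mul s t) y = h s (h t y).
Proof. by have [_ hM _ _ _] := pb; exact: hM. Qed.

Lemma Rplus_mulC (s t : Rplus R) : Rplus_mul s t = Rplus_mul t s.
Proof. by apply: Rplus_inj; rewrite /= mulrC. Qed.

Lemma msmooth_act t y : msmooth (h t) y.
Proof. exact: (msmooth_comp (msmooth_pair_cst t y) (msmooth_act_map _)). Qed.

Lemma fiber_orbit y y' : pi y = pi y' -> exists t, y' = h t y.
Proof.
move=> yy'; have [_ _ _ _ lt] := pb; have [U [Phi [Uy [oU [Psi]]]]] := lt (pi y).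
move=> [_ _ PsiK _ eqv].
have Uy' : U (pi y') by rewrite -yy'.
have [e1 e2] := eqv y Uy; have [e1' e2'] := eqv y' Uy'.
(* The ratio of the fibre coordinates of the two points in a local trivialization. *)
pose t : Rplus R := to_Rplus (num (Phi y').2 / num (Phi y).2).
exists t; rewrite -[LHS]PsiK// -[RHS]PsiK ?pi_act//; congr Psi.
rewrite e2 [LHS]surjective_pairing e1' e1 yy'; congr pair.
by apply: Rplus_inj; rewrite /= to_Rplus_num// divfK.
Qed.

Lemma local_section x0 : exists U (sg : M -> P), [/\ open U, U x0 &
  forall x, U x -> pi (sg x) = x /\ msmooth sg x].
Proof.
have [_ _ _ _ lt] := pb; have [U [Phi [Ux [oU [Psi]]]]] := lt x0.
move=> [_ sPsi _ PhiK eqv]; exists U, (Psi \o @unit_pt R m M); split => // x Ux'.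
split; last first.
  apply: (msmooth_comp (msmooth_pair_cst _ x)).
  exact: (smooth_on_msmooth sPsi).
have [Up e] := PhiK (unit_pt x) Ux'.
by have [e1 _] := eqv _ Up; rewrite /= -e1 e.
Qed.

(* The fibre coordinate [f] of a local trivialization is homogeneous of degree
   one, so its derivative along the Euler field is [f], which is positive. *)
Lemma euler_neq0 y : tmap act_map (unit_pt y) evecP != 0.
Proof.
have [_ _ _ _ lt] := pb; have [U [Phi [Uy [oU [Psi]]]]] := lt (pi y).
move=> [sPhi _ _ _ eqv]; pose f (z : P) := num (Phi z).2.
have sf z : U (pi z) -> fsmooth f z.
  move=> Uz; have sz : msmooth Phi z by exact: smooth_on_msmooth sPhi Uz.
  exact: (fsmooth_comp sz (fsmooth_prod_s (Phi z))).
have Uh : U (pi (act_map (unit_pt y))) by rewrite pi_act.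
apply/negP => /eqP e0.
have := dfun_comp evecP (msmooth_act_map (unit_pt y)) (sf _ Uh).
rewrite e0 {1}/dfun derive0.
have nE : \forall q \near unit_pt y,
    (f \o act_map) q = @prod_s R _ P q * (f \o @prod_pi R _ P) q.
  have np : \forall z \near y, U (pi z).
    exact: near_continuous (msmooth_pi y).1 (open_near oU Uy).
  have nq := near_continuous (msmooth_prod_pi (unit_pt y)).1 np.
  by apply: filterS nq => q Uq; rewrite /= /f; have [_ ->] := eqv _ Uq.
rewrite (near_dfun _ nE) dfun_mul; last 2 first.
- exact: fsmooth_prod_s.
- exact: (fsmooth_comp (msmooth_prod_pi (unit_pt y)) (sf _ Uy)).
rewrite dfun_prod_s rsubmx_evec mulr1.
rewrite -(dfun_comp evecP (msmooth_prod_pi (unit_pt y)) (sf _ Uy)) tmap_prod_pi.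
rewrite lsubmx_evec {1}/dfun derive0 mulr0 add0r => /esym fy0.
have : 0 < num (Phi y).2 by [].
by rewrite (fy0 : num (Phi y).2 = 0) ltxx.
Qed.

Section HomogeneousMetric.
Variable g : form2 P.
Hypothesis rg : riemannian g.
Hypothesis hom_g : forall t y u v, pull2 (h t) g y u v = num t * g y u v.

(* [g (Delta, Delta)], where [Delta] is the derivative of the action in the
   direction of the group at [t = 1] *)
Definition euler_norm (y : P) : R := pull2 act_map g (unit_pt y) evecP evecP.

Lemma euler_norm_gt0 y : 0 < euler_norm y.
Proof. by have [_ _ pos] := rg; apply: pos; exact: euler_neq0. Qed.

Lemma fsmooth_euler_norm y : fsmooth euler_norm y.
Proof.
apply: fsmooth_slice_ee; apply: smooth_pull2; first exact: msmooth_act_map.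
by have [] := rg.
Qed.

(** As R_+ is commutative, h_t commutes with the whole action and therefore preserves Delta;
    homogeneity of g then gives the factor t. *)
Lemma euler_norm_act t y : euler_norm (h t y) = num t * euler_norm y.
Proof.
pose K (q : PN) : PN := (h t q.1, q.2).
have sK q : msmooth K q by apply: msmooth_fst_map; exact: msmooth_act.
have aK : act_map \o K = h t \o act_map.
  apply/funext => -[z r]; rewrite /= /act_map /= -!actM.
  by rewrite Rplus_mulC.
have E : tmap act_map (unit_pt (h t y)) evecP =
    tmap (h t) (act_map (unit_pt y)) (tmap act_map (unit_pt y) evecP).
  rewrite -(tmap_comp evecP (msmooth_act_map (unit_pt y)) (msmooth_act t _)) -aK.
  rewrite (tmap_comp evecP (sK _) (msmooth_act_map _)).
  by rewrite tmap_fst_map_evec //; exact: msmooth_act.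
rewrite /euler_norm -hom_g /pull2 E.
by rewrite -[act_map (unit_pt (h t y))]/((act_map \o K) (unit_pt y)) aK.
Qed.

Definition euler_triv (y : P) : N := (pi y, to_Rplus (euler_norm y)).

Lemma num_euler_triv y : num (euler_triv y).2 = euler_norm y.
Proof. exact: to_Rplus_num (euler_norm_gt0 y). Qed.

Lemma msmooth_euler_triv y : msmooth euler_triv y.
Proof.
apply: msmooth_prod; first exact: msmooth_pi.
have -> : (fun z => num (euler_triv z).2) = euler_norm.
  by apply/funext => z; exact: num_euler_triv.
exact: fsmooth_euler_norm.
Qed.

Lemma euler_triv_act t y : euler_triv (h t y) = prod_act t (euler_triv y).
Proof.
have e : num (euler_triv (h t y)).2 = num t * num (euler_triv y).2.
  exact: (etrans (num_euler_triv (h t y)) (etrans (euler_norm_act t y)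
    (congr1 ( *%R (num t)) (esym (num_euler_triv y))))).
exact: (congr2 (fun a b => (a, b) : N) (pi_act t y)
  (Rplus_inj (t := Rplus_mul t (euler_triv y).2) e)).
Qed.

(** Two points of a fibre differ by some h_t, which multiplies the positive norm by t; equal norms
    force t = 1. *)
Lemma euler_triv_inj y y' : euler_triv y = euler_triv y' -> y = y'.
Proof.
move=> e; have [t tE] := fiber_orbit (congr1 fst e).
have e2 : euler_norm y = num t * euler_norm y.
  have e3 : num (euler_triv y).2 = num (euler_triv (h t y)).2 by rewrite -tE e.
  exact: (etrans (esym (num_euler_triv y)) (etrans e3
    (etrans (num_euler_triv (h t y)) (euler_norm_act t y)))).
have t1 : num t = num (1%:pos : {posnum R}).
  apply: (mulIf (lt0r_neq0 (euler_norm_gt0 y))).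
  by rewrite -[LHS]e2 [RHS]mul1r.
by rewrite tE (Rplus_inj (t := (1%:pos : {posnum R})) t1) act1.
Qed.

Lemma section_exists (x : M) : exists y, pi y = x.
Proof.
by have [U [sg [_ Ux]]] := local_section x; move=> /(_ x Ux) [e _]; exists (sg x).
Qed.

(** An arbitrary point of the fibre is rescaled to the prescribed norm. By [euler_triv_inj] the
    result does not depend on the point, so for smoothness the choice may be replaced by a local
    section. *)
Definition euler_triv_inv (q : N) : P :=
  let y := sval (cid (section_exists q.1)) in h (to_Rplus (num q.2 / euler_norm y)) y.

Lemma euler_triv_scale y (q : N) : pi y = q.1 ->
  euler_triv (h (to_Rplus (num q.2 / euler_norm y)) y) = q.
Proof.
move=> yq; rewrite euler_triv_act [RHS]surjective_pairing; congr pair => //.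
apply: Rplus_inj; rewrite /= !to_Rplus_num ?divr_gt0 ?euler_norm_gt0//.
by rewrite divfK// gt_eqF// euler_norm_gt0.
Qed.

Lemma euler_triv_invK q : euler_triv (euler_triv_inv q) = q.
Proof. by apply: euler_triv_scale; case: cid. Qed.

Lemma euler_trivK y : euler_triv_inv (euler_triv y) = y.
Proof. by apply: euler_triv_inj; rewrite euler_triv_invK. Qed.

Lemma msmooth_euler_triv_inv q : msmooth euler_triv_inv q.
Proof.
have [U [sg [oU Uq ssg]]] := local_section q.1.
pose Q (r : N) : PN := (sg r.1, to_Rplus (num r.2 / euler_norm (sg r.1))).
have near_U : \forall r \near q, U r.1.
  exact: near_continuous (msmooth_prod_pi q).1 (open_near oU Uq).
have ssq := msmooth_comp (@msmooth_prod_pi _ _ M q) (ssg _ Uq).2.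
have sQ : msmooth Q q.
  apply: msmooth_prod => //.
  have -> : (fun r => num (Q r).2) =
      (fun r : N => @prod_s R _ M r * ((euler_norm \o (sg \o @prod_pi R _ M)) r)^-1).
    by apply/funext => r; rewrite /= to_Rplus_num// divr_gt0// euler_norm_gt0.
  apply: fsmooth_mul; first exact: fsmooth_prod_s.
  apply: fsmooth_inv; first by rewrite gt_eqF//= euler_norm_gt0.
  exact: (fsmooth_comp ssq (fsmooth_euler_norm _)).
apply: msmooth_ext (msmooth_comp sQ (msmooth_act_map _)).
apply: filterS near_U => r Ur; apply: euler_triv_inj.
by rewrite euler_triv_invK; apply: euler_triv_scale; have [] := ssg _ Ur.
Qed.

Lemma euler_triv_inv_act t q : euler_triv_inv (prod_act t q) = h t (euler_triv_inv q).
Proof. by apply: euler_triv_inj; rewrite euler_triv_act !euler_triv_invK. Qed.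

Lemma trivialization_euler : trivialization pi h setT euler_triv.
Proof.
split; first exact: openT; exists euler_triv_inv; split.
- apply: msmooth_smooth_on; first exact: openT.
  by move=> y _; exact: msmooth_euler_triv.
- apply: msmooth_smooth_on; last by move=> q _; exact: msmooth_euler_triv_inv.
  by rewrite (_ : mkset _ = setT) //; exact: openT.
- by move=> y _; exact: euler_trivK.
- by move=> q _; split=> //; exact: euler_triv_invK.
- by move=> y _; split=> // t; exact: euler_triv_act.
Qed.

Lemma tmap_euler_trivK y u :
  tmap euler_triv_inv (euler_triv y) (tmap euler_triv y u) = u.
Proof.
rewrite -(tmap_comp u (msmooth_euler_triv y) (msmooth_euler_triv_inv _)).
have -> : euler_triv_inv \o euler_triv = id by apply/funext => z; exact: euler_trivK.
exact: tmap_id.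
Qed.

Lemma tmap_euler_triv_invK q u :
  tmap euler_triv (euler_triv_inv q) (tmap euler_triv_inv q u) = u.
Proof.
rewrite -(tmap_comp u (msmooth_euler_triv_inv q) (msmooth_euler_triv _)).
have -> : euler_triv \o euler_triv_inv = id by apply/funext => z; exact: euler_triv_invK.
exact: tmap_id.
Qed.

Lemma pull2_euler_triv_inv_hom (B : form2 P) :
  (forall t y u v, pull2 (h t) B y u v = num t * B y u v) ->
  forall t q u v, pull2 (@prod_act R m M t) (pull2 euler_triv_inv B) q u v =
    num t * pull2 euler_triv_inv B q u v.
Proof.
move=> homB t q u v.
have E : euler_triv_inv \o @prod_act R m M t = h t \o euler_triv_inv.
  by apply/funext => r; exact: euler_triv_inv_act.
have T w : tmap euler_triv_inv (prod_act t q) (tmap (@prod_act R m M t) q w) =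
    tmap (h t) (euler_triv_inv q) (tmap euler_triv_inv q w).
  rewrite -(tmap_comp w (msmooth_prod_act t q) (msmooth_euler_triv_inv _)) E.
  exact: tmap_comp (msmooth_euler_triv_inv q) (msmooth_act t _).
have congrB x x' a a' b b' : x = x' -> a = a' -> b = b' -> B x a b = B x' a' b'.
  by move=> -> -> ->.
exact: (etrans (congrB _ _ _ _ _ _ (euler_triv_inv_act t q) (T u) (T v))
  (homB t (euler_triv_inv q) (tmap euler_triv_inv q u) (tmap euler_triv_inv q v))).
Qed.

(** The inverse trivialization sends (x, s) to h_s (F x), so d/ds at s = 1 goes to Delta at F x, a
    point of norm 1. This supplies the normalization [gee]. *)
Lemma pull2_euler_triv_inv_evec x :
  pull2 euler_triv_inv g (unit_pt x) (evec R m) (evec R m) = 1.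
Proof.
pose F (x : M) := euler_triv_inv (unit_pt x).
have sF z : msmooth F z.
  exact: (msmooth_comp (msmooth_pair_cst _ z) (msmooth_euler_triv_inv _)).
pose L (q : N) : PN := (F q.1, q.2).
have sL : msmooth L (unit_pt x) by exact: msmooth_fst_map.
have E : act_map \o L = euler_triv_inv.
  apply/funext => q; apply: euler_triv_inj; rewrite euler_triv_invK /= euler_triv_act.
  rewrite euler_triv_invK [RHS]surjective_pairing; congr pair.
  by apply: Rplus_inj; rewrite /= mulr1.
have T : tmap euler_triv_inv (unit_pt x) (evec R m) = tmap act_map (unit_pt (F x)) evecP.
  rewrite -E (tmap_comp (evec R m) sL (msmooth_act_map _)).
  by rewrite tmap_fst_map_evec.
have -> : pull2 euler_triv_inv g (unit_pt x) (evec R m) (evec R m) = euler_norm (F x).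
  by rewrite /euler_norm /pull2 T -[in LHS]E.
by rewrite -num_euler_triv euler_triv_invK.
Qed.

End HomogeneousMetric.
End PrincipalBundle.

Lemma hom_almost_kahler_model (R : realType) (m : nat) (M : manifold R m)
    (P : manifold R (m + 1)) (pi : P -> M) (h : Rplus R -> P -> P) (om g : form2 P) :
  hom_almost_kahler pi h om g ->
  exists (eta : form1 M) (gM : form2 M) (mu : form1 M) (Phi : P -> prod_Rplus M),
    [/\ contact_metric eta gM, compatible eta gM mu, trivialization pi h setT Phi,
      forall y u v, om y u v = pull2 Phi (omega_of eta) y u v &
      forall y u v, g y u v = pull2 Phi (g_of gM mu) y u v].
Proof.
move=> [pb [[som clom _] rg] hom_om hom_g [J [gJ JJ]]].
pose Phi := euler_triv pi h g.
pose Psi := euler_triv_inv pb g.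
have sPsi q : msmooth Psi q by exact: msmooth_euler_triv_inv.
have PhiK y : Psi (Phi y) = y by exact: euler_trivK.
have PsiK q : Phi (Psi q) = q by exact: euler_triv_invK.
have TPhiK y u : tmap Psi (Phi y) (tmap Phi y u) = u by exact: tmap_euler_trivK.
have TPsiK q u : tmap Phi (Psi q) (tmap Psi q u) = u by exact: tmap_euler_triv_invK.
(* [J] is conjugated by the tangent maps, so that both identities for J hold for the pulled-back
   forms on the product. *)
pose J' q v := tmap Phi (Psi q) (J (Psi q) (tmap Psi q v)).
have TJ q v : tmap Psi q (J' q v) = J (Psi q) (tmap Psi q v).
  by have := TPhiK (Psi q) (J (Psi q) (tmap Psi q v)); rewrite PsiK.
have cancel (B : form2 P) y u v :
    pull2 Psi B (Phi y) (tmap Phi y u) (tmap Phi y v) = B y u v.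
  have congrB x x' a a' b b' : x = x' -> a = a' -> b = b' -> B x a b = B x' a' b'.
    by move=> -> -> ->.
  exact: congrB (PhiK y) (TPhiK y u) (TPhiK y v).
have [sg symg posg] := rg.
have [||||||||eta [gM [mu [cm co omE gE]]]] :=
  @homogeneous_product_structure R m M (pull2 Psi om) (pull2 Psi g) J'.
- by split; [exact: smooth_pull2 som.1|move=> q u; exact: som.2].
- exact: closed_pull2.
- split; [exact: smooth_pull2|by move=> q u v; exact: symg|].
  move=> q u u0; apply: posg; apply: contra_neq u0 => T0.
  by rewrite -(TPsiK q u) T0 tmap0.
- exact: pull2_euler_triv_inv_hom.
- exact: pull2_euler_triv_inv_hom.
- by move=> q u v; rewrite /pull2 gJ TJ.
- by move=> q v; rewrite {1}/J' TJ JJ (tmapN _ (msmooth_euler_triv pb rg _)) TPsiK.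
- exact: pull2_euler_triv_inv_evec.
exists eta, gM, mu, Phi; split => //.
- exact: trivialization_euler.
- by move=> y u v; exact: (etrans (esym (cancel om y u v)) (omE _ _ _)).
- by move=> y u v; exact: (etrans (esym (cancel g y u v)) (gE _ _ _)).
Qed.

Theorem theorem9p5 (R : realType) :
  (forall (m : nat) (M : manifold R m) (eta : form1 M) (gM : form2 M)
      (mu : form1 M),
    contact_metric eta gM -> compatible eta gM mu ->
    hom_almost_kahler (@prod_pi R m M) (@prod_act R m M)
      (omega_of eta) (g_of gM mu))
  /\
  (forall (m : nat) (M : manifold R m) (P : manifold R (m + 1))
      (pi : P -> M) (h : Rplus R -> P -> P) (om g : form2 P),
    hom_almost_kahler pi h om g ->
    exists (eta : form1 M) (gM : form2 M) (mu : form1 M)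
      (Phi : P -> prod_Rplus M),
      [/\ contact_metric eta gM,
          compatible eta gM mu,
          trivialization pi h setT Phi,
          forall y u v, om y u v = pull2 Phi (omega_of eta) y u v &
          forall y u v, g y u v = pull2 Phi (g_of gM mu) y u v]).
Proof.
split=> [m M eta gM mu|m M P pi h om g].
  exact: model_hom_almost_kahler.
exact: hom_almost_kahler_model.
Qed.
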